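(* Let $\tau>0$ and $g_0\in[0,1]$, and consider the transmission protocol with one-bit channel state feedback and parameters $(\tau,g_0)$ described in the context. Let $\bar{\eta}=\left[\tau+1-\frac{g_0\tau}{1-\exp(-\tau)}\right]^{-1}$. The wideband outage exponent is $$\mathcal{E}(\eta)=\begin{cases}\min\left\{\inf_{x\in(0,1)}\tilde{\mathcal{E}}(\eta,x),\ \tilde{\mathcal{E}}_0(\eta)\right\} & \text{if } \bar{\eta}\le\eta\le\frac{1}{(1-g_0)\tau},\\[4pt] \tilde{\mathcal{E}}_0(\eta) & \text{if } \eta>\frac{1}{(1-g_0)\tau},\end{cases}$$ where $$\tilde{\mathcal{E}}_0(\eta):=\sup_{\lambda\le 0}\left\{\frac{\lambda}{\eta}+\log(1-g_0\lambda)-\log\left[1-e^{-(1-g_0\lambda)\tau}\right]\right\},$$ $$\tilde{\mathcal{E}}(\eta,x):=\sup_{\lambda\le 0}\left\{\frac{\lambda}{\eta}-x\log\left[e^{(1-g_0\lambda/x)\tau}-1\right]+x\log(x-g_0\lambda)+(1-x)\log[1-x-(1-g_0)\lambda]+(1-\lambda)\tau\right\}.$$ (When $g_0=1$, $\frac{1}{(1-g_0)\tau}$ is read as $+\infty$.)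
   Context: Setting (one-bit feedback protocol over $K$ i.i.d. parallel scalar Rayleigh fading channels). Channel $k$ is $Y_k=H_kX_k+Z_k$ with $Z_k\sim\mathcal{CN}(0,1)$ and $|H_k|^2$ i.i.d. exponential with mean 1. The transmitter is told $F_k=0$ if $|H_k|^2\le\tau$ and $F_k=1$ otherwise. Let $p_0=\Pr[F_k=0]=1-e^{-\tau}$, $p_1=e^{-\tau}$, let $K_0$ be the number of channels with $F_k=0$, and $K_1=K-K_0$. Let $g_1=1-g_0$ and let $\rho>0$ be the total power. Each channel with $F_k=0$ receives power $g_0\rho/K_0$ and each channel with $F_k=1$ receives power $g_1\rho/K_1$ (if $K_0=0$ or $K_1=0$ the corresponding power $g_0\rho$ or $g_1\rho$ is wasted). The total achievable rate (in nats) is the random variable $$R(K,\rho)=\sum_{i=1}^{K_0}\log\left(1+\frac{g_0\rho}{K_0}A_i^{(0)}\right)+\sum_{j=1}^{K_1}\log\left(1+\frac{g_1\rho}{K_1}A_j^{(1)}\right)$$ (an empty sum is $0$), where $K_0\sim\mathrm{Binomial}(K,p_0)$, $A^{(0)}_1,A^{(0)}_2,\ldots$ are i.i.d. with density $e^{-x}/p_0$ on $[0,\tau]$, $A^{(1)}_1,A^{(1)}_2,\ldots$ are i.i.d. with density $e^{-x}/p_1$ on $(\tau,\infty)$, and $K_0$ and these two sequences are independent. For an energy per nat $\eta>0$, with target rate $r=\rho/\eta$, the wideband outage exponent is $$\mathcal{E}(\eta):=\lim_{K\to\infty}\frac{-\log\Pr[R(K,\rho)\le r]}{K}.$$ All logarithms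 are natural. *)

(* Defs.v *)
From HB Require Import structures.
From mathcomp Require Import all_boot all_order all_algebra.
From mathcomp Require Import finmap.
From mathcomp Require Import all_classical all_reals all_analysis.

Set Implicit Arguments.
Unset Strict Implicit.
Unset Printing Implicit Defensive.

Import Order.TTheory GRing.Theory Num.Theory.
Import numFieldNormedType.Exports.

Local Open Scope classical_set_scope.
Local Open Scope ring_scope.

Section independence.
Context {d : measure_display} {T : measurableType d} {R : realType}.
Variable P : probability T R.

Definition mutually_independent (I : choiceType) (F : I -> set (set T)) :=
  forall (J : {fset I}) (E : I -> set T),
    (forall i, i \in J -> F i (E i)) ->
    P (\bigcap_(i in [set` J]) E i) = (\prod_(i <- J) P (E i))%E.

(* The sigma-algebra generated by the random variable X. *)
Definition sigma_of {d' : measure_display} {T' : measurableType d'}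
    (X : T -> T') : set (set T) :=
  preimage_set_system [set: T] X measurable.

(* X has density f with respect to the Lebesgue measure. *)
Definition has_density (X : T -> R) (f : R -> R) :=
  forall B : set R, measurable B ->
    P (X @^-1` B) = (\int[lebesgue_measure]_(x in B) (f x)%:E)%E.

End independence.

Section protocol.
Context {R : realType}.
Implicit Types tau rho eta lambda x : R.

(* Probability that a channel reports a gain at most tau, and its complement. *)
Definition p0 tau : R := 1 - expR (- tau).
Definition p1 tau : R := expR (- tau).

(* Densities of the unit-mean exponential gain, conditioned on the feedback. *)
Definition gain_density0 tau (x : R) : R := expR (- x) / p0 tau * \1_`[0, tau] x.
Definition gain_density1 tau (x : R) : R := expR (- x) / p1 tau * \1_`]tau, +oo[ x.

(* K0 K is the number of channels, out of K, whose feedback bit is 0; the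
   sequences are indexed from 0. Index None stands for K0 K, inl i for the
   i-th gain with feedback 0 and inr j for the j-th gain with feedback 1. No
   relation is assumed between K0 K and K0 K' when K and K' differ. *)
Record one_bit_feedback {d : measure_display} {T : measurableType d}
    (P : probability T R) tau (K0 : nat -> {RV P >-> nat})
    (A0 A1 : nat -> {RV P >-> R}) : Prop := OneBitFeedback {
  K0_binomial : forall (K : nat) (U : set nat),
    P (K0 K @^-1` U) = binomial_prob K (p0 tau) U;
  A0_density : forall i : nat, has_density P (A0 i) (gain_density0 tau);
  A1_density : forall j : nat, has_density P (A1 j) (gain_density1 tau);
  K0_A0_A1_independent : forall K : nat,
    mutually_independent P (fun o : option (nat + nat) =>
      match o with
      | None => sigma_of (K0 K)
      | Some (inl i) => sigma_of (A0 i)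
      | Some (inr j) => sigma_of (A1 j)
      end) }.

(* Total rate, in nats, at the sample point w. When k0 = 0 or k0 = K one of the
   sums is empty and the corresponding power is wasted. *)
Definition total_rate {T : Type} (g0 : R) (K0 : nat -> T -> nat)
    (A0 A1 : nat -> T -> R) (K : nat) rho (w : T) : R :=
  let k0 := K0 K w in
  let k1 := (K - k0)%N in
  \sum_(i < k0) ln (1 + g0 * rho / k0%:R * A0 i w) +
  \sum_(j < k1) ln (1 + (1 - g0) * rho / k1%:R * A1 j w).

(* The target rate is rho / eta; lne 0 = -oo. *)
Definition normalized_log_outage {d : measure_display} {T : measurableType d}
    (P : probability T R) (g0 : R) (K0 : nat -> T -> nat) (A0 A1 : nat -> T -> R)
    rho eta (K : nat) : \bar R :=
  (- lne (P [set w | (total_rate g0 K0 A0 A1 K rho w <= rho / eta)%R])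
   * (K%:R^-1)%:E)%E.

(* The wideband outage exponent exists and is equal to e. *)
Definition is_wideband_outage_exponent
    {d : measure_display} {T : measurableType d}
    (P : probability T R) (g0 : R) (K0 : nat -> T -> nat) (A0 A1 : nat -> T -> R)
    rho eta (e : \bar R) :=
  normalized_log_outage P g0 K0 A0 A1 rho eta K @[K --> \oo] --> e.

Definition eta_bar tau (g0 : R) : R :=
  (tau + 1 - g0 * tau / (1 - expR (- tau)))^-1.

(* The division of R is total with 0^-1 = 0, hence the separate case g0 = 1. *)
Definition eta_max tau (g0 : R) : \bar R :=
  if g0 == 1 then +oo%E else (((1 - g0) * tau)^-1)%:E.

Definition exponent0 tau (g0 : R) eta : \bar R :=
  ereal_sup [set (lambda / eta + ln (1 - g0 * lambda)
                  - ln (1 - expR (- ((1 - g0 * lambda) * tau))))%:E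
            | lambda in [set l : R | l <= 0]].

(* The value may be +oo: at eta = eta_max the supremum is infinite. *)
Definition exponent tau (g0 : R) eta x : \bar R :=
  ereal_sup [set (lambda / eta
                  - x * ln (expR ((1 - g0 * lambda / x) * tau) - 1)
                  + x * ln (x - g0 * lambda)
                  + (1 - x) * ln (1 - x - (1 - g0) * lambda)
                  + (1 - lambda) * tau)%:E
            | lambda in [set l : R | l <= 0]].

End protocol.

(* Main.v *)
(* Write [theta = 1 / eta], so that the outage event is [R <= rho * theta], and
   split it according to the value [k] of [K0]. Every channel receives power of
   order [1 / K] and [ln (1 + z) = z + O(z ^ 2)], so that up to subexponential
   factors the outage event for [K0 = k] is the event that a weighted sum of the
   gains is at most [theta]. Quantizing the gains into cells of small width turns
   the large deviations of this event into estimates of finite sums.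

   Upper bound: Chernoff's inequality with multiplier [l * K / rho] gives the
   exponent at [x = k / K]. The multiplier can be bounded uniformly in [k] unless
   [k / K] is close to 0 or 1; there the few channels of the minority type are
   discarded, which leaves the exponents of [x -> 0], which is not smaller than
   the infimum over [x], and of [K0 = K].

   Lower bound: for fixed [x], tilt both laws of the gains by a common multiplier
   [l <= 0] under which the mean of the weighted sum is slightly below [theta],
   taking [l = 0] if this holds without tilting; Chebyshev's inequality, applied
   to the tilted sums and to [K0], then gives the exponent at [x]. The event
   [K0 = K] gives the other term of the minimum. If [theta <= (1 - g0) * tau],
   then the exponent at every [x] of the open unit interval is infinite, so only
   the event [K0 = K] matters. *)

Require Import Defs.
From HB Require Import structures.
From mathcomp Require Import all_boot all_order all_algebra.
From mathcomp Require Import finmap.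
From mathcomp Require Import all_classical all_reals all_analysis.
From mathcomp Require Import measurable_realfun ring lra.

Import Order.TTheory GRing.Theory Num.Theory.
Import numFieldNormedType.Exports.

Local Open Scope classical_set_scope.
Local Open Scope ring_scope.

(** * Finite sums and tilting *)

(** Independence is given for finitely many events at a time, so cells turn the joint law into a
    finite product and tilted laws into explicit weights; no change of measure on [T] is built. The
    lower bound avoids duality: it is never shown that the supremum over multipliers is attained, or
    that a maximizer has mean [theta]. The multiplier [l] found there causes a loss
    [- l * (2 * eps + h)], which need not be small since [l] depends on [eps]. This loss is read as
    the effect of lowering [theta], or [theta - (1 - g0) * tau], by a factor [s]; the scaling lemmas
    then compare with the exponent at [s * l], which the supremum bounds like any other. Stirling's
    formula is avoided too: ['C(K, k)] is always paired with [x ^ k * (1 - x) ^ (K - k)]; these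
    products are at most 1, and over a window around [K * x] they sum to at least 1/2. *)

Section reals.
Context {R : realType}.
Implicit Types (s h b y z c : R) (n : nat).

(** Bounds the loss in replacing a rate by a linear function of the gain: with powers of order
    [1 / K] and a multiplier of order [K], the quadratic term costs O(1 / K) per channel. *)
Lemma ln_lower_quadratic z : 0 <= z -> z - z ^+ 2 <= ln (1 + z).
Proof.
move=> z0; have z1 : 0 < 1 + z by lra.
have H : - ln (1 + z) <= (1 + z)^-1 - 1.
  rewrite -lnV ?posrE// -[X in ln X](_ : 1 + ((1 + z)^-1 - 1) = _); last by ring.
  by apply: le_ln1Dx; rewrite ltrBrDr addNr invr_gt0.
suff : z - z ^+ 2 <= 1 - (1 + z)^-1 by lra.
rewrite -(ler_pM2r z1) [leRHS]mulrBl mulVf ?gt_eqF// mul1r.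
have : 0 <= z ^+ 3 by exact: exprn_ge0.
by move=> ?; have -> : (z - z ^+ 2) * (1 + z) = z - z ^+ 3; [ring | lra].
Qed.

Lemma one_sub_expRN_le y : 1 - expR (- y) <= y.
Proof. by have := expR_ge1Dx (- y); lra. Qed.

Lemma one_sub_expRN_ge y : y * expR (- y) <= 1 - expR (- y).
Proof.
have : (1 + y) * expR (- y) <= expR y * expR (- y).
  by rewrite ler_wpM2r ?expR_ge0// expR_ge1Dx.
by rewrite expRxMexpNx_1; lra.
Qed.

Lemma mul_expRN_le c y : 0 < c -> y * expR (- (c * y)) <= c^-1.
Proof.
move=> c0; rewrite -(ler_pM2l c0) mulfV ?gt_eqF// mulrA.
apply: le_trans (one_sub_expRN_ge _) _.
by rewrite gerBl expR_ge0.
Qed.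

(* For [s != 0], the integral of [expR (- s * x)] over the interval from [a] to [b]. *)
Definition expmass a b s : R := (expR (- (s * a)) - expR (- (s * b))) / s.

(** The integral of [expR (- x)] over the [j]-th cell of width [h] to the right of [b], factored so
    that sums over [j] are geometric. *)
Definition cell_mass h b (j : nat) : R :=
  expR (- (b + j%:R * h)) * (1 - expR (- h)).

Lemma cell_mass_gt0 h b j : 0 < h -> 0 < cell_mass h b j.
Proof.
by move=> h0; rewrite mulr_gt0 ?expR_gt0// subr_gt0 expR_lt1 oppr_lt0.
Qed.

Lemma geometric_expR s h b n :
  \sum_(j < n) expR (- (s * (b + j%:R * h))) * (1 - expR (- (s * h))) =
  expR (- (s * b)) - expR (- (s * (b + n%:R * h))).
Proof.
elim: n => [|n IH]; first by rewrite big_ord0 mul0r addr0 subrr.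
rewrite big_ord_recr/= IH mulrBr mulr1 -expRD -natr1.
have -> : - (s * (b + n%:R * h)) - s * h = - (s * (b + (n%:R + 1) * h)) by ring.
ring.
Qed.

(** Rounding each gain down to the left end of its cell overestimates the tilted mass. Cell by cell
    the ratio to the exact integral is at most [expR (s * h)], because [1 - expR (- h) <= h] and [s
    * h <= expR (s * h) * (1 - expR (- (s * h)))]. *)
Lemma sum_cell_mass_low h b n s : 0 < h -> 1 <= s ->
  \sum_(j < n) cell_mass h b j * expR ((1 - s) * (b + j%:R * h)) <=
  expR (s * h) * expmass b (b + n%:R * h) s.
Proof.
move=> h0 s1; have s0 : 0 < s by lra.
have sh0 : 0 < s * h by rewrite mulr_gt0.
rewrite /expmass -geometric_expR mulrCA mulr_suml.
apply: ler_sum => j _; rewrite /cell_mass.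
have -> : expR (- (b + j%:R * h)) * (1 - expR (- h)) *
    expR ((1 - s) * (b + j%:R * h)) =
    expR (- (s * (b + j%:R * h))) * (1 - expR (- h)).
  rewrite mulrAC -expRD; congr (expR _ * _); ring.
have -> : expR (- (s * (b + j%:R * h))) * (1 - expR (- (s * h))) * (expR (s * h) / s)
  = expR (- (s * (b + j%:R * h))) * ((1 - expR (- (s * h))) * (expR (s * h) / s)) by ring.
rewrite ler_wpM2l ?expR_ge0//.
apply: (le_trans (one_sub_expRN_le h)).
have := one_sub_expRN_ge (s * h).
rewrite -(ler_pM2r (expR_gt0 (s * h))) -[leLHS]mulrA -[X in _ * X <= _]expRD addNr expR0 mulr1 => H.
by rewrite mulrA ler_pdivlMr// mulrC.
Qed.

(** The mirror bound for gains rounded up, from [h * expR (- h) <= 1 - expR (- h)] and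
    [1 - expR (- (s * h)) <= s * h]. *)
Lemma sum_cell_mass_high h b n s : 0 < h -> 1 <= s ->
  expR (- (s * h)) * expmass b (b + n%:R * h) s <=
  \sum_(j < n) cell_mass h b j * expR ((1 - s) * (b + j.+1%:R * h)).
Proof.
move=> h0 s1; have s0 : 0 < s by lra.
have sh0 : 0 < s * h by rewrite mulr_gt0.
rewrite /expmass -geometric_expR mulrCA mulr_suml.
apply: ler_sum => j _; rewrite /cell_mass.
have -> : expR (- (b + j%:R * h)) * (1 - expR (- h)) *
    expR ((1 - s) * (b + j.+1%:R * h)) =
    expR (- (s * (b + j%:R * h))) * ((1 - expR (- h)) * expR ((1 - s) * h)).
  rewrite -natr1 mulrAC -expRD [(1 - expR (- h)) * _]mulrC mulrA -expRD.
  by congr (expR _ * _); ring.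
have -> : expR (- (s * (b + j%:R * h))) * (1 - expR (- (s * h))) * (expR (- (s * h)) / s)
  = expR (- (s * (b + j%:R * h))) * ((1 - expR (- (s * h))) * (expR (- (s * h)) / s)) by ring.
rewrite ler_wpM2l ?expR_ge0//.
have -> : expR ((1 - s) * h) = expR h * expR (- (s * h)).
  by rewrite -expRD; congr expR; ring.
rewrite mulrA mulrA [X in X <= _]mulrAC ler_wpM2r ?expR_ge0//.
rewrite ler_pdivrMr//.
have := one_sub_expRN_ge h.
rewrite -(ler_pM2r (expR_gt0 h)) -mulrA -expRD addNr expR0 mulr1.
have := one_sub_expRN_le (s * h) => H1 H2; apply: (le_trans H1).
by rewrite [s * h]mulrC ler_wpM2r// ltW.
Qed.

End reals.

(** * Independent letters of a finite alphabet: Chernoff and Chebyshev *)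

Section finite_product.
Context {R : realType}.

Lemma sum_ffun_prod (C : finType) n (F : C -> R) :
  \sum_(w : {ffun 'I_n -> C}) \prod_i F (w i) = (\sum_c F c) ^+ n.
Proof.
rewrite -(@bigA_distr_bigA R 0 1 *%R +%R _ _ (fun _ c => F c)).
by rewrite prodr_const card_ord.
Qed.

(** Markov's inequality for the exponential of the total, with one multiplier for both kinds of
    letters: since [kappa <= 0], the factor [expR (kappa * (a + a' - r))] is at least 1 on the words
    that are kept. *)
Lemma sum_ffun_chernoff (C0 C1 : finType) n0 n1 (p0 L0 : C0 -> R)
    (p1 L1 : C1 -> R) (kappa r : R) :
  (forall c, 0 <= p0 c) -> (forall c, 0 <= p1 c) -> kappa <= 0 ->
  \sum_(w0 : {ffun 'I_n0 -> C0}) \sum_(w1 : {ffun 'I_n1 -> C1} |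
       \sum_i L0 (w0 i) + \sum_j L1 (w1 j) <= r)
     (\prod_i p0 (w0 i)) * (\prod_j p1 (w1 j)) <=
  expR (- (kappa * r)) * (\sum_c p0 c * expR (kappa * L0 c)) ^+ n0 *
  (\sum_c p1 c * expR (kappa * L1 c)) ^+ n1.
Proof.
move=> p00 p10 k0; rewrite -!sum_ffun_prod -mulrA mulr_suml mulr_sumr.
apply: ler_sum => w0 _; rewrite mulr_sumr mulr_sumr big_mkcond/=.
apply: ler_sum => w1 _.
have q0 : 0 <= \prod_i p0 (w0 i) by exact: prodr_ge0.
have q1 : 0 <= \prod_j p1 (w1 j) by exact: prodr_ge0.
rewrite !big_split/= -!expR_sum.
have -> : \sum_i kappa * L0 (w0 i) = kappa * \sum_i L0 (w0 i) by rewrite mulr_sumr.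
have -> : \sum_i kappa * L1 (w1 i) = kappa * \sum_i L1 (w1 i) by rewrite mulr_sumr.
set a := \sum_i _; set a' := \sum_i _.
have -> : expR (- (kappa * r)) * ((\prod_i p0 (w0 i) * expR (kappa * a)) *
  (\prod_i p1 (w1 i) * expR (kappa * a'))) = (\prod_i p0 (w0 i)) * (\prod_i p1 (w1 i))
   * expR (kappa * (a + a' - r)).
  have -> : kappa * (a + a' - r) = - (kappa * r) + kappa * a + kappa * a' by ring.
  by rewrite !expRD; ring.
case: ifPn => H; last by rewrite !mulr_ge0// expR_ge0.
rewrite ler_peMr ?mulr_ge0// -expR0 ler_expR.
by rewrite mulr_le0// subr_le0.
Qed.

Lemma sum_ffun_variance (C : finType) n (q Y : C -> R) :
  \sum_c q c = 1 -> \sum_c q c * Y c = 0 ->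
  \sum_(w : {ffun 'I_n -> C}) (\prod_i q (w i)) * (\sum_i Y (w i)) ^+ 2 =
  n%:R * \sum_c q c * Y c ^+ 2.
Proof.
move=> q1 qY.
transitivity (\sum_(w : {ffun 'I_n -> C}) \sum_i \sum_j
    (\prod_k q (w k)) * (Y (w i) * Y (w j))).
  apply: eq_bigr => w _; rewrite expr2 mulr_suml mulr_sumr.
  by apply: eq_bigr => i _; rewrite !mulr_sumr.
rewrite exchange_big/=.
under eq_bigr => i _ do rewrite exchange_big/=.
have E (i j : 'I_n) : \sum_(w : {ffun 'I_n -> C}) (\prod_k q (w k)) * (Y (w i) * Y (w j))
   = if i == j then \sum_c q c * Y c ^+ 2 else 0.
  (* The product of two letters is spread over all positions, so that the sum over words factors
     position by position. *)
  pose F (k : 'I_n) c := q c * ((if k == i then Y c else 1) * (if k == j then Y c else 1)).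
  transitivity (\sum_(w : {ffun 'I_n -> C}) \prod_k F k (w k)).
    apply: eq_bigr => w _; rewrite !big_split/=; congr (_ * (_ * _)).
      by rewrite -big_mkcond/= big_pred1_eq.
    by rewrite -big_mkcond/= big_pred1_eq.
  rewrite -bigA_distr_bigA/=; case: eqVneq => [ij|ij].
    subst j; rewrite (bigD1 i)//= /F [X in _ * X](_ : _ = 1) ?mulr1.
      by apply: eq_bigr => c _; rewrite eqxx expr2.
    apply: big1 => k ki; rewrite -[RHS]q1; apply: eq_bigr => c _.
    by rewrite (negbTE ki) !mulr1.
  rewrite (bigD1 i)//= /F [X in X * _](_ : _ = 0) ?mul0r//.
  rewrite -[RHS]qY; apply: eq_bigr => c _.
  by rewrite eqxx (negbTE ij) mulr1.
under eq_bigr => i _.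
  under eq_bigr => j _ do rewrite E.
  rewrite -big_mkcond/= (eq_bigl (pred1 i)) ?big_pred1_eq; last by move=> j; rewrite /= eq_sym.
  over.
by rewrite sumr_const card_ord mulr_natl.
Qed.

Lemma sum_ffun_chebyshev (C : finType) n (q V : C -> R) (m W e : R) :
  (forall c, 0 <= q c) -> \sum_c q c = 1 -> \sum_c q c * V c = m ->
  (forall c, 0 <= V c <= W) -> 0 < e -> (0 < n)%N ->
  1 - W ^+ 2 / (n%:R * e ^+ 2) <=
  \sum_(w : {ffun 'I_n -> C} | `|\sum_i V (w i) - n%:R * m| <= n%:R * e)
    \prod_i q (w i).
Proof.
move=> q0 q1 qm VW e0 n0.
have n0' : 0 < n%:R :> R by rewrite ltr0n.
(* The mean lies in the same interval as the values, so [W ^ 2] bounds the variance of one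
   letter. *)
have mW : 0 <= m <= W.
  rewrite -qm; apply/andP; split.
    by apply: sumr_ge0 => c _; rewrite mulr_ge0//; case/andP: (VW c).
  rewrite -[W]mul1r -q1 mulr_suml; apply: ler_sum => c _.
  by rewrite ler_wpM2l//; case/andP: (VW c).
have var := @sum_ffun_variance C n q (fun c => V c - m) q1.
have qY : \sum_c q c * (V c - m) = 0.
  under eq_bigr do rewrite mulrBr.
  by rewrite big_split/= qm sumrN -mulr_suml q1 mul1r subrr.
have {}var := var qY.
have sumY (w : {ffun 'I_n -> C}) : \sum_i (V (w i) - m) = \sum_i V (w i) - n%:R * m.
  by rewrite big_split/= sumrN sumr_const card_ord mulr_natl.
have all1 : \sum_(w : {ffun 'I_n -> C}) \prod_i q (w i) = 1.
  by rewrite sum_ffun_prod q1 expr1n.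
rewrite (bigID (fun w : {ffun 'I_n -> C} => `|\sum_i V (w i) - n%:R * m| <= n%:R * e))/= in all1.
rewrite lerBlDr -[X in X <= _]all1 lerD2l.
rewrite ler_pdivlMr; last by rewrite mulr_gt0// exprn_gt0.
rewrite -(ler_pM2l n0').
have -> : n%:R * ((\sum_(w : {ffun 'I_n -> C} | ~~ (`|\sum_i V (w i) - n%:R * m| <= n%:R * e))
    \prod_i q (w i)) * (n%:R * e ^+ 2)) =
   \sum_(w : {ffun 'I_n -> C} | ~~ (`|\sum_i V (w i) - n%:R * m| <= n%:R * e))
    (\prod_i q (w i)) * (n%:R * e) ^+ 2.
  by rewrite -mulr_suml; ring.
apply: (@le_trans _ _ (n%:R * \sum_c q c * (V c - m) ^+ 2)).
  rewrite -var [leRHS](bigID (fun w : {ffun 'I_n -> C} => `|\sum_i V (w i) - n%:R * m| <= n%:R * e))/=.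
  apply: ler_wpDl.
    by apply: sumr_ge0 => w _; rewrite mulr_ge0 ?sqr_ge0//; apply: prodr_ge0.
  apply: ler_sum => w; rewrite -ltNge => /ltW H.
  rewrite ler_wpM2l ?prodr_ge0// sumY -[leRHS]real_normK ?num_real//.
  by rewrite lerXn2r// nnegrE ?mulr_ge0// ltW.
rewrite ler_wpM2l//.
rewrite -[leRHS]mul1r -q1 mulr_suml; apply: ler_sum => c _.
rewrite ler_wpM2l// -[leLHS]real_normK ?num_real// lerXn2r ?nnegrE//.
  by case/andP: mW => /le_trans; apply.
by rewrite ler_norml; case/andP: mW; case/andP: (VW c); lra.
Qed.

End finite_product.

(** * Exponential tilting on a finite alphabet *)

Section tilting.
Context {R : realType} {C : finType}.
Variables (q V : C -> R).
Hypothesis q_gt0 : forall c, 0 < q c.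

Definition mgf (mu : R) : R := \sum_c q c * expR (mu * V c).
Definition tilted_mean (mu : R) : R := (\sum_c q c * expR (mu * V c) * V c) / mgf mu.

Lemma mgf_gt0 (c0 : C) mu : 0 < mgf mu.
Proof.
rewrite /mgf (bigD1 c0)//= ltr_pwDl ?mulr_gt0 ?expR_gt0//.
by apply: sumr_ge0 => c _; rewrite mulr_ge0 ?expR_ge0// ltW.
Qed.

(** Change of measure: under the tilted law Chebyshev confines the sum to a window of radius [n * e]
    around its mean. The upper side of the window gives the event; the lower side, with [mu <= 0],
    bounds the density of the tilted product law by the inverse of the leading power on the left. *)
Lemma sum_ffun_tilted (c0 : C) n (W e mu : R) :
  (forall c, 0 <= V c <= W) -> mu <= 0 -> 0 < e -> (0 < n)%N ->
  (mgf mu * expR (- (mu * (tilted_mean mu - e)))) ^+ n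
    * (1 - W ^+ 2 / (n%:R * e ^+ 2)) <=
  \sum_(w : {ffun 'I_n -> C} | \sum_i V (w i) <= n%:R * (tilted_mean mu + e))
    \prod_i q (w i).
Proof.
move=> VW mu0 e0 n0; have M0 := mgf_gt0 c0 mu.
set m := tilted_mean mu.
pose t c := q c * expR (mu * V c) / mgf mu.
have t0 c : 0 <= t c by rewrite !mulr_ge0 ?expR_ge0 ?invr_ge0 ?ltW.
have t1 : \sum_c t c = 1 by rewrite -mulr_suml mulfV// gt_eqF.
have tm : \sum_c t c * V c = m.
  by rewrite /m /tilted_mean mulr_suml; apply: eq_bigr => c _; rewrite /t; ring.
have := @sum_ffun_chebyshev R C n t V m W e t0 t1 tm VW e0 n0.
move=> /(ler_wpM2l (_ : 0 <= (mgf mu * expR (- (mu * (m - e)))) ^+ n)).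
move=> /(_ _)/le_trans; apply.
  by rewrite exprn_ge0// mulr_ge0 ?expR_ge0// ltW.
rewrite mulr_sumr [leRHS]big_mkcond [leLHS]big_mkcond/=; apply: ler_sum => w _.
have P0 : 0 <= \prod_i q (w i) by apply: prodr_ge0 => i _; exact/ltW.
case: ifPn => [H|_]; last by case: ifP.
rewrite ifT; last by move: H; rewrite ler_norml; lra.
have -> : \prod_i t (w i) = (\prod_i q (w i)) * expR (mu * \sum_i V (w i)) / mgf mu ^+ n.
  rewrite !big_split/= prodr_const card_ord -expR_sum -mulr_sumr exprVn//.
rewrite exprMn -expRM_natl.
have Mn0 : mgf mu ^+ n != 0 by rewrite expf_neq0// gt_eqF.
set E1 := expR _; set E2 := expR _; set P := \prod_i _.
have -> : mgf mu ^+ n * E1 * (P * E2 / mgf mu ^+ n) = P * (E1 * E2) by field.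
rewrite ler_piMr// /E1 /E2 -expRD expR_le1.
rewrite (_ : _ + _ = mu * (\sum_i V (w i) - n%:R * m + n%:R * e)); last by ring.
by rewrite mulr_le0_ge0//; move: H; rewrite ler_norml; lra.
Qed.

Lemma continuous_tilted_mean (c0 : C) : continuous tilted_mean.
Proof.
move=> mu; have ce c : {for mu, continuous (fun x : R => expR (x * V c))}.
  apply: continuous_comp; last exact: continuous_expR.
  by apply: cvgM; [exact: cvg_id | exact: cvg_cst].
apply: cvgM.
  apply: cvg_big => [|c _]; first exact: add_continuous.
  apply: cvgM; last exact: cvg_cst.
  by apply: cvgM; [exact: cvg_cst | exact: ce].
apply: cvgV; first by rewrite gt_eqF// (mgf_gt0 c0).
apply: cvg_big => [|c _]; first exact: add_continuous.
by apply: cvgM; [exact: cvg_cst | exact: ce].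
Qed.

(** A strong negative tilt concentrates at the minimum [V c0]: [mul_expRN_le] with [y = V c - V c0]
    bounds the excess in the numerator, and the single letter [c0] bounds [mgf] from below. *)
Lemma tilted_mean_le (c0 : C) (L : R) : (forall c, V c0 <= V c) -> 0 < L ->
  tilted_mean (- L) <= V c0 + (\sum_c q c) / (q c0 * L).
Proof.
move=> Vmin L0; rewrite /tilted_mean ler_pdivrMr; last exact: (mgf_gt0 c0).
rewrite mulrDl -lerBlDl mulr_sumr -sumrB.
have H1 : \sum_c (q c * expR (- L * V c) * V c - V c0 * (q c * expR (- L * V c)))
   <= (\sum_c q c) * (expR (- (L * V c0)) / L).
  rewrite mulr_suml; apply: ler_sum => c _.
  have -> : q c * expR (- L * V c) * V c - V c0 * (q c * expR (- L * V c)) =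
     q c * (expR (- (L * V c0)) * ((V c - V c0) * expR (- (L * (V c - V c0))))).
    rewrite (_ : - L * V c = - (L * V c0) + (- (L * (V c - V c0)))); last by ring.
    by rewrite expRD; ring.
  by rewrite !ler_wpM2l ?expR_ge0 ?mul_expRN_le// ltW.
apply: (le_trans H1).
have H2 : q c0 * expR (- (L * V c0)) <= mgf (- L).
  rewrite /mgf (bigD1 c0)//= mulNr lerDl.
  by apply: sumr_ge0 => c _; rewrite mulr_ge0 ?expR_ge0// ltW.
have -> : (\sum_c q c) * (expR (- (L * V c0)) / L) =
  (\sum_c q c) / (q c0 * L) * (q c0 * expR (- (L * V c0))).
  by field; rewrite !gt_eqF.
apply: ler_wpM2l H2.
by rewrite divr_ge0 ?sumr_ge0// ?mulr_ge0// => *; exact/ltW.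
Qed.

End tilting.

Lemma ivt_or_zero {R : realType} (m : R -> R) (L a : R) : 0 <= L ->
  continuous m -> m (- L) <= a ->
  exists l, [/\ l <= 0, m l <= a & l * m l = l * a].
Proof.
move=> L0 mc mL; have [m0|m0] := leP (m 0) a.
  by exists 0; split; rewrite ?mul0r.
have [|||l] := @IVT R m (- L) 0 a.
- lra.
- exact: continuous_subspaceT.
- by rewrite ge_min mL/= le_max (ltW m0) orbT.
- by rewrite in_itv/= => /andP[_ l0] E; exists l; rewrite E.
Qed.

(** * Probabilities of cells of gains *)

Section finite_unions.
Context {R : realType} {d : measure_display} {T : measurableType d}.
Variable P : probability T R.

Lemma le_measure_cover (I : finType) (E : set T) (B : I -> set T) :
  measurable E -> (forall i, measurable (B i)) -> E `<=` \bigcup_i B i ->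
  (P E <= \sum_i P (B i))%E.
Proof.
move=> mE mB EB.
have H (s : seq I) : (P (\big[setU/set0]_(i <- s) B i) <= \sum_(i <- s) P (B i))%E.
  elim: s => [|i s IH]; first by rewrite !big_nil measure0.
  rewrite !big_cons; apply: (le_trans (measureU2 _ _ _)) => //.
    exact: bigsetU_measurable.
  exact: leeD2l.
apply: le_trans (H (index_enum I)).
apply: le_measure; rewrite ?inE//; first exact: bigsetU_measurable.
by move=> w /EB[i _ Bi]; rewrite -bigcup_seq; exists i => //=; rewrite mem_index_enum.
Qed.

Lemma ge_measure_disjoint (I : finType) (Q : pred I) (E : set T) (B : I -> set T) :
  measurable E -> (forall i, measurable (B i)) -> (forall i, Q i -> B i `<=` E) ->
  (forall i j w, B i w -> B j w -> i = j) ->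
  (\sum_(i | Q i) P (B i) <= P E)%E.
Proof.
move=> mE mB BE dB.
have H (s : seq I) : uniq s ->
    (\sum_(i <- s | Q i) P (B i) = P (\big[setU/set0]_(i <- s | Q i) B i))%E.
  elim: s => [|i s IH]; first by rewrite !big_nil measure0.
  rewrite /= => /andP[i_s us]; rewrite !big_cons; case: ifP => Qi; last exact: IH.
  rewrite measureU//; first by rewrite IH.
    exact: bigsetU_measurable.
  apply/seteqP; split=> // w [Biw]; rewrite -bigcup_seq_cond => -[j /= /andP[js _] Bjw].
  by move: i_s; rewrite (dB _ _ _ Biw Bjw) js.
rewrite H ?index_enum_uniq//; apply: le_measure; rewrite ?inE//.
  exact: bigsetU_measurable.
by move=> w; rewrite -bigcup_seq_cond => -[j /= /andP[_ Qj] Bjw]; exact: BE Bjw.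
Qed.

End finite_unions.

Section exponential_density.
Context {R : realType} {d : measure_display} {T : measurableType d}.
Variable P : probability T R.

Lemma integral_expRN_itv (p a b : R) : a < b ->
  (\int[lebesgue_measure]_(x in `]a, b]) (expR (- x) / p)%:E =
   ((expR (- a) - expR (- b)) / p)%:E)%E.
Proof.
move=> ab.
have ce : continuous (fun x : R => expR (- x) / p).
  move=> x; apply: cvgM; last exact: cvg_cst.
  by apply: continuous_comp; [exact: opp_continuous | exact: continuous_expR].
rewrite integral_itv_obnd_cbnd; last first.
  apply/measurable_realfun.measurable_EFinP; apply: measurable_funTS.
  exact: continuous_measurable_fun.
have D (x : R) : is_derive x 1 (fun x : R => - (expR (- x) / p)) (expR (- x) / p).
  apply: is_derive_eq; rewrite /GRing.scale/=.
  by ring.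
rewrite (@continuous_FTC2 _ _ (fun x => - (expR (- x) / p)))//.
- by rewrite -EFinB; congr EFin; ring.
- exact: continuous_subspaceT.
- split.
  + by move=> x _; exact: ex_derive.
  + by apply: cvg_at_right_filter; apply: cvgN; exact: ce.
  + by apply: cvg_at_left_filter; apply: cvgN; exact: ce.
- by move=> x _; rewrite derive1E; exact: derive_val.
Qed.

Lemma density_itv (X : T -> R) (p a b : R) (I : set R) :
  has_density P X (fun x => expR (- x) / p * \1_I x) ->
  `]a, b] `<=` I -> a < b ->
  P (X @^-1` `]a, b]) = ((expR (- a) - expR (- b)) / p)%:E.
Proof.
move=> dX abI ab; rewrite dX// -integral_expRN_itv//.
apply: eq_integral => x; rewrite inE => xab.
by rewrite indicE mem_set ?mulr1//; exact: abI.
Qed.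

Lemma density_null (X : T -> R) (p : R) (I B : set R) : measurable B ->
  has_density P X (fun x => expR (- x) / p * \1_I x) ->
  B `&` I = set0 -> P (X @^-1` B) = 0%E.
Proof.
move=> mB dX BI; rewrite dX//; apply: integral0_eq => x Bx.
rewrite indicE memNset ?mulr0// => Ix.
by have : (B `&` I) x by []; rewrite BI.
Qed.

End exponential_density.

(** * Joint law of the feedback and the gains, cell by cell *)

Section independence.
Context {R : realType} {d : measure_display} {T : measurableType d}.
Variables (P : probability T R) (tau : R).
Variables (K0 : nat -> {RV P >-> nat}) (A0 A1 : nat -> {RV P >-> R}).
Hypothesis feedback : one_bit_feedback tau K0 A0 A1.

Lemma feedback_joint K k n (U : 'I_k -> set R) (V : 'I_n -> set R) :
  (forall i, measurable (U i)) -> (forall j, measurable (V j)) ->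
  P [set w | [/\ K0 K w = k, forall i : 'I_k, U i (A0 i w) &
                 forall j : 'I_n, V j (A1 j w)]] =
  (P (K0 K @^-1` [set k]) * (\prod_(i < k) P (A0 i @^-1` U i)) *
   (\prod_(j < n) P (A1 j @^-1` V j)))%E.
Proof.
move=> mU mV.
(* The family [E] must be given at every index of [option (nat + nat)], so [U] and [V] are extended
   by the whole line outside their ranges. *)
pose U' i : set R := if insub i is Some i' then U i' else setT.
pose V' i : set R := if insub i is Some i' then V i' else setT.
have U'E (i : 'I_k) : U' i = U i by rewrite /U' valK.
have V'E (i : 'I_n) : V' i = V i by rewrite /V' valK.
have mU' i : measurable (U' i) by rewrite /U'; case: insubP.
have mV' i : measurable (V' i) by rewrite /V'; case: insubP.
pose E (o : option (nat + nat)) : set T := match o with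
  | None => K0 K @^-1` [set k]
  | Some (inl i) => A0 i @^-1` U' i
  | Some (inr j) => A1 j @^-1` V' j end.
pose s : seq (option (nat + nat)) := None :: [seq Some (inl i) | i <- iota 0 k]
   ++ [seq Some (inr j) | j <- iota 0 n].
have us : uniq s.
  rewrite /s /= mem_cat negb_or cat_uniq !map_inj_uniq ?iota_uniq/=; last 2 first.
  - by move=> ? ? [].
  - by move=> ? ? [].
  rewrite andbT; apply/andP; split; last first.
    by apply/hasPn => o /mapP[j _ ->]; apply/mapP => -[].
  by apply/andP; split; apply/mapP => -[].
have memJ o : (o \in [fset o in s]%fset) = (o \in s).
  by apply/imfsetP/idP => [[x xs ->]//|os]; exists o.
have := @K0_A0_A1_independent _ _ _ _ _ _ _ _ feedback K [fset o in s]%fset E.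
have -> : \bigcap_(i in [set` [fset o in s]%fset]) E i =
  [set w | [/\ K0 K w = k, forall i : 'I_k, U i (A0 i w) &
                 forall j : 'I_n, V j (A1 j w)]].
  apply/seteqP; split => [w H|w [H1 H2 H3] o].
    split.
    - by apply: (H None); rewrite /= memJ.
    - move=> i; rewrite -U'E; apply: (H (Some (inl (val i)))).
      rewrite /= memJ in_cons mem_cat map_f ?orbT//.
      by rewrite mem_iota/= add0n.
    - move=> i; rewrite -V'E; apply: (H (Some (inr (val i)))).
      rewrite /= memJ in_cons mem_cat (map_f (fun j => Some (inr j))) ?orbT//.
      by rewrite mem_iota/= add0n.
  rewrite /= memJ in_cons mem_cat => /or3P[/eqP ->//|/mapP[i]|/mapP[i]];
    rewrite mem_iota/= add0n => ik -> /=.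
  - by have := H2 (Ordinal ik); rewrite -U'E.
  - by have := H3 (Ordinal ik); rewrite -V'E.
move=> ->.
  rewrite (perm_big s)/=; last first.
    by apply: uniq_perm; rewrite ?fset_uniq.
  rewrite /s big_cons big_cat !big_map /= muleA.
  rewrite -[X in iota 0 X]subn0 big_mkord -[X in iota 0 X]subn0 big_mkord.
  congr (_ * _ * _)%E; apply: eq_bigr => i _; by rewrite ?U'E ?V'E.
move=> [[i|j]|] _ /=.
- by exists (U' i); rewrite ?setTI.
- by exists (V' j); rewrite ?setTI.
- by exists [set k]; rewrite ?setTI.
Qed.

Lemma K0_pmf K k : 0 < tau ->
  P (K0 K @^-1` [set k]) = (binomial_pmf K (p0 tau) k)%:E.
Proof.
move=> tau0.
have p01 : 0 <= p0 tau <= 1.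
  rewrite /p0 subr_ge0 gerBl expR_ge0 andbT.
  by rewrite expR_le1 oppr_le0 ltW.
rewrite (K0_binomial feedback) /binomial_prob ifT// esum_set1//.
by rewrite lee_fin binomial_pmf_ge0.
Qed.

Lemma K0_gt_null K : 0 < tau -> P (K0 K @^-1` [set k | (K < k)%N]) = 0%E.
Proof.
move=> tau0.
have p01 : 0 <= p0 tau <= 1.
  rewrite /p0 subr_ge0 gerBl expR_ge0 andbT.
  by rewrite expR_le1 oppr_le0 ltW.
rewrite (K0_binomial feedback) /binomial_prob ifT// esum1// => k /= Kk.
by rewrite /binomial_pmf bin_small.
Qed.

Lemma measurable_sums_le K k n (u v : R -> R) (r : R) :
  measurable_fun setT u -> measurable_fun setT v ->
  measurable [set w | K0 K w = k /\
    \sum_(i < k) u (A0 i w) + \sum_(j < n) v (A1 j w) <= r].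
Proof.
move=> mu mv.
set E := [set w | _].
have -> : E = (K0 K @^-1` [set k]) `&`
  ((fun w => \sum_(i < k) u (A0 i w) + \sum_(j < n) v (A1 j w)) @^-1` `]-oo, r]).
  by apply/seteqP; split => w; rewrite /E /= in_itv.
apply: measurableI.
  by rewrite -[X in measurable X]setTI; exact: measurable_funP.
rewrite -[X in measurable X]setTI.
have mf : measurable_fun setT
    (fun w => \sum_(i < k) u (A0 i w) + \sum_(j < n) v (A1 j w)).
  apply: measurable_funD.
    by apply: measurable_sum => i; exact: measurableT_comp.
  by apply: measurable_sum => i; exact: measurableT_comp.
exact: mf.
Qed.

Section cells.
Variables (C0 C1 : finType) (S0 : C0 -> set R) (S1 : C1 -> set R).
Variables (q0 : C0 -> R) (q1 : C1 -> R).
Hypothesis mS0 : forall c, measurable (S0 c).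
Hypothesis mS1 : forall c, measurable (S1 c).
Hypothesis q0E : forall i c, P (A0 i @^-1` S0 c) = (q0 c)%:E.
Hypothesis q1E : forall j c, P (A1 j @^-1` S1 c) = (q1 c)%:E.
Hypothesis tau_gt0 : 0 < tau.

Definition cell_event K k n (w0 : {ffun 'I_k -> C0}) (w1 : {ffun 'I_n -> C1}) :=
  [set w | [/\ K0 K w = k, forall i : 'I_k, S0 (w0 i) (A0 i w) &
                 forall j : 'I_n, S1 (w1 j) (A1 j w)]].

Lemma measurable_cell_event K k n w0 w1 : measurable (@cell_event K k n w0 w1).
Proof.
have -> : cell_event K _ _ w0 w1 = (K0 K @^-1` [set k]) `&`
   (\bigcap_(i in [set: 'I_k]) A0 i @^-1` S0 (w0 i)) `&`
   (\bigcap_(j in [set: 'I_n]) A1 j @^-1` S1 (w1 j)).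
  apply/seteqP; split => w.
    by move=> [H1 H2 H3]; split; first split => //; move=> ? _ /=.
  by move=> [[H1 H2] H3]; split=> // i; [apply: H2 | apply: H3].
apply: measurableI; first apply: measurableI.
- by rewrite -[X in measurable X]setTI; exact: measurable_funP.
- apply: fin_bigcap_measurable => // i _.
  by rewrite -[X in measurable X]setTI; exact: measurable_funP.
- apply: fin_bigcap_measurable => // i _.
  by rewrite -[X in measurable X]setTI; exact: measurable_funP.
Qed.

Lemma cell_eventE K k n w0 w1 : P (@cell_event K k n w0 w1) =
  (binomial_pmf K (p0 tau) k * ((\prod_i q0 (w0 i)) * (\prod_j q1 (w1 j))))%:E.
Proof.
rewrite (feedback_joint K k n (fun i => S0 (w0 i)) (fun j => S1 (w1 j)))// K0_pmf//.
transitivity ((binomial_pmf K (p0 tau) k)%:E * (\prod_(i < k) (q0 (w0 i))%:E) *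
   (\prod_(j < n) (q1 (w1 j))%:E))%E.
  by congr (_ * _ * _)%E; apply: eq_bigr => i _.
by rewrite !prodEFin -!EFinM mulrA.
Qed.

Let q0_ge0 c : 0 <= q0 c. Proof. by rewrite -lee_fin -(q0E 0). Qed.
Let q1_ge0 c : 0 <= q1 c. Proof. by rewrite -lee_fin -(q1E 0). Qed.
Let pmf_ge0 K k : 0 <= binomial_pmf K (p0 tau) k.
Proof. by rewrite -lee_fin -K0_pmf. Qed.

(* Null cells may violate the bounds: this is needed for the values below the
   support of the gain, some of which are negative. *)
Lemma feedback_chernoff K k n (u v : R -> R) (L0 : C0 -> R) (L1 : C1 -> R)
    (kappa r : R) :
  measurable_fun setT u -> measurable_fun setT v ->
  (forall x, exists c, S0 c x) -> (forall x, exists c, S1 c x) ->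
  (forall c, q0 c = 0 \/ forall x, S0 c x -> L0 c <= u x) ->
  (forall c, q1 c = 0 \/ forall x, S1 c x -> L1 c <= v x) ->
  kappa <= 0 ->
  (P [set w | K0 K w = k /\
        (\sum_(i < k) u (A0 i w) + \sum_(j < n) v (A1 j w) <= r)%R]
   <= (binomial_pmf K (p0 tau) k * (expR (- (kappa * r)) *
      (\sum_c q0 c * expR (kappa * L0 c)) ^+ k *
      (\sum_c q1 c * expR (kappa * L1 c)) ^+ n))%:E)%E.
Proof.
move=> mu mv cov0 cov1 low0 low1 kappa0.
set E := [set w | _].
have mE : measurable E by exact: measurable_sums_le.
pose I := ({ffun 'I_k -> C0} * {ffun 'I_n -> C1})%type.
have cover : E `<=` \bigcup_(c : I) (E `&` cell_event K _ _ c.1 c.2).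
  move=> w Ew.
  have [w0 Hw0] := choice (fun i : 'I_k => cov0 (A0 i w)).
  have [w1 Hw1] := choice (fun j : 'I_n => cov1 (A1 j w)).
  exists ([ffun i => w0 i], [ffun j => w1 j]) => //; split=> //.
  by split=> [|i|j]; rewrite ?ffunE//; case: Ew.
have mEc (c : I) : measurable (E `&` cell_event K _ _ c.1 c.2).
  by apply: measurableI => //; exact: measurable_cell_event.
apply: (le_trans (le_measure_cover P _ _ _ mE mEc cover)).
have := sum_ffun_chernoff C0 C1 k n q0 L0 q1 L1 kappa r q0_ge0 q1_ge0 kappa0.
move=> /(ler_wpM2l (pmf_ge0 K k)); rewrite -lee_fin; apply: le_trans.
rewrite mulr_sumr -sumEFin -(pair_bigA _ (fun w0 w1 => P (E `&` cell_event K _ _ w0 w1)))/=.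
apply: lee_sum => w0 _; rewrite mulr_sumr -sumEFin big_mkcond [leRHS]big_mkcond/=.
apply: lee_sum => w1 _; case: ifPn => H.
  rewrite -cell_eventE; apply: le_measure; rewrite ?inE//.
  - exact: (mEc (w0, w1)).
  - exact: measurable_cell_event.
(* The word fails the condition on its lowest values and must contribute 0: either it contains a
   null cell, or none of its sample points lies in the event. *)
case: (pselect (exists i, q0 (w0 i) = 0)) => [[i qi]|N0].
  rewrite (_ : 0 = P (cell_event K _ _ w0 w1))%E; last first.
    by rewrite cell_eventE (bigD1 i)//= qi !mul0r mulr0.
  apply: le_measure; rewrite ?inE//.
  - exact: (mEc (w0, w1)).
  - exact: measurable_cell_event.
case: (pselect (exists j, q1 (w1 j) = 0)) => [[j qj]|N1].
  rewrite (_ : 0 = P (cell_event K _ _ w0 w1))%E; last first.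
    by rewrite cell_eventE (bigD1 j)//= qj !mul0r !mulr0.
  apply: le_measure; rewrite ?inE//.
  - exact: (mEc (w0, w1)).
  - exact: measurable_cell_event.
rewrite (_ : _ `&` _ = set0) ?measure0//.
apply/seteqP; split=> // w [[Kw Hr] [_ H0 H1]].
case/negP: H; apply: le_trans Hr; apply: lerD.
  by apply: ler_sum => i _; case: (low0 (w0 i)) => [qi|]; [case: N0; exists i | apply].
by apply: ler_sum => j _; case: (low1 (w1 j)) => [qj|]; [case: N1; exists j | apply].
Qed.

(** From below, disjoint cells suffice and need not cover the line; gains are replaced by upper
    values. Separate budgets [a0] and [a1] for the two sums make the bound factor. *)
Lemma feedback_lower K k n (E : set T) (V0 : C0 -> R) (V1 : C1 -> R) (a0 a1 : R) :
  measurable E ->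
  (forall c c' x, S0 c x -> S0 c' x -> c = c') ->
  (forall c c' x, S1 c x -> S1 c' x -> c = c') ->
  (forall c x, S0 c x -> 0 <= x <= V0 c) -> (forall c x, S1 c x -> 0 <= x <= V1 c) ->
  (forall w, K0 K w = k -> (forall i : 'I_k, 0 <= A0 i w) ->
     (forall j : 'I_n, 0 <= A1 j w) ->
     \sum_(i < k) A0 i w <= a0 -> \sum_(j < n) A1 j w <= a1 -> E w) ->
  ((binomial_pmf K (p0 tau) k *
    ((\sum_(w0 : {ffun 'I_k -> C0} | \sum_i V0 (w0 i) <= a0) \prod_i q0 (w0 i)) *
     (\sum_(w1 : {ffun 'I_n -> C1} | \sum_j V1 (w1 j) <= a1) \prod_j q1 (w1 j))))%:E
   <= P (E `&` (K0 K @^-1` [set k])))%E.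
Proof.
move=> mE d0 d1 up0 up1 HE.
pose I := ({ffun 'I_k -> C0} * {ffun 'I_n -> C1})%type.
have mB (c : I) : measurable (cell_event K _ _ c.1 c.2) by exact: measurable_cell_event.
have mE' : measurable (E `&` (K0 K @^-1` [set k])).
  apply: measurableI => //.
  by rewrite -[X in measurable X]setTI; exact: measurable_funP.
pose Q (c : I) := (\sum_i V0 (c.1 i) <= a0) && (\sum_i V1 (c.2 i) <= a1).
have := ge_measure_disjoint P _ Q _ _ mE' mB => ge_measure.
have sub (c : I) : Q c -> cell_event K _ _ c.1 c.2 `<=` E `&` (K0 K @^-1` [set k]).
  move=> /andP[Q0 Q1] w [Kw H0 H1]; split => //; apply: HE => //.
  - by move=> i; case/andP: (up0 _ _ (H0 i)).
  - by move=> i; case/andP: (up1 _ _ (H1 i)).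
  - by apply: le_trans Q0; apply: ler_sum => i _; case/andP: (up0 _ _ (H0 i)).
  - by apply: le_trans Q1; apply: ler_sum => i _; case/andP: (up1 _ _ (H1 i)).
apply: le_trans (ge_measure sub _); last first.
  move=> [v0 v1] [v0' v1'] w /= [_ H0 H1] [_ H0' H1'].
  congr pair; apply/ffunP => i; first exact: d0 (H0 i) (H0' i).
  exact: d1 (H1 i) (H1' i).
rewrite big_distrlr/= mulr_sumr -sumEFin.
rewrite -(pair_big (fun w0 : {ffun 'I_k -> C0} => \sum_i V0 (w0 i) <= a0)
  (fun w1 : {ffun 'I_n -> C1} => \sum_i V1 (w1 i) <= a1)
  (fun w0 w1 => P (cell_event K _ _ w0 w1)))/=.
apply: lee_sum => w0 _; rewrite mulr_sumr -sumEFin.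
by apply: lee_sum => w1 _; rewrite cell_eventE.
Qed.

End cells.
End independence.

(** * Quantized gains *)

Section quantization.
Context {R : realType}.
Variables (h b : R) (n : nat).
Hypotheses (h_gt0 : 0 < h) (b_ge0 : 0 <= b).

Definition cell (j : nat) : set R := `]b + j%:R * h, b + j.+1%:R * h].

(** A finite partition of the whole line, since the gains lie in their supports only almost surely:
    [None] is the null part up to [b], [Some None] the tail beyond the cells. *)
Definition full_cell (c : option (option 'I_n)) : set R :=
  match c with
  | Some (Some j) => cell j
  | Some None => `]b + n%:R * h, +oo[
  | None => `]-oo, b]
  end.

(** Here [p] is the normalizing constant of the conditional density and [o] the unnormalized mass of
    the tail. *)
Definition full_mass (p o : R) (c : option (option 'I_n)) : R :=
  match c with
  | Some (Some j) => cell_mass h b j / p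
  | Some None => o / p
  | None => 0
  end.

Definition low_value (c : option (option 'I_n)) : R :=
  match c with
  | Some (Some j) => b + j%:R * h
  | Some None => b + n%:R * h
  | None => 0
  end.

Lemma measurable_cell j : measurable (cell j). Proof. exact: measurable_itv. Qed.

Lemma measurable_full_cell c : measurable (full_cell c).
Proof. by case: c => [[j|]|] /=; exact: measurable_itv. Qed.

Lemma full_cell_cover x : exists c, full_cell c x.
Proof.
have [xb|bx] := leP x b; first by exists None; rewrite /= in_itv.
have [xn|nx] := leP x (b + n%:R * h); last first.
  by exists (Some None); rewrite /= in_itv/= nx.
suff [j jn Hj] : exists2 j, (j < n)%N & cell j x.
  by exists (Some (Some (Ordinal jn))).
elim: n xn => [|m IH] xm; first by move: xm; rewrite mul0r addr0 leNgt bx.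
have [xm'|mx] := leP x (b + m%:R * h).
  by have [j jm Hj] := IH xm'; exists j => //; exact: ltnW.
by exists m => //; rewrite /cell /= in_itv/= mx.
Qed.

Lemma cell_disjoint (i j : nat) x : cell i x -> cell j x -> i = j.
Proof.
wlog ij : i j / (i <= j)%N.
  move=> H ci cj; case: (leqP i j) => [/H|/ltnW /H]; first exact.
  by move=> /(_ cj ci).
rewrite /cell /= !in_itv/= => /andP[_ xi] /andP[jx _].
apply/eqP; rewrite eqn_leq ij leqNgt; apply/negP => lt_ij.
have : b + j%:R * h < b + i.+1%:R * h by exact: lt_le_trans xi.
by rewrite ltrD2l ltr_pM2r// ltr_nat ltnS leqNgt lt_ij.
Qed.

Lemma cell_bounds j x : cell j x -> 0 <= x <= b + j.+1%:R * h.
Proof.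
rewrite /cell /= in_itv/= => /andP[jx ->]; rewrite andbT.
by apply: le_trans (ltW jx); rewrite addr_ge0// mulr_ge0// ltW.
Qed.

Lemma low_value_le c : 0 <= low_value c <= b + n%:R * h.
Proof.
case: c => [[j|]|] /=.
- rewrite addr_ge0 ?mulr_ge0 ?(ltW h_gt0)//= lerD2l ler_wpM2r ?(ltW h_gt0)//.
  by rewrite ler_nat ltnW.
- by rewrite addr_ge0 ?mulr_ge0 ?(ltW h_gt0)/=.
- by rewrite lexx addr_ge0 ?mulr_ge0 ?(ltW h_gt0).
Qed.

Lemma low_value_lt c x : full_cell c x -> c = None \/ low_value c <= x.
Proof.
case: c => [[j|]|] /=; rewrite /cell /= ?in_itv/=; last by left.
- by move=> /andP[/ltW]; right.
- by rewrite andbT => /ltW; right.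
Qed.

Lemma sum_option (I : finType) (F : option I -> R) :
  \sum_c F c = F None + \sum_i F (Some i).
Proof.
rewrite (bigD1 None)//=; congr (_ + _).
rewrite (reindex_omap Some id)/=; last by case.
by apply: eq_bigl => i; rewrite eqxx.
Qed.

Lemma big_full_cell (F : option (option 'I_n) -> R) :
  \sum_c F c = F None + (F (Some None) + \sum_(j < n) F (Some (Some j))).
Proof. by rewrite !sum_option. Qed.

(** Up to the quadratic error, the multiplier [kappa] of the rate is a multiplier [kappa * a] of the
    gain, which turns the density [expR (- x)] into [expR (- (s * x))] with [s = 1 - kappa * a]. The
    term in [o] is the tail, rounded down to its left end. *)
Lemma full_mass_mgf_le (p o kappa a : R) : 0 < p -> 0 <= o -> kappa <= 0 -> 0 <= a ->
  \sum_c full_mass p o c * expR (kappa * ln (1 + a * low_value c)) <=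
  expR (- (kappa * a ^+ 2 * (b + n%:R * h) ^+ 2)) *
    (expR ((1 - kappa * a) * h) * expmass b (b + n%:R * h) (1 - kappa * a) +
     o * expR (kappa * a * (b + n%:R * h))) / p.
Proof.
move=> p0 o0 k0 a0; set W := b + n%:R * h; set s := 1 - kappa * a.
have -> : kappa * a * W = (1 - s) * W by rewrite /s; ring.
have s1 : 1 <= s by rewrite /s lerBrDr gerDl mulr_le0_ge0.
have E c : expR (kappa * ln (1 + a * low_value c)) <=
  expR (- (kappa * a ^+ 2 * W ^+ 2)) * expR ((1 - s) * low_value c).
  rewrite -expRD ler_expR; have /andP[l0 lW] := low_value_le c.
  have al0 : 0 <= a * low_value c by rewrite mulr_ge0.
  have H1 := ln_lower_quadratic _ al0.
  have H2 : (a * low_value c) ^+ 2 <= a ^+ 2 * W ^+ 2.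
    by rewrite -exprMn lerXn2r ?nnegrE ?mulr_ge0 ?ler_wpM2l// (le_trans l0).
  have H3 : a * low_value c - a ^+ 2 * W ^+ 2 <= ln (1 + a * low_value c) by lra.
  have := ler_wnM2l k0 H3; rewrite /s => H4; apply: (le_trans H4).
  by rewrite le_eqVlt; apply/orP; left; apply/eqP; ring.
have q0 c : 0 <= full_mass p o c.
  case: c => [[j|]|] //=; rewrite divr_ge0 ?(ltW p0)//.
  exact/ltW/cell_mass_gt0.
apply: (@le_trans _ _ (\sum_c full_mass p o c *
   (expR (- (kappa * a ^+ 2 * W ^+ 2)) * expR ((1 - s) * low_value c)))).
  by apply: ler_sum => c _; rewrite ler_wpM2l.
rewrite big_full_cell /= mul0r add0r.
have := sum_cell_mass_low h b n s h_gt0 s1; rewrite -/W => H.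
rewrite (_ : \sum_(j < n) _ = expR (- (kappa * a ^+ 2 * W ^+ 2)) / p *
   \sum_(j < n) cell_mass h b j * expR ((1 - s) * (b + j%:R * h))); last first.
  by rewrite mulr_sumr; apply: eq_bigr => j _; ring.
rewrite -/W; set e := expR (- _); set e' := expR (_ * W).
have -> : e * (expR (s * h) * expmass b W s + o * e') / p =
  o / p * (e * e') + e / p * (expR (s * h) * expmass b W s) by ring.
by rewrite lerD2l ler_wpM2l// divr_ge0 ?expR_ge0// ltW.
Qed.

End quantization.

Section quantized_gains.
Context {R : realType} {d : measure_display} {T : measurableType d}.
Variables (P : probability T R) (tau : R).
Hypothesis tau_gt0 : 0 < tau.

Lemma p0_gt0 : 0 < p0 tau.
Proof. by rewrite /p0 subr_gt0 expR_lt1 oppr_lt0. Qed.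

Lemma p1_gt0 : 0 < p1 tau. Proof. exact: expR_gt0. Qed.

Lemma gain0_itv (X : T -> R) (a b : R) : has_density P X (gain_density0 tau) ->
  0 <= a -> a < b -> b <= tau ->
  P (X @^-1` `]a, b]) = ((expR (- a) - expR (- b)) / p0 tau)%:E.
Proof.
move=> dX a0 ab bt; apply: density_itv dX _ ab => x.
by rewrite /= !in_itv/= => /andP[ax xb]; apply/andP; split; lra.
Qed.

Lemma gain1_itv (X : T -> R) (a b : R) : has_density P X (gain_density1 tau) ->
  tau <= a -> a < b ->
  P (X @^-1` `]a, b]) = ((expR (- a) - expR (- b)) / p1 tau)%:E.
Proof.
move=> dX ta ab; apply: density_itv dX _ ab => x.
by rewrite /= !in_itv/= => /andP[ax xb]; rewrite andbT; lra.
Qed.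

Lemma cell_massE (h b : R) (j : nat) :
  cell_mass h b j = expR (- (b + j%:R * h)) - expR (- (b + j.+1%:R * h)).
Proof. by rewrite /cell_mass mulrBr mulr1 -expRD -natr1; congr (_ - expR _); ring. Qed.

Lemma gain0_cell (X : {RV P >-> R}) (h : R) n (j : 'I_n) :
  has_density P X (gain_density0 tau) -> 0 < h -> n%:R * h = tau ->
  P (X @^-1` cell h 0 j) = (cell_mass h 0 j / p0 tau)%:E.
Proof.
move=> dX h0 nh; rewrite /cell gain0_itv// ?cell_massE//.
- by rewrite add0r mulr_ge0// ltW.
- by rewrite ltrD2l ltr_pM2r// ltr_nat.
- by rewrite add0r -nh ler_wpM2r ?(ltW h0)// ler_nat.
Qed.

Lemma gain1_cell (X : {RV P >-> R}) (h : R) (j : nat) :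
  has_density P X (gain_density1 tau) -> 0 < h ->
  P (X @^-1` cell h tau j) = (cell_mass h tau j / p1 tau)%:E.
Proof.
move=> dX h0; rewrite /cell gain1_itv// ?cell_massE//.
- by rewrite lerDl mulr_ge0// ltW.
- by rewrite ltrD2l ltr_pM2r// ltr_nat.
Qed.

Lemma gain0_full_cell (X : {RV P >-> R}) (h : R) n c :
  has_density P X (gain_density0 tau) -> 0 < h -> n%:R * h = tau ->
  P (X @^-1` full_cell h 0 n c) = (full_mass h 0 n (p0 tau) 0 c)%:E.
Proof.
move=> dX h0 nh.
have mX (B : set R) : measurable B -> measurable (X @^-1` B).
  by move=> mB; rewrite -[X in measurable X]setTI; exact: measurable_funP.
(* The cells already carry the full mass, so both unbounded parts are null. *)
have null : P (~` (X @^-1` `]0, tau])) = 0%E.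
  rewrite probability_setC; last exact: mX.
  rewrite gain0_itv// oppr0 expR0 -/(p0 tau) divff ?gt_eqF ?p0_gt0//.
  by rewrite subee.
have sub0 (B : set R) : measurable B -> B `<=` ~` `]0, tau] -> P (X @^-1` B) = 0%E.
  move=> mB HB; apply/eqP; rewrite -measure_le0 -null; apply: le_measure.
  - by rewrite inE; exact: mX.
  - by rewrite inE; apply: measurableC; exact: mX.
  - by move=> w /HB.
case: c => [[j|]|] /=.
- exact: gain0_cell.
- rewrite mul0r sub0// => x; rewrite /= in_itv/= andbT nh add0r => tx.
  by rewrite in_itv/= => /andP[_]; rewrite leNgt tx.
- rewrite sub0// => x; rewrite /= in_itv/= => x0.
  by rewrite in_itv/= ltNge x0.
Qed.

Lemma gain1_full_cell (X : {RV P >-> R}) (h : R) n c :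
  has_density P X (gain_density1 tau) -> 0 < h -> (0 < n)%N ->
  P (X @^-1` full_cell h tau n c) =
  (full_mass h tau n (p1 tau) (expR (- (tau + n%:R * h))) c)%:E.
Proof.
move=> dX h0 n0.
have mX (B : set R) : measurable B -> measurable (X @^-1` B).
  by move=> mB; rewrite -[X in measurable X]setTI; exact: measurable_funP.
have null : P (X @^-1` `]-oo, tau]) = 0%E.
  apply: density_null dX _ => //; apply/seteqP; split => // x [].
  by rewrite /= !in_itv/= andbT => xt; rewrite ltNge xt.
have tn : tau < tau + n%:R * h by rewrite ltrDl mulr_gt0// ltr0n.
case: c => [[j|]|] //=; first exact: gain1_cell.
have -> : X @^-1` `]tau + n%:R * h, +oo[ =
   ~` (X @^-1` `]-oo, tau] `|` X @^-1` `]tau, tau + n%:R * h]).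
  apply/seteqP; split => w; rewrite /= !in_itv/= ?andbT.
    by move=> H [|/andP[_]]; lra.
  move=> H; rewrite ltNge; apply/negP => xn; apply: H.
  by have [xt|tx] := leP (X w) tau; [left | right; rewrite xn].
rewrite probability_setC; last by apply: measurableU; exact: mX.
rewrite measureU; [|exact: mX|exact: mX|]; last first.
  apply/seteqP; split => // w [] /=; rewrite !in_itv/= => H /andP[].
  by rewrite ltNge H.
rewrite /= null add0e gain1_itv// -EFinB; congr EFin.
by rewrite mulrBl divff ?gt_eqF ?expR_gt0//; ring.
Qed.

End quantized_gains.

(** * Bounds on the outage probability for a fixed number of channels *)

Section outage_bounds.
Context {R : realType} {d : measure_display} {T : measurableType d}.
Variables (P : probability T R) (tau g0 rho theta : R).
Variables (K0 : nat -> {RV P >-> nat}) (A0 A1 : nat -> {RV P >-> R}).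
Hypotheses (tau_gt0 : 0 < tau) (g0_01 : 0 <= g0 <= 1) (rho_gt0 : 0 < rho).
Hypothesis feedback : one_bit_feedback tau K0 A0 A1.

Let g0_ge0 : 0 <= g0. Proof. by case/andP: g0_01. Qed.
Let g1_ge0 : 0 <= 1 - g0. Proof. by rewrite subr_ge0; case/andP: g0_01. Qed.

Definition outage (K : nat) : set T :=
  [set w | total_rate g0 (fun K => K0 K) (fun i => A0 i) (fun j => A1 j) K rho w
           <= rho * theta].

Lemma outage_atE K k :
  outage K `&` (K0 K @^-1` [set k]) =
  [set w | K0 K w = k /\
     \sum_(i < k) ln (1 + g0 * rho / k%:R * A0 i w) +
     \sum_(j < K - k) ln (1 + (1 - g0) * rho / (K - k)%:R * A1 j w) <= rho * theta].
Proof.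
apply/seteqP; split => w; rewrite /outage /total_rate /=.
  by move=> [H Kw]; move: H; rewrite Kw.
by move=> [Kw H]; rewrite Kw.
Qed.

Lemma measurable_rate_term (a : R) :
  measurable_fun setT (fun x : R => ln (1 + a * x)).
Proof.
apply: measurableT_comp; first exact: measurable_ln.
by apply: measurable_funD => //; apply: measurable_funM.
Qed.

Lemma measurable_outage_at K k : measurable (outage K `&` (K0 K @^-1` [set k])).
Proof.
rewrite outage_atE.
apply: (measurable_sums_le _ _ _ _ K k (K - k) (fun x => ln (1 + g0 * rho / k%:R * x))
  (fun x => ln (1 + (1 - g0) * rho / (K - k)%:R * x))).
- exact: measurable_rate_term.
- exact: measurable_rate_term.
Qed.

Lemma measurable_outage K : measurable (outage K).
Proof.
have -> : outage K = \bigcup_k (outage K `&` (K0 K @^-1` [set k])).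
  apply/seteqP; split => [w Hw|w [k _ []]//].
  by exists (K0 K w).
by apply: bigcupT_measurable => k; exact: measurable_outage_at.
Qed.

Lemma outage_le_sum K :
  (P (outage K) <= \sum_(k < K.+1) P (outage K `&` (K0 K @^-1` [set (k : nat)])))%E.
Proof.
pose B (c : option 'I_K.+1) : set T := match c with
  | Some k => outage K `&` (K0 K @^-1` [set (k : nat)])
  | None => K0 K @^-1` [set k | (K < k)%N] end.
have mB c : measurable (B c).
  case: c => [k|]; first exact: measurable_outage_at.
  by rewrite -[X in measurable X]setTI; exact: measurable_funP.
have cov : outage K `<=` \bigcup_c B c.
  move=> w Hw; have [KK|KK] := ltnP K (K0 K w); first by exists None.
  by exists (Some (Ordinal (KK : (K0 K w < K.+1)%N))).
apply: (le_trans (le_measure_cover P _ _ _ (measurable_outage K) mB cov)).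
rewrite (bigD1 None)//= (K0_gt_null _ _ _ _ _ feedback)// add0e.
by rewrite (reindex_omap Some id)/=; [under eq_bigl do rewrite eqxx | case].
Qed.

(** * Chernoff bound for a given number of channels with feedback 0 *)

Section upper.
Variables (lambda h : R) (N n K k : nat) (a0 a1 : R).
Hypotheses (lambda_le0 : lambda <= 0) (h_gt0 : 0 < h) (Nh : N%:R * h = tau).
Hypotheses (n_gt0 : (0 < n)%N).
Hypotheses (a0_le : 0 <= a0 <= g0 * rho / k%:R).
Hypotheses (a1_le : 0 <= a1 <= (1 - g0) * rho / (K - k)%:R).

(** With this scaling [kappa * (g0 * rho / k)] is [g0 * lambda / (k / K)], of order 1 while [k / K]
    stays away from 0. *)
Let kappa := lambda * K%:R / rho.
Let s0 := 1 - kappa * a0.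
Let s1 := 1 - kappa * a1.
Let D := n%:R * h.

(* The actual powers per channel may be replaced by smaller ones [a0] and [a1],
   which only lowers the rate; in particular [a1 = 0] discards the channels with
   feedback 1, when they are too few for their power to be of order [1 / K]. *)
Lemma outage_upper :
  (P (outage K `&` (K0 K @^-1` [set k])) <=
   ('C(K, k)%:R * expR (- (lambda * K%:R * theta)) *
    (expR (- (kappa * a0 ^+ 2 * tau ^+ 2)) * expR (s0 * h) * expmass 0 tau s0) ^+ k *
    (expR (- (kappa * a1 ^+ 2 * (tau + D) ^+ 2)) * expR (s1 * h) * (1 + D^-1) *
       (expR (- (s1 * tau)) / s1)) ^+ (K - k))%:E)%E.
Proof.
have kappa0 : kappa <= 0 by rewrite /kappa pmulr_lle0 ?invr_gt0// mulr_le0_ge0.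
have D0 : 0 < D by rewrite mulr_gt0// ltr0n.
have /andP[a00 a0le] := a0_le.
have /andP[a10 a1le] := a1_le.
have s11 : 1 <= s1 by rewrite /s1 lerBrDr gerDl mulr_le0_ge0.
rewrite outage_atE.
have low (b a A : R) m p o (b0 : 0 <= b) (a0' : 0 <= a) (aA : a <= A)
    (c : option (option 'I_m)) :
    full_mass h b m p o c = 0 \/ forall x, full_cell h b m c x ->
     ln (1 + a * low_value h b m c) <= ln (1 + A * x).
  case Ec : c => [c'|]; last by left.
  right => x Hx; have [//|lx] := low_value_lt h b m (Some c') x Hx.
  have /andP[l0 _] := low_value_le h b m h_gt0 b0 (Some c').
  rewrite ler_ln ?posrE.
  - by rewrite lerD2l ler_pM.
  - by rewrite ltr_wpDr// mulr_ge0.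
  - by rewrite ltr_wpDr// mulr_ge0// (le_trans _ aA, le_trans l0).
have := @feedback_chernoff R d T P tau K0 A0 A1 feedback _ _
   (full_cell h 0 N) (full_cell h tau n)
   (full_mass h 0 N (p0 tau) 0)
   (full_mass h tau n (p1 tau) (expR (- (tau + n%:R * h))))
   (measurable_full_cell h 0 N) (measurable_full_cell h tau n)
   (fun i c => gain0_full_cell P tau tau_gt0 (A0 i) h N c (A0_density feedback i) h_gt0 Nh)
   (fun j c => gain1_full_cell P tau (A1 j) h n c (A1_density feedback j) h_gt0 n_gt0)
   tau_gt0 K k (K - k)%N _ _
   (fun c => ln (1 + a0 * low_value h 0 N c))
   (fun c => ln (1 + a1 * low_value h tau n c))
   kappa (rho * theta)
   (measurable_rate_term (g0 * rho / k%:R))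
   (measurable_rate_term ((1 - g0) * rho / (K - k)%:R))
   (full_cell_cover h 0 N) (full_cell_cover h tau n)
   (low 0 a0 _ N _ _ (lexx 0) a00 a0le)
   (low tau a1 _ n _ _ (ltW tau_gt0) a10 a1le) kappa0.
move=> /le_trans; apply; rewrite lee_fin.
have p0p := p0_gt0 tau tau_gt0.
have p1p := p1_gt0 tau.
have M0 := full_mass_mgf_le h 0 N h_gt0 (lexx 0) (p0 tau) 0 kappa a0 p0p (lexx 0) kappa0 a00.
have M1 := full_mass_mgf_le h tau n h_gt0 (ltW tau_gt0) (p1 tau)
  (expR (- (tau + n%:R * h))) kappa a1 p1p (expR_ge0 _) kappa0 a10.
rewrite mul0r addr0 Nh add0r -/s0 in M0.

set F0 := \sum_c _ in M0 *.
set F1 := \sum_c _ in M1 *.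
set Y0 := expR (- (kappa * a0 ^+ 2 * tau ^+ 2)) * expR (s0 * h) * expmass 0 tau s0.
set Y1 := expR (- (kappa * a1 ^+ 2 * (tau + D) ^+ 2)) * expR (s1 * h) * (1 + D^-1) *
       (expR (- (s1 * tau)) / s1).
have HF0 : p0 tau * F0 <= Y0.
  rewrite mulrC -ler_pdivlMr//; apply: (le_trans M0).
  by rewrite /Y0 mulrA.
have HF1 : p1 tau * F1 <= Y1.
  rewrite mulrC -ler_pdivlMr//; apply: (le_trans M1).
  rewrite -/s1 -/D ler_pM2r ?invr_gt0//.
  have -> : Y1 = expR (- (kappa * a1 ^+ 2 * (tau + D) ^+ 2)) *
      (expR (s1 * h) * (expR (- (s1 * tau)) / s1) +
       expR (s1 * h) * (D^-1 * (expR (- (s1 * tau)) / s1))).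
    by rewrite /Y1; ring.
  rewrite ler_wpM2l ?expR_ge0//.
  have s10 : 0 < s1 by lra.
  apply: lerD.
    rewrite ler_wpM2l ?expR_ge0// /expmass ler_wpM2r ?invr_ge0 ?(ltW s10)//.
    by rewrite gerBl expR_ge0.
  (* By [s1 * expR (- (D * s1)) <= D^-1], the tail beyond [tau + D] adds at most the fraction [D^-1]
     of the untruncated mass, uniformly in [s1]. *)
  have -> : expR (- (tau + D)) * expR (kappa * a1 * (tau + D)) =
     (expR (- (s1 * tau)) / s1) * (s1 * expR (- (D * s1))).
    rewrite -expRD mulrA divfK ?gt_eqF// -expRD /s1; congr expR; ring.
  apply: (@le_trans _ _ (1 * (D^-1 * (expR (- (s1 * tau)) / s1)))).
    rewrite mul1r [leRHS]mulrC ler_wpM2l ?divr_ge0 ?expR_ge0 ?(ltW s10)//.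
    exact: mul_expRN_le.
  rewrite ler_wpM2r ?mulr_ge0 ?invr_ge0 ?expR_ge0 ?(ltW s10) ?(ltW D0)//.
  by rewrite -expR0 ler_expR mulr_ge0// ltW.
have F00 : 0 <= F0.
  apply: sumr_ge0 => c _; rewrite mulr_ge0 ?expR_ge0//.
  by case: c => [[j|]|] //=; rewrite divr_ge0 ?(ltW p0p)// ltW// cell_mass_gt0.
have F10 : 0 <= F1.
  apply: sumr_ge0 => c _; rewrite mulr_ge0 ?expR_ge0//.
  by case: c => [[j|]|] //=; rewrite divr_ge0 ?(ltW p1p) ?expR_ge0// ltW// cell_mass_gt0.
rewrite /binomial_pmf /unstable.onem (_ : 1 - p0 tau = p1 tau); last first.
  by rewrite /p0 /p1; ring.
have -> : kappa * (rho * theta) = lambda * K%:R * theta.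
  by rewrite /kappa; field; rewrite gt_eqF.
set e := expR _.
have -> : p0 tau ^+ k * p1 tau ^+ (K - k) *+ 'C(K, k) *
   (e * F0 ^+ k * F1 ^+ (K - k)) =
   'C(K, k)%:R * e * ((p0 tau * F0) ^+ k * (p1 tau * F1) ^+ (K - k)).
  by rewrite !exprMn -mulr_natl; ring.
rewrite -[leRHS]mulrA; apply: ler_wpM2l; first by rewrite mulr_ge0 ?expR_ge0.
have Hx (x y : R) m : 0 <= x -> x <= y -> x ^+ m <= y ^+ m.
  by move=> x0 xy; rewrite lerXn2r ?nnegrE// (le_trans x0).
by apply: ler_pM; rewrite ?exprn_ge0 ?mulr_ge0 ?(ltW p0p) ?(ltW p1p)//; apply: Hx;
  rewrite // mulr_ge0 // ltW.
Qed.

End upper.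

(** * Tilted lower bounds for a given number of channels with feedback 0 *)

Section lower.
Variables (h : R) (N n : nat).
Hypotheses (h_gt0 : 0 < h) (Nh : N%:R * h = tau) (n_gt0 : (0 < n)%N).

Definition mass0 (j : 'I_N) : R := cell_mass h 0 j.
Definition mass1 (j : 'I_n) : R := cell_mass h tau j.
Definition value0 (j : 'I_N) : R := 0 + j.+1%:R * h.
Definition value1 (j : 'I_n) : R := tau + j.+1%:R * h.

Lemma mass0_gt0 j : 0 < mass0 j. Proof. exact: cell_mass_gt0. Qed.
Lemma mass1_gt0 j : 0 < mass1 j. Proof. exact: cell_mass_gt0. Qed.

(** As [ln (1 + z) <= z], a bound on the weighted sum of gains forces outage. The powers of [p0 tau]
    and [p1 tau] in the binomial weight cancel the normalizations of the conditional densities,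
    which leaves ['C(K, k)] and unnormalized masses. *)
Lemma outage_lower_cells K k (a0 a1 : R) : (k <= K)%N ->
  g0 * rho / k%:R * a0 + (1 - g0) * rho / (K - k)%:R * a1 <= rho * theta ->
  (('C(K, k)%:R *
    ((\sum_(w0 : {ffun 'I_k -> 'I_N} | \sum_i value0 (w0 i) <= a0) \prod_i mass0 (w0 i)) *
     (\sum_(w1 : {ffun 'I_(K - k) -> 'I_n} | \sum_j value1 (w1 j) <= a1)
        \prod_j mass1 (w1 j))))%:E
   <= P (outage K `&` (K0 K @^-1` [set k])))%E.
Proof.
move=> kK Ha.
have p0p := p0_gt0 tau tau_gt0.
have p1p := p1_gt0 tau.
have := @feedback_lower R d T P tau K0 A0 A1 feedback _ _
   (fun j : 'I_N => cell h 0 j) (fun j : 'I_n => cell h tau j)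
   (fun j => mass0 j / p0 tau) (fun j => mass1 j / p1 tau)
   (fun j => measurable_cell h 0 j) (fun j => measurable_cell h tau j)
   (fun i c => gain0_cell P tau (A0 i) h N c (A0_density feedback i) h_gt0 Nh)
   (fun j c => gain1_cell P tau (A1 j) h c (A1_density feedback j) h_gt0)
   tau_gt0 K k (K - k)%N (outage K) value0 value1 a0 a1 (measurable_outage K).
move=> /(_ (fun c c' x H H' => val_inj (cell_disjoint h 0 h_gt0 c c' x H H'))).
move=> /(_ (fun c c' x H H' => val_inj (cell_disjoint h tau h_gt0 c c' x H H'))).
move=> /(_ (fun c x => cell_bounds h 0 h_gt0 (lexx 0) c x)).
move=> /(_ (fun c x => cell_bounds h tau h_gt0 (ltW tau_gt0) c x)).
have HE w : K0 K w = k -> (forall i : 'I_k, 0 <= A0 i w) ->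
  (forall j : 'I_(K - k), 0 <= A1 j w) -> \sum_(i < k) A0 i w <= a0 ->
  \sum_(j < K - k) A1 j w <= a1 -> outage K w.
  move=> Kw w0 w1 S0 S1.
  suff : (outage K `&` (K0 K @^-1` [set k])) w by case.
  rewrite outage_atE; split=> //; apply: le_trans Ha.
  have H (m : nat) (A : nat -> T -> R) (c a : R) : 0 <= c ->
      (forall i : 'I_m, 0 <= A i w) -> \sum_(i < m) A i w <= a ->
      \sum_(i < m) ln (1 + c * A i w) <= c * a.
    move=> c0 Aw Sa; apply: (@le_trans _ _ (c * \sum_(i < m) A i w)); last first.
      exact: ler_wpM2l.
    rewrite mulr_sumr; apply: ler_sum => i _; apply: le_ln1Dx.
    by rewrite (lt_le_trans (ltrN10 _))// mulr_ge0.
  apply: lerD.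
    by apply: (H k (fun i => A0 i)) => //; rewrite divr_ge0// mulr_ge0// ltW.
  by apply: (H (K - k)%N (fun i => A1 i)) => //; rewrite divr_ge0// mulr_ge0// ltW.
move=> /(_ HE); apply: le_trans.
rewrite lee_fin le_eqVlt; apply/orP; left; apply/eqP.
have E (m : nat) (C : finType) (Q : pred {ffun 'I_m -> C}) (f : C -> R) (p : R) :
    \sum_(w | Q w) \prod_i (f (w i) / p) =
    p^-1 ^+ m * (\sum_(w | Q w) \prod_i f (w i)).
  rewrite mulr_sumr; apply: eq_bigr => w _.
  by rewrite big_split/= prodr_const card_ord mulrC.
rewrite !E /binomial_pmf /unstable.onem (_ : 1 - p0 tau = p1 tau); last first.
  by rewrite /p0 /p1; ring.
rewrite -mulr_natl !exprVn; field.
by rewrite !expf_neq0 ?gt_eqF.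
Qed.

Let D := n%:R * h.
Let W := tau + D.

Let N_gt0 : (0 < N)%N.
Proof. by case: N Nh => // H; move: tau_gt0; rewrite -H mul0r ltxx. Qed.

Lemma value0_bounds j : 0 <= value0 j <= W.
Proof.
rewrite /value0 add0r mulr_ge0 ?(ltW h_gt0)//=.
apply: (@le_trans _ _ tau); last by rewrite lerDl mulr_ge0// ltW.
by rewrite -Nh ler_wpM2r ?(ltW h_gt0)// ler_nat.
Qed.

Lemma value1_bounds j : 0 <= value1 j <= W.
Proof.
rewrite /value1 addr_ge0 ?mulr_ge0 ?(ltW h_gt0) ?(ltW tau_gt0)//=.
by rewrite lerD2l ler_wpM2r ?(ltW h_gt0)// ler_nat.
Qed.

(** The conditions on [W] make both Chebyshev factors at least 1/2, whence the 4. The two tilts are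
    tied together only through the weighted sum of their means. *)
Lemma outage_lower K k (mu0 mu1 e : R) : (0 < k)%N -> (k < K)%N ->
  mu0 <= 0 -> mu1 <= 0 -> 0 < e ->
  let t0 := tilted_mean mass0 value0 mu0 in
  let t1 := tilted_mean mass1 value1 mu1 in
  (g0 * (t0 + e) + (1 - g0) * (t1 + e) <= theta)%R ->
  2 * W ^+ 2 <= k%:R * e ^+ 2 -> 2 * W ^+ 2 <= (K - k)%:R * e ^+ 2 ->
  (('C(K, k)%:R *
    ((mgf mass0 value0 mu0 * expR (- (mu0 * (t0 - e)))) ^+ k *
     (mgf mass1 value1 mu1 * expR (- (mu1 * (t1 - e)))) ^+ (K - k)) / 4)%:E
   <= P (outage K `&` (K0 K @^-1` [set k])))%E.
Proof.
move=> k0 kK mu00 mu10 e0 t0 t1 Ht Wk Wn.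
have n0 : (0 < K - k)%N by rewrite subn_gt0.
have kR : k%:R != 0 :> R by rewrite pnatr_eq0 -lt0n.
have nR : (K - k)%:R != 0 :> R by rewrite pnatr_eq0 -lt0n.
have := outage_lower_cells K k (k%:R * (t0 + e)) ((K - k)%:R * (t1 + e)) (ltnW kK).
have -> : g0 * rho / k%:R * (k%:R * (t0 + e)) + (1 - g0) * rho / (K - k)%:R *
  ((K - k)%:R * (t1 + e)) = rho * (g0 * (t0 + e) + (1 - g0) * (t1 + e)).
  by field; rewrite kR nR.
rewrite ler_pM2l// => /(_ Ht); apply: le_trans; rewrite lee_fin.
have c0 := Ordinal N_gt0; have c1 := Ordinal n_gt0.
have B0 := sum_ffun_tilted mass0 value0 mass0_gt0 c0 k W e mu0 value0_bounds mu00 e0 k0.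
have B1 := sum_ffun_tilted mass1 value1 mass1_gt0 c1 (K - k) W e mu1 value1_bounds mu10 e0 n0.
rewrite -/t0 in B0; rewrite -/t1 in B1.
have half (m : nat) : (0 < m)%N -> 2 * W ^+ 2 <= m%:R * e ^+ 2 ->
    2^-1 <= 1 - W ^+ 2 / (m%:R * e ^+ 2).
  move=> m0 H; rewrite lerBrDl -lerBrDr ler_pdivrMr; first by lra.
  by rewrite mulr_gt0 ?exprn_gt0// ltr0n.
have X0 : 0 <= (mgf mass0 value0 mu0 * expR (- (mu0 * (t0 - e)))) ^+ k.
  by rewrite exprn_ge0// mulr_ge0 ?expR_ge0// ltW// (mgf_gt0 _ _ mass0_gt0 c0).
have X1 : 0 <= (mgf mass1 value1 mu1 * expR (- (mu1 * (t1 - e)))) ^+ (K - k).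
  by rewrite exprn_ge0// mulr_ge0 ?expR_ge0// ltW// (mgf_gt0 _ _ mass1_gt0 c1).
have Y0 := le_trans (ler_wpM2l X0 (half k k0 Wk)) B0.
have Y1 := le_trans (ler_wpM2l X1 (half _ n0 Wn)) B1.
rewrite -[leLHS]mulrA ler_wpM2l//.
rewrite (_ : 4^-1 = 2^-1 * 2^-1); last by rewrite -invfM -natrM.
rewrite mulrACA; apply: ler_pM => //; by rewrite mulr_ge0// invr_ge0.
Qed.

Lemma outage_lower_all0 K (mu0 e : R) : (0 < K)%N -> mu0 <= 0 -> 0 < e ->
  let t0 := tilted_mean mass0 value0 mu0 in
  g0 * (t0 + e) <= theta -> 2 * W ^+ 2 <= K%:R * e ^+ 2 ->
  (((mgf mass0 value0 mu0 * expR (- (mu0 * (t0 - e)))) ^+ K / 2)%:E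
   <= P (outage K))%E.
Proof.
move=> K_gt0 mu00 e0 t0 Ht WK.
have kR : K%:R != 0 :> R by rewrite pnatr_eq0 -lt0n.
have := outage_lower_cells K K (K%:R * (t0 + e)) 0 (leqnn K).
rewrite mulr0 addr0.
have -> : g0 * rho / K%:R * (K%:R * (t0 + e)) = rho * (g0 * (t0 + e)) by field.
rewrite ler_pM2l// => /(_ Ht) H.
apply: (@le_trans _ _ (P (outage K `&` K0 K @^-1` [set K]))); last first.
  apply: le_measure; rewrite ?inE; first exact: measurable_outage_at.
    exact: measurable_outage.
  by move=> w [].
apply: le_trans H; rewrite lee_fin binn mul1r.
have c0 := Ordinal N_gt0.
have B0 := sum_ffun_tilted mass0 value0 mass0_gt0 c0 K W e mu0 value0_bounds mu00 e0 K_gt0.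
rewrite -/t0 in B0.
have X0 : 0 <= (mgf mass0 value0 mu0 * expR (- (mu0 * (t0 - e)))) ^+ K.
  by rewrite exprn_ge0// mulr_ge0 ?expR_ge0// ltW// (mgf_gt0 _ _ mass0_gt0 c0).
have half : 2^-1 <= 1 - W ^+ 2 / (K%:R * e ^+ 2).
  rewrite lerBrDl -lerBrDr ler_pdivrMr; first by lra.
  by rewrite mulr_gt0 ?exprn_gt0// ltr0n.
have Y0 := le_trans (ler_wpM2l X0 half) B0.
(* For [k = K] the second sum runs over the empty word alone. *)
rewrite [X in _ <= _ * X](_ : _ = 1) ?mulr1// subnn.
transitivity (\sum_(w : {ffun 'I_0 -> 'I_n}) \prod_j mass1 (w j)).
  by apply: eq_bigl => w; rewrite big_ord0 lexx.
by rewrite sum_ffun_prod expr0.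
Qed.

End lower.
End outage_bounds.

(** * The exponents as functions of the multiplier *)

Section logarithms.
Context {R : realType}.
Implicit Types x y z : R.

Lemma ler_ln_pos x y : 0 < x -> x <= y -> ln x <= ln y.
Proof. by move=> x0 xy; rewrite ler_ln// posrE (lt_le_trans x0). Qed.

(** The concave [ln] lies below its tangent at [y^-1]. The slope [y] is free, so a logarithm of the
    multiplier can be absorbed in part of a linear term. *)
Lemma ln_tangent x y : 0 < x -> 0 < y -> ln x <= x * y - 1 - ln y.
Proof.
move=> x0 y0; have : ln (1 + (x * y - 1)) <= x * y - 1.
  by apply: le_ln1Dx; rewrite ltrBrDr addNr mulr_gt0.
by rewrite addrC subrK lnM ?posrE//; lra.
Qed.

Lemma ler_scale_nonpos x y : x <= 0 -> y <= 1 -> x <= y * x.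
Proof.
move=> x0 y1; have : 0 <= (1 - y) * - x by rewrite mulr_ge0; lra.
by rewrite mulrBl mul1r mulrN; lra.
Qed.

Lemma ln_one_sub_ge x : 0 <= x <= 1 / 2 -> - ln (1 - x) <= 2 * x.
Proof.
move=> /andP[x0 x2]; have y0 : 0 < 1 - x by lra.
have := ln_tangent (1 - x)^-1 1; rewrite invr_gt0 ltr01 => /(_ y0 isT).
rewrite lnV ?posrE// ln1 mulr1 subr0 => /le_trans; apply.
rewrite lerBlDr -[(1 - x)^-1]mul1r ler_pdivrMr//.
have : 0 <= x * (1 - 2 * x) by rewrite mulr_ge0//; lra.
lra.
Qed.

Lemma mul_ln_ge x : 0 < x -> - 1 <= x * ln x.
Proof.
move=> x0; have := ln_tangent x^-1 1; rewrite invr_gt0 ltr01 => /(_ x0 isT).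
rewrite lnV ?posrE// ln1 mulr1 => H.
have : x * (- ln x) <= x * (x^-1 - 1 - 0) by rewrite ler_wpM2l// ltW.
by rewrite subr0 mulrBr mulfV ?gt_eqF//; lra.
Qed.

Lemma exp_ln_pow (n : nat) x : 0 < x -> x ^+ n = expR (n%:R * ln x).
Proof. by move=> x0; rewrite expRM_natl lnK ?posrE. Qed.

(* From [t ^ j * 'C(K, j) <= (1 + t) ^ K]. *)
Lemma binomial_edge (K j : nat) (m t delta : R) : (j <= K)%N -> 0 < m ->
  0 < t -> j%:R <= delta * K%:R ->
  'C(K, j)%:R * m ^+ (K - j) <=
  expR (K%:R * (ln m + t + delta * (`|ln t| + `|ln m|))).
Proof.
move=> jK m0 t0 jd.
have H1 : 'C(K, j)%:R * t ^+ j <= expR (K%:R * t).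
  apply: (@le_trans _ _ ((t + 1) ^+ K)); last first.
    rewrite expRM_natl lerXn2r ?nnegrE ?expR_ge0//; first by rewrite addr_ge0// ltW.
    by rewrite addrC expR_ge1Dx.
  rewrite addrC exprDn (bigD1 (Ordinal (jK : (j < K.+1)%N)))//= expr1n mul1r -mulr_natl.
  rewrite mulr1 mulr_natl lerDl; apply: sumr_ge0 => i _.
  by rewrite expr1n mul1r mulrn_wge0// exprn_ge0// ltW.
have -> : 'C(K, j)%:R * m ^+ (K - j) =
    'C(K, j)%:R * t ^+ j * (m ^+ (K - j) * t ^- j).
  by field; rewrite expf_neq0// gt_eqF.
apply: (@le_trans _ _ (expR (K%:R * t) * (m ^+ (K - j) * t ^- j))).
  by rewrite ler_wpM2r// mulr_ge0 ?invr_ge0 ?exprn_ge0 ?(ltW m0) ?(ltW t0).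
rewrite -exprVn !exp_ln_pow ?invr_gt0// -!expRD ler_expR lnV ?posrE// natrB//.
have A : (j%:R : R) * - ln t <= delta * K%:R * `|ln t|.
  apply: (@le_trans _ _ (j%:R * `|ln t|)); last by rewrite ler_wpM2r.
  by rewrite ler_wpM2l// -normrN ler_norm.
have B : (j%:R : R) * - ln m <= delta * K%:R * `|ln m|.
  apply: (@le_trans _ _ (j%:R * `|ln m|)); last by rewrite ler_wpM2r.
  by rewrite ler_wpM2l// -normrN ler_norm.
have -> : K%:R * (ln m + t + delta * (`|ln t| + `|ln m|)) =
  K%:R * t + K%:R * ln m + (delta * K%:R * `|ln t| + delta * K%:R * `|ln m|) by ring.
by lra.
Qed.

(** One term of the expansion of [(1 - x + x) ^ K]; with [x = k / K] it bounds ['C(K, k)] by the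
    exponential of the entropy. *)
Lemma binomial_mode_le (K k : nat) x : (k <= K)%N -> 0 <= x <= 1 ->
  'C(K, k)%:R * (x ^+ k * (1 - x) ^+ (K - k)) <= 1.
Proof.
move=> kK /andP[x0 x1].
have E : (1 - x + x) ^+ K = 1 by rewrite subrK expr1n.
rewrite -[leRHS]E [leRHS]exprDn (bigD1 (Ordinal (kK : (k < K.+1)%N)))//= mulr_natl.
rewrite [x ^+ k * _]mulrC lerDl.
by apply: sumr_ge0 => i _; rewrite mulrn_wge0// mulr_ge0// exprn_ge0// subr_ge0.
Qed.

End logarithms.

Section exponents.
Context {R : realType}.
Variables (tau g0 theta : R).
Hypotheses (tau_gt0 : 0 < tau) (g0_01 : 0 <= g0 <= 1).
Local Notation g1 := (1 - g0).
Local Notation excess := (theta - g1 * tau).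

Let g0_ge0 : 0 <= g0. Proof. by case/andP: g0_01. Qed.
Let g1_ge0 : 0 <= g1. Proof. by rewrite subr_ge0; case/andP: g0_01. Qed.

(** For [s > 0], the integral of [expR (- (s * x))] over [x > tau], the counterpart of
    [expmass 0 tau s]. *)
Definition mass_above (s : R) : R := expR (- (s * tau)) / s.

(* With [theta = 1 / eta], [exponent_all0] and [exponent_at x] are the functions
   of the multiplier whose suprema are the two exponents of the theorem, and
   [exponent_all1] is the limit of [exponent_at x] as [x] tends to 0. *)
Definition exponent_all0 (l : R) : R :=
  l * theta + ln (1 - g0 * l) - ln (1 - expR (- ((1 - g0 * l) * tau))).

Definition exponent_all1 (l : R) : R := l * excess + tau + ln (1 - g1 * l).

Definition exponent_at (x l : R) : R :=
  l * excess + (1 - x) * tau + x * ln (x - g0 * l) +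
  (1 - x) * ln (1 - x - g1 * l) - x * ln (1 - expR (- ((1 - g0 * l / x) * tau))).

Lemma one_sub_expRN_gt0 s : 1 <= s -> 0 < 1 - expR (- (s * tau)).
Proof.
by move=> s1; rewrite subr_gt0 expR_lt1 oppr_lt0 mulr_gt0// (lt_le_trans ltr01).
Qed.

Lemma tilt_ge1 (c x l : R) : 0 <= c -> 0 < x -> l <= 0 -> 1 <= 1 - c * l / x.
Proof.
move=> c0 x0 l0; rewrite lerBrDr gerDl pmulr_lle0 ?invr_gt0//.
by rewrite mulr_ge0_le0.
Qed.

Lemma expmass0_gt0 s : 1 <= s -> 0 < expmass 0 tau s.
Proof.
move=> s1; rewrite /expmass mulr0 oppr0 expR0 divr_gt0 ?one_sub_expRN_gt0//.
by rewrite (lt_le_trans ltr01).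
Qed.

Lemma mass_above_gt0 s : 1 <= s -> 0 < mass_above s.
Proof. by move=> s1; rewrite divr_gt0 ?expR_gt0// (lt_le_trans ltr01). Qed.

Lemma ln_expmass0 s : 1 <= s ->
  ln (expmass 0 tau s) = ln (1 - expR (- (s * tau))) - ln s.
Proof.
move=> s1; rewrite /expmass mulr0 oppr0 expR0 ln_div ?posrE ?one_sub_expRN_gt0//.
by rewrite (lt_le_trans ltr01).
Qed.

Lemma ln_mass_above s : 1 <= s -> ln (mass_above s) = - (s * tau) - ln s.
Proof.
move=> s1; rewrite /mass_above ln_div ?posrE ?expR_gt0 ?expRK//.
by rewrite (lt_le_trans ltr01).
Qed.

Lemma exponent_all0_mass l : l <= 0 ->
  exponent_all0 l = l * theta - ln (expmass 0 tau (1 - g0 * l)).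
Proof.
move=> l0; have := tilt_ge1 g0 1 l g0_ge0 ltr01 l0; rewrite divr1 => s1.
by rewrite ln_expmass0// /exponent_all0; ring.
Qed.

Lemma exponent_all1_mass l : l <= 0 ->
  exponent_all1 l = l * theta - ln (mass_above (1 - g1 * l)).
Proof.
move=> l0; have := tilt_ge1 g1 1 l g1_ge0 ltr01 l0; rewrite divr1 => s1.
by rewrite ln_mass_above// /exponent_all1; ring.
Qed.

(** The form in which the exponent arises: a linear term, minus the logarithms of the tilted masses
    in proportions [x] and [1 - x], with the entropy terms of the binomial coefficient. *)
Lemma exponent_at_mass x l : 0 < x < 1 -> l <= 0 ->
  exponent_at x l = l * theta + x * ln x + (1 - x) * ln (1 - x)
   - x * ln (expmass 0 tau (1 - g0 * l / x))
   - (1 - x) * ln (mass_above (1 - g1 * l / (1 - x))).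
Proof.
move=> /andP[x0 x1] l0; have y0 : 0 < 1 - x by rewrite subr_gt0.
have s0 := tilt_ge1 g0 x l g0_ge0 x0 l0.
have s1 := tilt_ge1 g1 (1 - x) l g1_ge0 y0 l0.
rewrite ln_expmass0// ln_mass_above// /exponent_at.
have -> : ln (x - g0 * l) = ln x + ln (1 - g0 * l / x).
  rewrite -lnM ?posrE ?(lt_le_trans ltr01 s0)//; congr ln.
  by field; rewrite gt_eqF.
have -> : ln (1 - x - g1 * l) = ln (1 - x) + ln (1 - g1 * l / (1 - x)).
  rewrite -lnM ?posrE ?(lt_le_trans ltr01 s1)//; congr ln.
  by field; rewrite gt_eqF.
by field; rewrite gt_eqF.
Qed.

(** Extracting [expR (s * tau)] from the logarithm removes the overflow as [x] tends to 0; its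
    exponent combines with [(1 - l) * tau] and produces [excess]. *)
Lemma exponent_at_alt x l : 0 < x < 1 -> l <= 0 ->
  l * theta - x * ln (expR ((1 - g0 * l / x) * tau) - 1) + x * ln (x - g0 * l)
  + (1 - x) * ln (1 - x - g1 * l) + (1 - l) * tau = exponent_at x l.
Proof.
move=> /andP[x0 x1] l0; have s0 := tilt_ge1 g0 x l g0_ge0 x0 l0.
set s := 1 - g0 * l / x in s0 *.
have -> : expR (s * tau) - 1 = expR (s * tau) * (1 - expR (- (s * tau))).
  by rewrite mulrBr mulr1 expRxMexpNx_1.
rewrite lnM ?posrE ?expR_gt0 ?one_sub_expRN_gt0// expRK /exponent_at -/s /s.
by field; rewrite gt_eqF.
Qed.

(** The error relative to the limit [x -> 0] is proportional to [x] and only logarithmic in [l], so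
    a linear term can absorb it. *)
Lemma exponent_at_le x l : 0 < x < 1 -> l <= 0 ->
  exponent_at x l <= exponent_all1 l + x * (ln (1 - l) - ln (1 - expR (- tau))).
Proof.
move=> /andP[x0 x1] l0; rewrite /exponent_at /exponent_all1.
have y0 : 0 < 1 - x by rewrite subr_gt0.
have g0l : 0 <= - (g0 * l) by rewrite oppr_ge0 mulr_ge0_le0.
have g1l : 0 <= - (g1 * l) by rewrite oppr_ge0 mulr_ge0_le0.
have H1 : x * ln (x - g0 * l) <= x * ln (1 - l).
  by rewrite ler_wpM2l ?(ltW x0)// ler_ln_pos//; lra.
have H2 : (1 - x) * ln (1 - x - g1 * l) <= ln (1 - g1 * l).
  apply: (@le_trans _ _ ((1 - x) * ln (1 - g1 * l))).
    by rewrite ler_wpM2l ?(ltW y0)// ler_ln_pos//; lra.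
  by rewrite ler_piMl ?ln_ge0//; lra.
have s0 := tilt_ge1 g0 x l g0_ge0 x0 l0.
have p : 0 < 1 - expR (- tau) by have := one_sub_expRN_gt0 1 (lexx 1); rewrite mul1r.
have H3 : x * ln (1 - expR (- tau)) <= x * ln (1 - expR (- ((1 - g0 * l / x) * tau))).
  rewrite ler_wpM2l ?(ltW x0)// ler_ln_pos// lerD2l lerN2 ler_expR lerN2.
  by rewrite ler_peMl// ltW.
have H4 : (1 - x) * tau <= tau by rewrite ler_piMl ?(ltW tau_gt0)//; lra.
by lra.
Qed.

Lemma exponent_at_unbounded (c delta : R) : 0 < theta -> excess <= 0 -> 0 < delta ->
  exists2 l, l <= 0 & forall x, 0 < x <= 1 - delta -> c < exponent_at x l.
Proof.
move=> th0 a0 d0.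
have g1p : 0 < g1.
  rewrite lt_neqAle g1_ge0 andbT; apply/negP => /eqP E.
  by move: a0; rewrite -E mul0r subr0 leNgt th0.
(* The logarithm of [1 - x - g1 * l] will exceed [y], and [1 - x >= delta]. Of the 2, one unit pays
   for [x * ln x >= -1], the other for strictness. *)
pose y := (`|c| + 2) / delta.
have y0 : 0 <= y by rewrite divr_ge0 ?(ltW d0)// addr_ge0.
exists (- (expR y / g1)); first by rewrite oppr_le0 divr_ge0 ?expR_ge0// ltW.
move=> x /andP[x0 xd]; set l := - _.
have l0 : l <= 0 by rewrite oppr_le0 divr_ge0 ?expR_ge0// ltW.
have y1 : 0 < 1 - x by lra.
have g0l : 0 <= - (g0 * l) by rewrite oppr_ge0 mulr_ge0_le0.
have H1 : -1 <= x * ln (x - g0 * l).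
  apply: (le_trans (mul_ln_ge x x0)); rewrite ler_wpM2l ?(ltW x0)// ler_ln_pos//; lra.
have H2 : `|c| + 2 <= (1 - x) * ln (1 - x - g1 * l).
  apply: (@le_trans _ _ (delta * y)).
    by rewrite /y mulrC divfK// gt_eqF.
  apply: ler_pM; rewrite ?(ltW d0)//; first by lra.
  rewrite -[leLHS]expRK ler_ln_pos ?expR_gt0//.
  have -> : g1 * l = - expR y by rewrite /l; field; rewrite gt_eqF.
  by lra.
have s0 := tilt_ge1 g0 x l g0_ge0 x0 l0.
have H3 : x * ln (1 - expR (- ((1 - g0 * l / x) * tau))) <= 0.
  by rewrite pmulr_rle0// ln_le0// gerBl expR_ge0.
have H4 : 0 <= (1 - x) * tau by rewrite mulr_ge0 ?ltW.
have H5 : 0 <= l * excess by exact: mulr_le0.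
have := ler_norm c; rewrite /exponent_at; lra.
Qed.

(* As [x] tends to 0, moving the multiplier from [l] to [(1 - x) * l] turns the
   bound [exponent_at_le] into a bound by [exponent_all1]. *)
Lemma exponent_all1_gt (c c' : R) : 0 < theta -> c < c' ->
  (forall x, 0 < x < 1 -> exists2 l, l <= 0 & c' < exponent_at x l) ->
  exists2 l, l <= 0 & c < exponent_all1 l.
Proof.
move=> th0 cc H; apply: contrapT => NE.
have le_c l : l <= 0 -> exponent_all1 l <= c.
  by move=> l0; rewrite leNgt; apply/negP => cl; apply: NE; exists l.
have [a0|a0] := leP excess 0.

  have : exponent_all1 (- (expR (`|c| + 1) / g1)) <= c.
    by apply: le_c; rewrite oppr_le0 divr_ge0 ?expR_ge0.
  have g1p : 0 < g1.
    rewrite lt_neqAle g1_ge0 andbT; apply/negP => /eqP E.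
    by move: a0; rewrite -E mul0r subr0 leNgt th0.
  rewrite /exponent_all1 (_ : g1 * - _ = - expR (`|c| + 1)); last first.
    by field; rewrite gt_eqF.
  rewrite opprK mulNr.
  have : `|c| + 1 <= ln (1 + expR (`|c| + 1)).
    by rewrite -[leLHS]expRK ler_ln_pos ?expR_gt0//; lra.
  have : 0 <= - (expR (`|c| + 1) / g1 * excess).
    by rewrite oppr_ge0 mulr_ge0_le0// divr_ge0 ?expR_ge0.
  have := ler_norm c; set u := _ * excess; move=> H1 H2 H3 H4.
  move: u H2 H4 => u H2 H4; set v := ln _ in H3 H4; move: v H3 H4 => v H3 H4.
  move: (tau_gt0) => t0; set w := `|c| in H1 H3; move: w H1 H3 => w H1 H3.
  suff : c < c by rewrite ltxx.
  clear -H1 H2 H3 H4 t0; lra.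
(* The tangent of slope [excess] bounds [x * ln (1 - l)] and turns [l * excess] into
   [(1 - x) * l * excess]; [b] collects the constants. The choice of [x] pays for [x * b] and for
   [- ln (1 - x) <= 2 * x]. *)
pose b := excess - 1 - ln excess - ln (1 - expR (- tau)).
pose x := Num.min (1 / 2) ((c' - c) / (`|b| + 2)).
have b0 : 0 < `|b| + 2 by rewrite ltr_wpDl.
have x0 : 0 < x by rewrite lt_min; apply/andP; split; [lra | rewrite divr_gt0// subr_gt0].
have x2 : x <= 1 / 2 by rewrite ge_min lexx.
have xb : x * (`|b| + 2) <= c' - c by rewrite -ler_pdivlMr// ge_min lexx orbT.
have y0 : 0 < 1 - x by lra.
have x01 : 0 < x < 1 by rewrite x0 -subr_gt0.
have [l l0] := H x x01; apply/negP; rewrite -leNgt.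
apply: (le_trans (exponent_at_le x l x01 l0)).
have l1 : 0 < 1 - l by lra.
have T := ln_tangent (1 - l) excess l1 a0.
have l'0 : (1 - x) * l <= 0 by rewrite mulr_ge0_le0// ltW.
have H1 := le_c _ l'0.
have g1l : 0 <= - (g1 * l) by rewrite oppr_ge0 mulr_ge0_le0.
have H2 : ln (1 - g1 * l) <= ln (1 - g1 * ((1 - x) * l)) - ln (1 - x).
  rewrite -ln_div ?posrE//; last first.
    rewrite (_ : g1 * ((1 - x) * l) = (1 - x) * (g1 * l)); last by ring.
    by rewrite -mulrN ltr_wpDr// mulr_ge0// ltW.
  rewrite ler_ln_pos//; first by lra.
  rewrite ler_pdivlMr//.
  rewrite (_ : _ * (1 - x) = 1 - g1 * ((1 - x) * l) - x); last by ring.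
  lra.
have H3 : - ln (1 - x) <= 2 * x by rewrite ln_one_sub_ge// (ltW x0).
have H4 : x * (ln (1 - l) - ln (1 - expR (- tau))) <= x * (- l * excess + b).
  by rewrite ler_wpM2l ?(ltW x0)// /b; lra.
have H5 : x * b <= x * `|b| by rewrite ler_wpM2l ?ler_norm ?(ltW x0).
have E1 : x * (- l * excess + b) = (1 - x) * l * excess - l * excess + x * b by ring.
have E2 : x * (`|b| + 2) = x * `|b| + 2 * x by ring.
rewrite E1 in H4; rewrite E2 in xb; rewrite /exponent_all1 in H1 *.
move: H1 H2 H3 H4 H5 xb; set u := (1 - x) * l * _; set v := l * _.
by clear; lra.
Qed.

(** If [excess > 0], the term [l * excess] dominates the logarithms, so a nonnegative exponent
    forces [l] to be bounded; otherwise one multiplier serves every [x <= 1 - delta]. *)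
Lemma exponent_at_bounded_multiplier (c delta : R) : 0 < theta -> 0 <= c -> 0 < delta ->
  (forall x, 0 < x < 1 -> exists2 l, l <= 0 & c < exponent_at x l) ->
  exists2 L, 0 <= L & forall x, 0 < x <= 1 - delta ->
    exists2 l, - L <= l <= 0 & c < exponent_at x l.
Proof.
move=> th0 c0 d0 H.
have [a0|a0] := leP excess 0.
  have [l l0 Hl] := exponent_at_unbounded c delta th0 a0 d0.
  by exists (- l) => [|x xd]; [lra | exists l; rewrite ?opprK ?lexx//; exact: Hl].
(* Two logarithms are bounded by the tangent of slope [excess / 4], which leaves half of
   [l * excess]. *)
pose b := excess + 2 * (- 1 - ln (excess / 4)) + tau - ln (1 - expR (- tau)).
exists (2 * `|b| / excess); first by rewrite divr_ge0 ?(ltW a0)// mulr_ge0.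
move=> x /andP[x0 xd]; have x01 : 0 < x < 1 by apply/andP; split; lra.
have [l l0 cl] := H x x01; exists l => //; rewrite l0 andbT lerNl.
rewrite ler_pdivlMr//.
have a4 : 0 < excess / 4 by lra.
have l1 : 0 < 1 - l by lra.
have T := ln_tangent (1 - l) (excess / 4) l1 a4.
have := lt_le_trans cl (exponent_at_le x l x01 l0).
have g1l : 0 <= - (g1 * l) by rewrite oppr_ge0 mulr_ge0_le0.
have g0l : 0 <= - (g0 * l) by rewrite oppr_ge0 mulr_ge0_le0.
have H1 : ln (1 - g1 * l) <= ln (1 - l) by rewrite ler_ln_pos//; lra.
have H2 : x * ln (1 - l) <= ln (1 - l) by rewrite ler_piMl ?ln_ge0//; lra.
have p : 0 < 1 - expR (- tau) by have := one_sub_expRN_gt0 1 (lexx 1); rewrite mul1r.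
have H3 : x * - ln (1 - expR (- tau)) <= - ln (1 - expR (- tau)).
  rewrite ler_piMl ?oppr_ge0 ?ln_le0 ?gerBl ?expR_ge0//; lra.
have E : (1 - l) * (excess / 4) = excess / 4 - l * excess / 4 by ring.
rewrite E in T; have := ler_norm b; rewrite {1}/b.
set B := `|b|; rewrite /exponent_all1 mulNr; move: T H3.
set u := l * excess; set v := ln (1 - l) in H1 H2 *.
by rewrite !mulrDr; lra.
Qed.

(* Together with [exponent_all0_scale], a form of continuity of the suprema in
   [theta]: lowering [theta] costs a factor [s] on the multiplier and [- ln s]. *)
Lemma exponent_at_scale (x l s : R) : 0 < x < 1 -> l <= 0 -> 0 < s <= 1 ->
  exponent_at x l + l * (s * excess - excess) <= exponent_at x (s * l) - ln s.
Proof.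
move=> /andP[x0 x1] l0 /andP[s0 s1]; rewrite /exponent_at.
have y0 : 0 < 1 - x by rewrite subr_gt0.
have g0l : 0 <= - (g0 * l) by rewrite oppr_ge0 mulr_ge0_le0.
have g1l : 0 <= - (g1 * l) by rewrite oppr_ge0 mulr_ge0_le0.
(* [z + w <= (z + s * w) / s]; the weights [x] and [1 - x] add up to a single [- ln s]. *)
have K (z w : R) : 0 < z -> 0 <= w -> z * ln (z + w) <= z * ln (z + s * w) - z * ln s.
  move=> z0 w0; rewrite -mulrBr ler_wpM2l ?(ltW z0)// -ln_div ?posrE//; last first.
    by rewrite ltr_wpDr// mulr_ge0// ltW.
  rewrite ler_ln_pos ?ltr_wpDr// ler_pdivlMr// mulrDl [w * s]mulrC lerD2r.
  by rewrite ler_piMr// ltW.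
have H1 := K x _ x0 g0l.
have H2 := K (1 - x) _ y0 g1l.
have H3 : x * ln (1 - expR (- ((1 - g0 * (s * l) / x) * tau))) <=
   x * ln (1 - expR (- ((1 - g0 * l / x) * tau))).
  have sl0 : s * l <= 0 by rewrite mulr_ge0_le0// ltW.
  have t1 := tilt_ge1 g0 x (s * l) g0_ge0 x0 sl0.
  rewrite ler_wpM2l ?(ltW x0)// ler_ln_pos ?one_sub_expRN_gt0//.
  rewrite lerD2l lerN2 ler_expR lerN2 ler_wpM2r ?(ltW tau_gt0)// lerD2l lerN2.
  rewrite ler_wpM2r ?invr_ge0 ?(ltW x0)//.
  by rewrite ler_wpM2l// ler_scale_nonpos.
move: H1 H2; have -> : s * - (g0 * l) = - (g0 * (s * l)) by ring.
have -> : s * - (g1 * l) = - (g1 * (s * l)) by ring.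
have -> : l * (s * excess - excess) = s * l * excess - l * excess by ring.
lra.
Qed.

Lemma exponent_all0_scale (l s : R) : l <= 0 -> 0 < s <= 1 ->
  exponent_all0 l + l * (s * theta - theta) <= exponent_all0 (s * l) - ln s.
Proof.
move=> l0 /andP[s0 s1]; rewrite /exponent_all0.
have g0l : 0 <= - (g0 * l) by rewrite oppr_ge0 mulr_ge0_le0.
have H1 : ln (1 - g0 * l) <= ln (1 - g0 * (s * l)) - ln s.
  have E : - (g0 * (s * l)) = s * - (g0 * l) by ring.
  rewrite E -ln_div ?posrE//; last by rewrite ltr_wpDr// mulr_ge0// ltW.
  by rewrite ler_ln_pos ?ltr_wpDr// ler_pdivlMr// mulrDl mul1r [- _ * s]mulrC lerD2r.
have H3 : ln (1 - expR (- ((1 - g0 * (s * l)) * tau))) <=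
   ln (1 - expR (- ((1 - g0 * l) * tau))).
  have sl0 : s * l <= 0 by rewrite mulr_ge0_le0// ltW.
  have := tilt_ge1 g0 1 (s * l) g0_ge0 ltr01 sl0; rewrite divr1 => t1.
  rewrite ler_ln_pos ?one_sub_expRN_gt0//.
  rewrite lerD2l lerN2 ler_expR lerN2 ler_wpM2r ?(ltW tau_gt0)// lerD2l lerN2.
  by rewrite ler_wpM2l// ler_scale_nonpos.
have -> : l * (s * theta - theta) = s * l * theta - l * theta by ring.
lra.
Qed.

(** Makes the minimum finite even when the infimum over [x] is infinite. *)
Lemma exponent_all0_bounded : 0 < theta ->
  exists c, forall l, l <= 0 -> exponent_all0 l <= c.
Proof.
move=> th0; exists (theta - 1 - ln theta - ln (1 - expR (- tau))) => l l0.
have l1 : 0 < 1 - l by lra.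
have T := ln_tangent (1 - l) theta l1 th0.
have g0l : 0 <= - (g0 * l) by rewrite oppr_ge0 mulr_ge0_le0.
have gl : - (g0 * l) <= - l.
  by rewrite -mulrN ler_piMl ?oppr_ge0//; case/andP: g0_01.
have H1 : ln (1 - g0 * l) <= ln (1 - l) by rewrite ler_ln_pos//; lra.
have p : 0 < 1 - expR (- tau) by have := one_sub_expRN_gt0 1 (lexx 1); rewrite mul1r.
have H2 : ln (1 - expR (- tau)) <= ln (1 - expR (- ((1 - g0 * l) * tau))).
  rewrite ler_ln_pos// lerD2l lerN2 ler_expR lerN2 ler_peMl ?(ltW tau_gt0)//.
  by lra.
by rewrite /exponent_all0; lra.
Qed.

End exponents.

(** * Asymptotic upper bound on the outage probability *)

Lemma exists_nat_gt {R : realType} (x : R) : exists2 n, (0 < n)%N & x < n%:R.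
Proof.
exists (Num.bound `|x|).+1 => //; apply: le_lt_trans (ler_norm x) _.
by apply: (lt_trans (archi_boundP (normr_ge0 x))); rewrite ltr_nat.
Qed.

Section prefactor.
Context {R : realType}.
Variables (tau g0 theta rho : R).
Hypotheses (tau_gt0 : 0 < tau) (g0_01 : 0 <= g0 <= 1).
Hypotheses (theta_gt0 : 0 < theta) (rho_gt0 : 0 < rho).
Local Notation g1 := (1 - g0).

Let g0_ge0 : 0 <= g0. Proof. by case/andP: g0_01. Qed.
Let g1_ge0 : 0 <= g1. Proof. by rewrite subr_ge0; case/andP: g0_01. Qed.
Let g0_le1 : g0 <= 1. Proof. by case/andP: g0_01. Qed.

(* The bound [outage_upper] without its quantization errors. *)
Definition prefactor (l a0 a1 : R) (K k : nat) : R :=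
  let kappa := l * K%:R / rho in
  'C(K, k)%:R * expR (- (l * K%:R * theta)) *
  (expmass 0 tau (1 - kappa * a0)) ^+ k *
  (mass_above tau (1 - kappa * a1)) ^+ (K - k).

Lemma prefactor_mid (c l : R) (K k : nat) : (0 < k)%N -> (k < K)%N -> l <= 0 ->
  c < exponent_at tau g0 theta (k%:R / K%:R) l ->
  prefactor l (g0 * rho / k%:R) (g1 * rho / (K - k)%:R) K k <= expR (- (c * K%:R)).
Proof.
move=> k0 kK l0; set x : R := k%:R / K%:R.
have K0 : 0 < K%:R :> R by rewrite ltr0n (leq_trans _ kK).
have kR : 0 < k%:R :> R by rewrite ltr0n.
have nR : 0 < (K - k)%:R :> R by rewrite ltr0n subn_gt0.
have yE : 1 - x = (K - k)%:R / K%:R.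
  by rewrite /x natrB ?(ltnW kK)//; field; rewrite gt_eqF.
have x0 : 0 < x by rewrite divr_gt0.
have y0 : 0 < 1 - x by rewrite yE divr_gt0.
have x01 : 0 < x < 1 by rewrite x0 -subr_gt0.
rewrite exponent_at_mass// => Hc.
rewrite /prefactor.
have -> : l * K%:R / rho * (g0 * rho / k%:R) = g0 * l / x.
  by rewrite /x; field; rewrite !gt_eqF.
have -> : l * K%:R / rho * (g1 * rho / (K - k)%:R) = g1 * l / (1 - x).
  by rewrite yE; field; rewrite !gt_eqF.
have s0 := tilt_ge1 g0 x l g0_ge0 x0 l0.
have s1 := tilt_ge1 g1 (1 - x) l g1_ge0 y0 l0.
have m0 := expmass0_gt0 tau tau_gt0 _ s0.
have m1 := mass_above_gt0 tau _ s1.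
set X := expmass _ _ _ in m0 Hc *; set Y := mass_above _ _ in m1 Hc *.
have B := binomial_mode_le K k x (ltnW kK) _.
have {}B : 'C(K, k)%:R * (x ^+ k * (1 - x) ^+ (K - k)) <= 1.
  by apply: B; rewrite (ltW x0) /= -subr_ge0 ltW.
have -> : 'C(K, k)%:R * expR (- (l * K%:R * theta)) * X ^+ k * Y ^+ (K - k) =
  'C(K, k)%:R * (x ^+ k * (1 - x) ^+ (K - k)) *
  (expR (- (l * K%:R * theta)) * (X / x) ^+ k * (Y / (1 - x)) ^+ (K - k)).
  have E (a b u v C e : R) i j : u != 0 -> v != 0 -> C * e * a ^+ i * b ^+ j =
      C * (u ^+ i * v ^+ j) * (e * (a / u) ^+ i * (b / v) ^+ j).
    move=> /(expf_neq0 i) u0 /(expf_neq0 j) v0; rewrite !expr_div_n.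
    move: (u ^+ i) (v ^+ j) u0 v0 => u' v' u0 v0.
    by field; rewrite ?u0 ?v0.
  by apply: E; rewrite gt_eqF.
apply: (@le_trans _ _ (1 * (expR (- (l * K%:R * theta)) * (X / x) ^+ k *
    (Y / (1 - x)) ^+ (K - k)))).
  by rewrite ler_wpM2r// !mulr_ge0 ?expR_ge0// exprn_ge0// divr_ge0// ltW.
rewrite mul1r (exp_ln_pow k _ (divr_gt0 m0 x0)) (exp_ln_pow (K - k) _ (divr_gt0 m1 y0)).
rewrite -!expRD ler_expR.
have -> : ln (X / x) = ln X - ln x by rewrite ln_div ?posrE.
have -> : ln (Y / (1 - x)) = ln Y - ln (1 - x) by rewrite ln_div ?posrE.
have -> : (k%:R : R) = x * K%:R by rewrite /x divfK// gt_eqF.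
have -> : ((K - k)%:R : R) = (1 - x) * K%:R by rewrite yE divfK// gt_eqF.
have := ltW Hc; rewrite -(ler_pM2r K0) -lerN2; apply: le_trans.
by rewrite le_eqVlt; apply/orP; left; apply/eqP; ring.
Qed.

(** Near [k = K] the power is lowered to [g0 * rho / K], so that the tilt no longer depends on [k];
    the discarded channels contribute a factor at most 1, and [binomial_edge] controls the rest. *)
Lemma prefactor_all0 (c l t delta : R) (K k : nat) : (0 < K)%N -> (k <= K)%N ->
  l <= 0 -> 0 < t -> (K - k)%:R <= delta * K%:R ->
  c + t + delta * (`|ln t| + `|ln (expmass 0 tau (1 - g0 * l))|) <=
    exponent_all0 tau g0 theta l ->
  prefactor l (g0 * rho / K%:R) 0 K k <= expR (- (c * K%:R)).
Proof.
move=> K_gt0 kK l0 t0 kd; rewrite exponent_all0_mass// => Hc.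
have K0 : 0 < K%:R :> R by rewrite ltr0n.
rewrite /prefactor mulr0 subr0.
have -> : l * K%:R / rho * (g0 * rho / K%:R) = g0 * l.
  by field; rewrite !gt_eqF.
have := tilt_ge1 g0 1 l g0_ge0 ltr01 l0; rewrite divr1 => s0.
have m0 := expmass0_gt0 tau tau_gt0 _ s0.
set X := expmass _ _ _ in m0 Hc *.
have m1 : mass_above tau 1 <= 1.
  by rewrite /mass_above divr1 mul1r expR_le1 oppr_le0 ltW.
have B := binomial_edge K (K - k) X t delta (leq_subr _ _) m0 t0 kd.
rewrite bin_sub// subKn// in B.
apply: (@le_trans _ _ ('C(K, k)%:R * expR (- (l * K%:R * theta)) * X ^+ k)).
  rewrite ler_piMr ?mulr_ge0 ?expR_ge0 ?exprn_ge0 ?(ltW m0)//.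
  by rewrite exprn_ile1// divr_ge0 ?expR_ge0.
rewrite mulrAC; apply: (le_trans (ler_wpM2r (expR_ge0 _) B)).
rewrite -expRD ler_expR.
move: Hc; rewrite -(ler_pM2r K0) => Hc.
by rewrite -subr_ge0; move: Hc; rewrite -subr_ge0 => /le_trans; apply;
  rewrite le_eqVlt; apply/orP; left; apply/eqP; ring.
Qed.

Lemma prefactor_all1 (c l t delta : R) (K k : nat) : (0 < K)%N -> (k <= K)%N ->
  l <= 0 -> 0 < t -> k%:R <= delta * K%:R ->
  c + t + delta * (`|ln t| + `|ln (mass_above tau (1 - g1 * l))|) <=
    exponent_all1 tau g0 theta l ->
  prefactor l 0 (g1 * rho / K%:R) K k <= expR (- (c * K%:R)).
Proof.
move=> K_gt0 kK l0 t0 kd; rewrite exponent_all1_mass// => Hc.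
have K0 : 0 < K%:R :> R by rewrite ltr0n.
rewrite /prefactor mulr0 subr0.
have -> : l * K%:R / rho * (g1 * rho / K%:R) = g1 * l.
  by field; rewrite !gt_eqF.
have := tilt_ge1 g1 1 l g1_ge0 ltr01 l0; rewrite divr1 => s0.
have m0 := mass_above_gt0 tau _ s0.
set X := mass_above _ _ in m0 Hc *.
have m1 : expmass 0 tau 1 <= 1.
  by rewrite /expmass divr1 mulr0 oppr0 expR0 gerBl expR_ge0.
have B := binomial_edge K k X t delta kK m0 t0 kd.
apply: (@le_trans _ _ ('C(K, k)%:R * expR (- (l * K%:R * theta)) * X ^+ (K - k))).
  rewrite ler_wpM2r ?exprn_ge0 ?(ltW m0)//.
  rewrite ler_piMr ?mulr_ge0 ?expR_ge0//.
  by rewrite exprn_ile1// ltW// expmass0_gt0.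
rewrite mulrAC; apply: (le_trans (ler_wpM2r (expR_ge0 _) B)).
rewrite -expRD ler_expR.
move: Hc; rewrite -(ler_pM2r K0) => Hc.
by rewrite -subr_ge0; move: Hc; rewrite -subr_ge0 => /le_trans; apply;
  rewrite le_eqVlt; apply/orP; left; apply/eqP; ring.
Qed.

(** The two edges and the middle range of [k] use the three preceding bounds. [L] and [delta] depend
    on neither [K] nor [k], so the quantization can be fixed afterwards, before [K] grows. *)
Lemma prefactor_uniform (c c' : R) : 0 <= c -> c < c' ->
  (exists2 l, l <= 0 & c' < exponent_all0 tau g0 theta l) ->
  (forall x, 0 < x < 1 -> exists2 l, l <= 0 & c' < exponent_at tau g0 theta x l) ->
  exists L delta, [/\ 0 <= L, 0 < delta <= 1 &
    forall K k, (0 < K)%N -> (k <= K)%N -> exists l a0 a1,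
    [/\ - L <= l <= 0, 0 <= a0 <= g0 * rho / k%:R, 0 <= a1 <= g1 * rho / (K - k)%:R,
        a0 <= rho / (delta * K%:R) /\ a1 <= rho / (delta * K%:R) &
        prefactor l a0 a1 K k <= expR (- (c * K%:R))]].
Proof.
move=> c0 cc [l0 l0_le0 Hl0] Hx.
pose e := (c' - c) / 4.
have e0 : 0 < e by rewrite divr_gt0// subr_gt0.
have ee : c' = c + 4 * e by rewrite /e; field.
have [l1 l1_le0 Hl1] : exists2 l, l <= 0 & c + 2 * e < exponent_all1 tau g0 theta l.
  by apply: (exponent_all1_gt _ _ _ _ _ _ c') => //; rewrite /e; lra.
(* [M] dominates the logarithms of [binomial_edge] at both edges. With [t = e] and [delta * M <= e]
   each edge loses at most [2 * e]. *)
pose M := `|ln e| + `|ln (expmass 0 tau (1 - g0 * l0))| +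
  `|ln (mass_above tau (1 - g1 * l1))| + 1.
have M0 : 0 < M by rewrite ltr_wpDl// !addr_ge0.
pose delta := Num.min (1 / 2) (e / M).
have d0 : 0 < delta by rewrite lt_min; apply/andP; split; [lra | rewrite divr_gt0].
have d2 : delta <= 1 / 2 by rewrite ge_min lexx.
have dM : delta * M <= e by rewrite -ler_pdivlMr// ge_min lexx orbT.
have Hx' x : 0 < x < 1 -> exists2 l, l <= 0 & c < exponent_at tau g0 theta x l.
  by move=> /Hx[l ? /(lt_trans cc)]; exists l.
have [L L0 HL] := exponent_at_bounded_multiplier tau g0 theta tau_gt0 g0_01
  c delta theta_gt0 c0 d0 Hx'.
exists (L + `|l0| + `|l1|), delta; split.
- by rewrite !addr_ge0.
- by rewrite d0; lra.
move=> K k K_gt0 kK; have K0 : 0 < K%:R :> R by rewrite ltr0n.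
have N0 := normr_ge0 l0; have N1 := normr_ge0 l1.
have dK0 : 0 < delta * K%:R by rewrite mulr_gt0.
have power g (m : nat) : 0 <= g <= 1 -> delta * K%:R <= m%:R ->
    0 <= g * rho / m%:R <= rho / (delta * K%:R).
  move=> /andP[g_0 g_1] dm; rewrite divr_ge0 ?mulr_ge0 ?(ltW rho_gt0)//=.
  have m0 : 0 < m%:R :> R by exact: lt_le_trans dm.
  apply: (@le_trans _ _ (rho / m%:R)).
    by rewrite ler_wpM2r ?invr_ge0 ?(ltW m0)// ler_piMl// ltW.
  by rewrite ler_pM2l// lef_pV2.
have dKK : delta * K%:R <= K%:R by rewrite ler_piMl ?(ltW K0)//; lra.
have grow g (m : nat) : 0 <= g <= 1 -> (0 < m)%N -> (m <= K)%N ->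
    0 <= g * rho / K%:R <= g * rho / m%:R.
  move=> /andP[g_0 g_1] m0 mK; rewrite divr_ge0 ?mulr_ge0 ?(ltW rho_gt0) ?(ltW K0)//=.
  by rewrite ler_wpM2l ?mulr_ge0 ?(ltW rho_gt0)// lef_pV2 ?posrE ?ltr0n// ler_nat.
have g0' : 0 <= g0 <= 1 by [].
have g1' : 0 <= g1 <= 1 by rewrite g1_ge0 gerBl.
have ar0 : 0 <= rho / (delta * K%:R) by rewrite ltW// divr_gt0.
have [hi|hi] := leP (K - k)%:R (delta * K%:R).
  exists l0, (g0 * rho / K%:R), 0; split.
  - rewrite l0_le0 andbT lerNl; have := ler_norm (- l0); rewrite normrN; lra.
  - apply: grow => //; rewrite lt0n; apply/eqP => k0.
    move: hi; rewrite k0 subn0; have : 0 < (1 / 2 - delta + 1 / 2) * K%:R.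
      by rewrite mulr_gt0//; lra.
    rewrite !mulrDl mulNr; lra.
  - by rewrite lexx/= divr_ge0// mulr_ge0// ltW.
  - by split=> //; case/andP: (power g0 K g0' dKK).
  - apply: (prefactor_all0 c l0 e delta) => //.
    have : delta * (`|ln e| + `|ln (expmass 0 tau (1 - g0 * l0))|) <= delta * M.
      rewrite ler_wpM2l ?(ltW d0)// /M.
      by have := normr_ge0 (ln (mass_above tau (1 - g1 * l1))); lra.
    by move: Hl0 dM ee; lra.
have [lo|lo] := leP k%:R (delta * K%:R).
  exists l1, 0, (g1 * rho / K%:R); split.
  - rewrite l1_le0 andbT lerNl; have := ler_norm (- l1); rewrite normrN; lra.
  - by rewrite lexx/= divr_ge0// mulr_ge0// ltW.
  - apply: grow => //; last exact: leq_subr.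
    by rewrite -(ltr_nat R); exact: lt_trans hi.
  - by split=> //; case/andP: (power g1 K g1' dKK).
  - apply: (prefactor_all1 c l1 e delta) => //.
    have : delta * (`|ln e| + `|ln (mass_above tau (1 - g1 * l1))|) <= delta * M.
      rewrite ler_wpM2l ?(ltW d0)// /M.
      by have := normr_ge0 (ln (expmass 0 tau (1 - g0 * l0))); lra.
    by move: Hl1 dM ee; lra.
have k0 : (0 < k)%N by rewrite -(ltr_nat R); exact: lt_trans lo.
have kK' : (k < K)%N by rewrite -subn_gt0 -(ltr_nat R); exact: lt_trans hi.
have [|l /andP[Ll l_0] Hl] := HL (k%:R / K%:R).
  rewrite divr_gt0 ?ltr0n//= ler_pdivrMr//.
  by move: hi; rewrite natrB// mulrBl mul1r; lra.
exists l, (g0 * rho / k%:R), (g1 * rho / (K - k)%:R); split.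
- by rewrite l_0 andbT; lra.
- by rewrite lexx andbT; case/andP: (power g0 k g0' (ltW lo)).
- by rewrite lexx andbT; case/andP: (power g1 _ g1' (ltW hi)).
- by split; [case/andP: (power g0 k g0' (ltW lo)) | case/andP: (power g1 _ g1' (ltW hi))].
- exact: prefactor_mid.
Qed.

End prefactor.

Section upper_limit.
Context {R : realType} {d : measure_display} {T : measurableType d}.
Variables (P : probability T R) (tau g0 rho theta : R).
Variables (K0 : nat -> {RV P >-> nat}) (A0 A1 : nat -> {RV P >-> R}).
Hypotheses (tau_gt0 : 0 < tau) (g0_01 : 0 <= g0 <= 1) (rho_gt0 : 0 < rho).
Hypotheses (theta_gt0 : 0 < theta).
Hypothesis feedback : one_bit_feedback tau K0 A0 A1.

Local Notation outage := (outage P g0 rho theta K0 A0 A1).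

(** The linearization error stays bounded in [K]; only the cell width and the truncation contribute
    a term linear in [K], with a coefficient that [h] and [n] make small. *)
Lemma outage_at_le_prefactor (l L h delta a0 a1 : R) (N n K k : nat) :
  - L <= l <= 0 -> 0 < h -> N%:R * h = tau -> (0 < n)%N -> (0 < K)%N -> (k <= K)%N ->
  0 < delta <= 1 ->
  0 <= a0 <= g0 * rho / k%:R -> 0 <= a1 <= (1 - g0) * rho / (K - k)%:R ->
  a0 <= rho / (delta * K%:R) -> a1 <= rho / (delta * K%:R) ->
  (P (outage K `&` (K0 K @^-1` [set k])) <=
   (prefactor tau theta rho l a0 a1 K k *
    expR (L * rho * (tau + n%:R * h) ^+ 2 / delta ^+ 2 +
          K%:R * (h * (1 + L / delta) + (n%:R * h)^-1)))%:E)%E.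
Proof.
move=> /andP[Ll l0] h0 Nh n0 K_gt0 kK /andP[d0 d1] a0b a1b a0d a1d.
have KR : 0 < K%:R :> R by rewrite ltr0n.
have := @outage_upper R d T P tau g0 rho theta K0 A0 A1 tau_gt0 rho_gt0 feedback
  l h N n K k a0 a1 l0 h0 Nh n0 a0b a1b.
move=> /le_trans; apply; rewrite lee_fin /prefactor.
set kappa := l * K%:R / rho; set s0 := 1 - kappa * a0; set s1 := 1 - kappa * a1.
set D := n%:R * h; set W := tau + D.
have D0 : 0 < D by rewrite mulr_gt0// ltr0n.
have W0 : 0 <= W by rewrite addr_ge0 ?ltW.
have kappa0 : 0 <= - kappa.
  by rewrite oppr_ge0 /kappa pmulr_lle0 ?invr_gt0// mulr_le0_ge0.
have kappaL : - kappa <= L * K%:R / rho.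
  by rewrite /kappa -!mulNr ler_wpM2r ?invr_ge0 ?(ltW rho_gt0)// ler_wpM2r//; lra.
(* The logarithmic error per channel, common to both types. *)
pose q := L * rho * W ^+ 2 / delta ^+ 2 / K%:R + h * (1 + L / delta) + D^-1.
have bound (a w : R) : 0 <= a -> a <= rho / (delta * K%:R) -> 0 <= w <= W ->
    expR (- (kappa * a ^+ 2 * w ^+ 2)) * expR ((1 - kappa * a) * h) <=
    expR (q - D^-1).
  move=> a_ge0 a_le /andP[w0 wW]; rewrite -expRD ler_expR /q addrK; apply: lerD.
    have -> : - (kappa * a ^+ 2 * w ^+ 2) = - kappa * a ^+ 2 * w ^+ 2 by ring.
    apply: (@le_trans _ _ (L * K%:R / rho * (rho / (delta * K%:R)) ^+ 2 * W ^+ 2)).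
      apply: ler_pM => //.
      - by rewrite mulr_ge0 ?sqr_ge0.
      - exact: sqr_ge0.
      - apply: ler_pM; rewrite ?sqr_ge0//.
        by rewrite lerXn2r// nnegrE (le_trans a_ge0).
      - by rewrite lerXn2r// nnegrE.
    by rewrite le_eqVlt; apply/orP; left; apply/eqP; field; rewrite !gt_eqF.
  have -> : 1 - kappa * a = 1 + - kappa * a by ring.
  rewrite mulrC ler_wpM2l ?(ltW h0)// lerD2l.
  apply: (@le_trans _ _ (L * K%:R / rho * (rho / (delta * K%:R)))).
    by apply: ler_pM.
  by rewrite le_eqVlt; apply/orP; left; apply/eqP; field; rewrite !gt_eqF.
have s01 : 1 <= s0.
  have -> : s0 = 1 + - kappa * a0 by rewrite /s0; ring.
  by rewrite lerDl mulr_ge0//; case/andP: a0b.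
have s11 : 1 <= s1.
  have -> : s1 = 1 + - kappa * a1 by rewrite /s1; ring.
  by rewrite lerDl mulr_ge0//; case/andP: a1b.
have X0 := ltW (expmass0_gt0 tau tau_gt0 _ s01).
have Y0 := ltW (mass_above_gt0 tau _ s11).
rewrite -/(mass_above tau s1).
set X := expmass _ _ _ in X0 *; set Y := mass_above _ _ in Y0 *.
have Di : 0 < D^-1 by rewrite invr_gt0.
have b0 : expR (- (kappa * a0 ^+ 2 * tau ^+ 2)) * expR (s0 * h) <= expR q.
  have /andP[a00 _] := a0b.
  apply: (le_trans (bound a0 tau a00 a0d _)).
    by rewrite (ltW tau_gt0)/= lerDl ltW.
  by rewrite ler_expR gerBl ltW.
have b1 : expR (- (kappa * a1 ^+ 2 * W ^+ 2)) * expR (s1 * h) * (1 + D^-1) <= expR q.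
  have /andP[a10 _] := a1b.
  have -> : expR q = expR (q - D^-1) * expR D^-1 by rewrite -expRD subrK.
  apply: ler_pM; rewrite ?mulr_ge0 ?expR_ge0 ?expR_ge1Dx//.
    by rewrite addr_ge0// ltW.
  by apply: bound; rewrite // lexx W0.
have -> : expR (L * rho * W ^+ 2 / delta ^+ 2 + K%:R * (h * (1 + L / delta) + D^-1)) =
   expR q ^+ k * expR q ^+ (K - k).
  rewrite -exprD subnKC// -expRM_natl; congr expR; rewrite /q; field.
  by rewrite !gt_eqF.
set C := 'C(K, k)%:R * _.
have -> : C * X ^+ k * Y ^+ (K - k) * (expR q ^+ k * expR q ^+ (K - k)) =
  C * ((expR q * X) ^+ k) * ((expR q * Y) ^+ (K - k)).
  by rewrite !exprMn; ring.
have C0 : 0 <= C by rewrite mulr_ge0 ?expR_ge0.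
have pw (x y z : R) m : 0 <= x -> x <= y -> 0 <= z -> (x * z) ^+ m <= (y * z) ^+ m.
  move=> x0 xy z0; rewrite lerXn2r ?nnegrE ?mulr_ge0 ?ler_wpM2r//.
  exact: le_trans xy.
apply: ler_pM.
- by rewrite (mulr_ge0 C0)// exprn_ge0// (mulr_ge0 _ X0)// mulr_ge0 ?expR_ge0.
- rewrite exprn_ge0// (mulr_ge0 _ Y0)// mulr_ge0 ?addr_ge0 ?(ltW Di)//.
- by rewrite ler_wpM2l// pw// mulr_ge0 ?expR_ge0.
- by rewrite pw// mulr_ge0 ?addr_ge0 ?(ltW Di)// ?mulr_ge0 ?expR_ge0.
Qed.

Lemma linear_le_expR_near (e B : R) : 0 < e ->
  \forall K \near \oo, K.+1%:R * B <= expR (e * K%:R).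
Proof.
move=> e0; near=> K.
have K1 : 1 <= K%:R :> R by near: K; exact: nbhs_infty_ger.
have KB : 4 * `|B| / e ^+ 2 <= K%:R by near: K; exact: nbhs_infty_ger.
have e2 : 0 < e ^+ 2 by rewrite exprn_gt0.
have eK : 0 <= e * K%:R by rewrite mulr_ge0// ltW.
have := expR_ge1Dxn 1 eK; rewrite (_ : (2`!)%:R = 2)//.
apply: le_trans; rewrite ler_pdivrMr// in KB.
have H1 : K.+1%:R * B <= 2 * K%:R * `|B|.
  apply: (@le_trans _ _ (K.+1%:R * `|B|)); first by rewrite ler_wpM2l// ler_norm.
  by rewrite ler_wpM2r// -natr1; lra.
have H2 : K%:R * (4 * `|B|) <= K%:R * (K%:R * e ^+ 2) by rewrite ler_wpM2l.
apply: (le_trans H1); rewrite exprMn.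
have -> : e ^+ 2 * K%:R ^+ 2 = K%:R * (K%:R * e ^+ 2) by ring.
by lra.
Unshelve. all: by end_near.
Qed.

Lemma outage_le_near (c c' : R) : 0 <= c -> c < c' ->
  (exists2 l, l <= 0 & c' < exponent_all0 tau g0 theta l) ->
  (forall x, 0 < x < 1 -> exists2 l, l <= 0 & c' < exponent_at tau g0 theta x l) ->
  \forall K \near \oo, (P (outage K) <= (expR (- (c * K%:R)))%:E)%E.
Proof.
move=> c0 cc H0 Hx.
(* One [e] is kept below [c'], one pays for the quantization, and one for the bounded error together
   with the [K + 1] values of [K0]. *)
pose e := (c' - c) / 4.
have e0 : 0 < e by rewrite divr_gt0// subr_gt0.
have c1 : 0 <= c + 3 * e by lra.
have c1c : c + 3 * e < c' by rewrite /e; lra.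
have [L [delta [L0 d01 HL]]] :=
  prefactor_uniform tau g0 theta rho tau_gt0 g0_01 theta_gt0 rho_gt0 _ _ c1 c1c H0 Hx.
have d0 : 0 < delta by case/andP: d01.
have q0 : 0 < 1 + L / delta by rewrite ltr_wpDr// divr_ge0// ltW.
have [N N0 HN] := exists_nat_gt (tau * (1 + L / delta) * 2 / e).
pose h := tau / N%:R.
have NR : 0 < N%:R :> R by rewrite ltr0n.
have h0 : 0 < h by rewrite divr_gt0.
have Nh : N%:R * h = tau by rewrite /h mulrC divfK// gt_eqF.
have [n n0 Hn] := exists_nat_gt (2 / e / h).
have nR : 0 < n%:R :> R by rewrite ltr0n.
have Dh : (n%:R * h)^-1 <= e / 2.
  have e2 : 0 < 2 / e by rewrite divr_gt0.
  have nh : 0 < n%:R * h by exact: mulr_gt0.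
  by rewrite -[leRHS]invrK invf_div lef_pV2 ?posrE// -ler_pdivrMr// ltW.
have hq : h * (1 + L / delta) <= e / 2.
  rewrite /h mulrAC ler_pdivrMr//; move: HN; rewrite ltr_pdivrMr//.
  by set u := tau * _; lra.
pose B := L * rho * (tau + n%:R * h) ^+ 2 / delta ^+ 2.
near=> K.
have K_gt0 : (0 < K)%N by near: K; exact: nbhs_infty_gt.
have HB : K.+1%:R * expR B <= expR (e * K%:R).
  by near: K; exact: linear_le_expR_near.
apply: (le_trans (outage_le_sum P tau g0 rho theta K0 A0 A1 tau_gt0 feedback K)).
apply: (@le_trans _ _ (\sum_(k < K.+1) (expR (- ((c + 2 * e) * K%:R)) * expR B)%:E)%E).
  apply: lee_sum => k _; have kK : (k <= K)%N by rewrite -ltnS.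
  have [l [a0 [a1 [lL a0b a1b [a0d a1d] pf]]]] := HL K k K_gt0 kK.
  apply: (le_trans (outage_at_le_prefactor l L h delta a0 a1 N n K k
     lL h0 Nh n0 K_gt0 kK d01 a0b a1b a0d a1d)).
  rewrite lee_fin.
  apply: (le_trans (ler_wpM2r (expR_ge0 _) pf)).
  rewrite -!expRD ler_expR -/B.
  have : K%:R * (h * (1 + L / delta) + (n%:R * h)^-1) <= K%:R * e.
    by rewrite ler_wpM2l//; lra.
  rewrite !mulrDl; lra.
rewrite sumEFin lee_fin sumr_const card_ord -[leLHS]mulr_natl.
rewrite mulrCA; apply: (le_trans (ler_wpM2l (expR_ge0 _) HB)).
rewrite -expRD ler_expR.
have : 0 <= e * K%:R by rewrite mulr_ge0// ltW.
rewrite mulrDl; lra.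
Unshelve. all: by end_near.
Qed.

End upper_limit.

(** * Asymptotic lower bound on the outage probability *)

(** Chebyshev for [K] Bernoulli letters: words are indicators of subsets of ['I_K], and grouping
    them by cardinality produces the binomial weights. *)
Lemma binomial_window {R : realType} (x delta : R) (K : nat) :
  0 <= x <= 1 -> 0 < delta -> (0 < K)%N ->
  1 - (K%:R * delta ^+ 2)^-1 <=
  \sum_(k < K.+1 | `|k%:R - K%:R * x| <= K%:R * delta)
     'C(K, k)%:R * (x ^+ k * (1 - x) ^+ (K - k)).
Proof.
move=> /andP[x0 x1] d0 K0.
pose q (b : bool) : R := if b then x else 1 - x.
pose V (b : bool) : R := b%:R.
have H := @sum_ffun_chebyshev R bool K q V x 1 delta _ _ _ _ d0 K0.
rewrite expr1n div1r in H; apply: le_trans (H _ _ _ _) _.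
- by case; rewrite /q// subr_ge0.
- by rewrite big_bool /= /q; ring.
- by rewrite big_bool /q /V /= mulr1n mulr0n mulr1 mulr0 addr0.
- by case; rewrite /V /= ?ler01 lexx.
rewrite le_eqVlt; apply/orP; left; apply/eqP.
rewrite (reindex (fun A : {set 'I_K} => [ffun i => i \in A])); last first.
  exists (fun w : {ffun 'I_K -> bool} => [set i | w i]%SET) => [A|w] _.
    by apply/setP => i; rewrite inE ffunE.
  by apply/ffunP => i; rewrite ffunE inE.
have sumV (A : {set 'I_K}) : \sum_i V ([ffun i => i \in A] i) = #|A|%:R.
  under eq_bigr do rewrite ffunE /V.
  by rewrite -natr_sum -sum1_card [in RHS]big_mkcond/=; congr (_%:R);
    apply: eq_bigr => i _; case: (i \in A).
have prodq (A : {set 'I_K}) : \prod_i q ([ffun i => i \in A] i) =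
    x ^+ #|A| * (1 - x) ^+ (K - #|A|).
  under eq_bigr do rewrite ffunE /q.
  rewrite (bigID (mem A))/=; congr (_ * _).
    under eq_bigr => i -> do [].
    by rewrite prodr_const.
  under eq_bigr => i /negbTE -> do [].
  rewrite prodr_const; congr (_ ^+ _).
  have E := cardC (mem A); rewrite card_ord in E.
  apply: (@addnI #|A|); rewrite subnKC; last by rewrite -[leqRHS]E leq_addr.
  by rewrite -[RHS]E; congr addn; apply: eq_card => i; rewrite !inE.
under eq_bigl do rewrite sumV.
under eq_bigr do rewrite prodq.
have cardK (A : {set 'I_K}) : (#|A| < K.+1)%N.
  by rewrite ltnS (leq_trans (max_card _))// card_ord.
rewrite (partition_big (fun A : {set 'I_K} => inord #|A| : 'I_K.+1)
  (fun k : 'I_K.+1 => `|k%:R - K%:R * x| <= K%:R * delta))/=; last first.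
  by move=> A; rewrite inordK.
apply: eq_bigr => k Hk.
transitivity (\sum_(A in [set A : {set 'I_K} | #|A| == k]%SET) x ^+ k * (1 - x) ^+ (K - k)).
  apply: eq_big => [A|A /andP[_ /eqP <-]]; last by rewrite inordK.
  rewrite inE; apply/andP/eqP => [[_ /eqP <-]|Ak]; first by rewrite inordK.
  by rewrite Ak Hk; split=> //; apply/eqP/val_inj; rewrite /= inordK.
by rewrite sumr_const card_draws card_ord mulr_natl.
Qed.

(** The prefactor [c] cancels the one in the tilt [- L * c], so the error term does not depend on
    [c] and [c = 0], which occurs when a power vanishes, is allowed. *)
Lemma scaled_tilted_mean_le {R : realType} {C : finType} (q V : C -> R) (c0 : C)
    (c L : R) : (forall c, 0 < q c) -> (forall c, V c0 <= V c) -> 0 <= c -> 0 < L ->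
  c * tilted_mean q V (- L * c) <= c * V c0 + (\sum_i q i) / q c0 / L.
Proof.
move=> q0 Vmin; rewrite le_eqVlt => /predU1P[<-|cp] L0.
  rewrite !mul0r add0r !divr_ge0 ?(ltW L0) ?(ltW (q0 _))//.
  by apply: sumr_ge0 => i _; exact/ltW.
have := @tilted_mean_le R C q V q0 c0 (L * c) Vmin; rewrite mulr_gt0// => /(_ isT).
rewrite mulNr -(ler_pM2l cp) => /le_trans; apply.
rewrite mulrDr lerD2l le_eqVlt; apply/orP; left; apply/eqP.
by field; rewrite !gt_eqF.
Qed.

Lemma continuous_scaled_tilted_mean {R : realType} {C : finType} (q V : C -> R)
    (c0 : C) (a b : R) : (forall c, 0 < q c) ->
  continuous (fun l : R => a * tilted_mean q V (l * b)).
Proof.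
move=> q0 l; apply: cvgM; first exact: cvg_cst.
have cl : {for l, continuous (fun l : R => l * b)}.
  by apply: cvgM; [exact: cvg_id | exact: cvg_cst].
exact: (continuous_comp cl (continuous_tilted_mean q V q0 c0 (l * b))).
Qed.

Section window.
Context {R : realType}.
Variables (x delta : R) (K k : nat).
Hypotheses (kK : (k <= K)%N) (k_win : `|k%:R - K%:R * x| <= K%:R * delta).

Lemma window_bounds : delta <= x / 2 -> delta <= (1 - x) / 2 ->
  K%:R * (x / 2) <= k%:R /\ K%:R * ((1 - x) / 2) <= (K - k)%:R.
Proof.
move=> d1 d2; have K0 : 0 <= K%:R :> R by [].
have := ler_wpM2l K0 d1; have := ler_wpM2l K0 d2.
by move: k_win; rewrite natrB// ler_norml => /andP[]; split; lra.
Qed.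

(** [b0] and [b1] are logarithmic weights per channel of each type; replacing [k / K] by [x] costs
    at most [delta] times the sum of their sizes. *)
Lemma window_exponent (b0 b1 b e : R) : - (x * b0 + (1 - x) * b1) <= b ->
  delta * (`|b0| + `|b1|) <= e ->
  - ((b + e) * K%:R) <= k%:R * b0 + (K - k)%:R * b1.
Proof.
move=> Hb He; have K0 : 0 <= K%:R :> R by [].
pose z := k%:R - K%:R * x.
have zb (y : R) : z * y <= K%:R * delta * `|y|.
  by apply: (le_trans (ler_norm _)); rewrite normrM ler_wpM2r.
have z0 := zb (- b0); have z1 := zb b1; rewrite normrN in z0.
have -> : k%:R * b0 + (K - k)%:R * b1 =
  K%:R * (x * b0 + (1 - x) * b1) - (z * - b0 + z * b1) by rewrite natrB// /z; ring.
have := ler_wpM2l K0 Hb; have := ler_wpM2l K0 He.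
by move: z0 z1; clear; set u := `|b0|; set v := `|b1|; lra.
Qed.

End window.

(** The errors [u], [h] and [y] come from rescaling the multiplier, from the cell width and from the
    truncation. *)
Lemma error_budget {R : realType} (c e u h y : R) :
  u <= 3 * e / 64 -> h <= e / 16 -> y <= e / 16 -> 0 < e ->
  c + 2 * u + h + 2 * y <= c + e / 2.
Proof. lra. Qed.

Section lower_limit.
Context {R : realType} {d : measure_display} {T : measurableType d}.
Variables (P : probability T R) (tau g0 rho theta : R).
Variables (K0 : nat -> {RV P >-> nat}) (A0 A1 : nat -> {RV P >-> R}).
Hypotheses (tau_gt0 : 0 < tau) (g0_01 : 0 <= g0 <= 1) (rho_gt0 : 0 < rho).
Hypotheses (theta_gt0 : 0 < theta).
Hypothesis feedback : one_bit_feedback tau K0 A0 A1.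
Local Notation g1 := (1 - g0).
Local Notation excess := (theta - g1 * tau).

Local Notation outage := (outage P g0 rho theta K0 A0 A1).

Let g0_ge0 : 0 <= g0. Proof. by case/andP: g0_01. Qed.
Let g1_ge0 : 0 <= g1. Proof. by rewrite subr_ge0; case/andP: g0_01. Qed.
Let g0_le1 : g0 <= 1. Proof. by case/andP: g0_01. Qed.

Section mgf_bounds.
Variables (h : R) (N n : nat).
Hypotheses (h_gt0 : 0 < h) (Nh : N%:R * h = tau).

Lemma ln_mgf0_ge (mu : R) : mu <= 0 ->
  - ((1 - mu) * h) + ln (expmass 0 tau (1 - mu)) <=
  ln (mgf (mass0 h N) (value0 h N) mu).
Proof.
move=> mu0; have s1 : 1 <= 1 - mu by lra.
have m0 := expmass0_gt0 tau tau_gt0 _ s1.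
have := sum_cell_mass_high h 0 N (1 - mu) h_gt0 s1.
rewrite Nh add0r opprB addrCA subrr addr0 => H.
rewrite -[X in X + _]expRK -lnM ?posrE ?expR_gt0//.
by rewrite ler_ln_pos// mulr_gt0// expR_gt0.
Qed.

(** The truncation loses the factor [1 - expR (- ((1 - mu) * (n%:R * h)))], which is smallest for
    [mu = 0]. *)
Lemma ln_mgf1_ge (mu : R) : mu <= 0 -> (0 < n)%N ->
  - ((1 - mu) * h) + ln (mass_above tau (1 - mu)) + ln (1 - expR (- (n%:R * h))) <=
  ln (mgf (mass1 tau h n) (value1 tau h n) mu).
Proof.
move=> mu0 n0; have s1 : 1 <= 1 - mu by lra.
have D0 : 0 < n%:R * h by rewrite mulr_gt0// ltr0n.
have m1 := mass_above_gt0 tau _ s1.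
have := sum_cell_mass_high h tau n (1 - mu) h_gt0 s1.
rewrite (_ : 1 - (1 - mu) = mu); last by ring.
move=> H.
have e1 : 0 < 1 - expR (- (n%:R * h)) by rewrite subr_gt0 expR_lt1 oppr_lt0.
rewrite -[X in X + _ + _]expRK -!lnM ?posrE ?expR_gt0//; last first.
  by rewrite mulr_gt0// expR_gt0.
rewrite ler_ln_pos ?(mulr_gt0 (mulr_gt0 (expR_gt0 _) m1) e1)//.
apply: le_trans H; rewrite -mulrA ler_wpM2l ?expR_ge0// /expmass /mass_above.
rewrite mulrAC ler_wpM2r ?invr_ge0//; first by lra.
rewrite mulrBr mulr1 lerD2l lerN2 -expRD ler_expR.
rewrite mulrDr opprD lerD2l lerN2 ler_peMl//; exact: ltW.
Qed.

End mgf_bounds.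

Lemma expR_gap_near (b c M : R) : b < c -> 0 < M ->
  \forall K \near \oo, expR (- (c * K%:R)) <= expR (- (b * K%:R)) / M.
Proof.
move=> bc M0; have g : 0 < c - b by rewrite subr_gt0.
near=> K.
have KM : M / (c - b) <= K%:R by near: K; exact: nbhs_infty_ger.
rewrite ler_pdivrMr// in KM.
rewrite ler_pdivlMr//; apply: (@le_trans _ _ (expR (- (c * K%:R)) * expR (K%:R * (c - b)))).
  rewrite ler_wpM2l ?expR_ge0//; apply: (le_trans KM).
  by apply: le_trans (expR_ge1Dx _); rewrite lerDr.
by rewrite -expRD ler_expR; lra.
Unshelve. all: by end_near.
Qed.

(** With [B] the weight per channel, [- ln B] is at most [exponent_all0 l - l * (2 * eps + h) + h].
    The middle term is [l * (s * theta - theta)], so [exponent_all0_scale] passes to the multiplier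
    [s * l], at which the exponent is at most [c0]. *)
Lemma outage_ge_all0_near (c c0 : R) : c0 < c ->
  (forall l, l <= 0 -> exponent_all0 tau g0 theta l <= c0) ->
  \forall K \near \oo, ((expR (- (c * K%:R)))%:E <= P (outage K))%E.
Proof.
move=> cc Hc0.
pose e0 := c - c0; have e0_gt0 : 0 < e0 by rewrite subr_gt0.
(* The first bound keeps [s >= 1/2] and lets the mean reach [theta - eps], the second makes [- ln s]
   small against [e0], the third the remaining [h]. *)
pose eps := Num.min (theta / 8) (Num.min (theta * e0 / 32) (e0 / 4)).
have eps0 : 0 < eps by rewrite !lt_min !divr_gt0// mulr_gt0.
have eps1 : eps <= theta / 8 by rewrite ge_min lexx.
have eps2 : eps <= theta * e0 / 32 by rewrite !ge_min lexx orbT.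
have eps3 : eps <= e0 / 4 by rewrite !ge_min lexx !orbT.
move: eps eps0 eps1 eps2 eps3 => eps eps0 eps1 eps2 eps3.
have [N N0 HN] := exists_nat_gt (tau / eps).
have NR : 0 < N%:R :> R by rewrite ltr0n.
pose h := tau / N%:R.
have h0 : 0 < h by rewrite divr_gt0.
have Nh : N%:R * h = tau by rewrite /h mulrC divfK// gt_eqF.
have heps : h <= eps.
  by rewrite /h ler_pdivrMr// mulrC -ler_pdivrMr// ltW.
move: h h0 Nh heps => h h0 Nh heps.
pose t0 := tilted_mean (mass0 h N) (value0 h N).
pose i0 : 'I_N := Ordinal N0.
have q0 j : 0 < mass0 h N j by exact: mass0_gt0.
pose m l := g0 * t0 (l * g0).
have mc : continuous m by exact: continuous_scaled_tilted_mean.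
pose Q := (\sum_j mass0 h N j) / mass0 h N i0.
have Q0 : 0 < Q.
  rewrite divr_gt0// (bigD1 i0)//= ltr_pwDl// sumr_ge0// => j _; exact/ltW.
have [||l [l0 ml lml]] := @ivt_or_zero R m (Q / eps) (theta - eps) _ mc.
- by rewrite divr_ge0// ltW.
- have := @scaled_tilted_mean_le R _ (mass0 h N) (value0 h N) i0 g0 (Q / eps) q0 _ g0_ge0 _.
  move=> /(_ _ _)/le_trans; apply.
  + by move=> j; rewrite /value0 lerD2l ler_wpM2r ?(ltW h0)// ler_nat.
  + by rewrite divr_gt0.
  rewrite -/Q invf_div mulrCA divff ?gt_eqF// mulr1 /value0 /= add0r mul1r.
  have : g0 * h <= h by rewrite ler_piMl// ltW.
  lra.
have lg0 : l * g0 <= 0 by rewrite mulr_le0_ge0.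
pose B := mgf (mass0 h N) (value0 h N) (l * g0) * expR (- (l * g0 * (t0 (l * g0) - eps))).
have M0 : 0 < mgf (mass0 h N) (value0 h N) (l * g0) by exact: mgf_gt0.
have B0 : 0 < B by rewrite mulr_gt0 ?expR_gt0.
pose s := 1 - (2 * eps + h) / theta.
have sE : (2 * eps + h) / theta <= 3 / 8.
  by rewrite ler_pdivrMr//; lra.
have sE' : 0 < (2 * eps + h) / theta by rewrite divr_gt0//; lra.
have sE2 : (2 * eps + h) / theta <= 3 * e0 / 32.
  by rewrite ler_pdivrMr//; lra.
have s01 : 0 < s <= 1 by rewrite /s; apply/andP; split; lra.
have lnB : - ln B <= c0 + e0 / 2.
  have H1 := ln_mgf0_ge h N h0 Nh _ lg0.
  have H2 := exponent_all0_scale tau g0 theta tau_gt0 g0_01 l s l0 s01.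
  have sl0 : s * l <= 0 by rewrite mulr_ge0_le0//; case/andP: s01 => /ltW.
  have H3 := Hc0 _ sl0.
  have H4 : - ln s <= 2 * ((2 * eps + h) / theta).
    by apply: ln_one_sub_ge; apply/andP; split; lra.
  have E : l * (s * theta - theta) = - l * (2 * eps + h).
    by rewrite /s; field; rewrite gt_eqF.
  rewrite E in H2.
  rewrite (exponent_all0_mass tau g0 theta tau_gt0 g0_01)// in H2.
  rewrite [l * g0]mulrC in H1.
  have H5 : - (l * g0) * eps <= - l * eps.
    rewrite ler_wpM2r ?(ltW eps0)// lerN2 -[leLHS]mulr1.
    by rewrite ler_wnM2l.
  have H6 : - (g0 * l) * h <= - l * h.
    rewrite ler_wpM2r ?(ltW h0)// lerN2 mulrC -[leLHS]mulr1.
    by rewrite ler_wnM2l.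
  rewrite /B lnM ?posrE ?expR_gt0// expRK.
  have E2 : l * g0 * (t0 (l * g0) - eps) = l * (theta - eps) - l * g0 * eps.
    by rewrite -lml /m; ring.
  rewrite E2 [X in mgf _ _ X]mulrC.
  set X := ln (mgf _ _ _) in H1 *; set Y := ln (expmass _ _ _) in H1 H2 *.
  move: H1 H2 H3 H4 H5 H6 eps3 sE2.
  set Z := exponent_all0 _ _ _ _; set U := _ / theta; set Z' := ln s.
  by clearbody X Y Z U Z'; rewrite /e0; lra.
near=> K.
have K_gt0 : (0 < K)%N by near: K; exact: nbhs_infty_gt.
(* No channel has feedback 1, so one cell above [tau] is enough. *)
have KW : 2 * (tau + 1%:R * h) ^+ 2 / eps ^+ 2 <= K%:R by near: K; exact: nbhs_infty_ger.
rewrite ler_pdivrMr ?exprn_gt0// in KW.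
have gap : expR (- (c * K%:R)) <= expR (- ((c0 + e0 / 2) * K%:R)) / 2.
  by near: K; apply: expR_gap_near => //; rewrite /e0; lra.
have cond : g0 * (t0 (l * g0) + eps) <= theta.
  rewrite mulrDr -lerBrDr; apply: (le_trans ml).
  by rewrite lerD2l lerN2 ler_piMl// ltW.
have := @outage_lower_all0 R d T P tau g0 rho theta K0 A0 A1 tau_gt0 g0_01 rho_gt0 feedback
  h N 1 h0 Nh K (l * g0) eps K_gt0 lg0 eps0 cond KW.
apply: le_trans; rewrite lee_fin -/B; apply: (le_trans gap).
rewrite ler_pM2r ?invr_gt0//.
rewrite exp_ln_pow// ler_expR -mulNr [leLHS]mulrC ler_wpM2l//.
by rewrite lerNl.
Unshelve. all: by end_near.
Qed.
(** The analogue for both types of channels: [x * mu0 = g0 * l] and [(1 - x) * mu1 = g1 * l], so the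
    two tilts recombine into one multiplier, and [exponent_at_scale] applies. *)
Lemma tilted_exponent_at_le (h : R) (N n : nat) (x l e c t0 t1 : R) :
  0 < h -> N%:R * h = tau -> (0 < n)%N -> 0 < x < 1 -> 0 < excess -> l <= 0 -> 0 < e ->
  (2 * e + h) / excess <= 1 / 2 -> expR (- (n%:R * h)) <= 1 / 2 ->
  g0 * l * t0 + g1 * l * t1 = l * (theta - e) ->
  (forall l, l <= 0 -> exponent_at tau g0 theta x l <= c) ->
  forall mu0 mu1, mu0 = l * (g0 / x) -> mu1 = l * (g1 / (1 - x)) ->
  (- (x * (ln (mgf (mass0 h N) (value0 h N) mu0) - mu0 * (t0 - e) - ln x) +
     (1 - x) * (ln (mgf (mass1 tau h n) (value1 tau h n) mu1) - mu1 * (t1 - e)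
                - ln (1 - x))) <=
  c + 2 * ((2 * e + h) / excess) + h + 2 * expR (- (n%:R * h))).
Proof.
move=> h0 Nh n0 x01 a0 l0 ep; set U := _ / excess => U1 HD2 mE Hc mu0 mu1 mu0E mu1E.
have /andP[x0 x1] := x01.
have y0 : 0 < 1 - x by rewrite subr_gt0.
have U0 : 0 < U by rewrite divr_gt0// addr_gt0// mulr_gt0.
pose s := 1 - U.
have s01 : 0 < s <= 1.
  rewrite /s subr_gt0 gerBl (ltW U0) andbT (le_lt_trans U1)//.
  by rewrite ltr_pdivrMr// mul1r ltr1n.
have mu00 : mu0 <= 0 by rewrite mu0E mulr_le0_ge0// divr_ge0// ltW.
have mu10 : mu1 <= 0 by rewrite mu1E mulr_le0_ge0// divr_ge0// ltW.
have {}mu0E : mu0 = g0 * l / x by rewrite mu0E; ring.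
have {}mu1E : mu1 = g1 * l / (1 - x) by rewrite mu1E; ring.
have H0 := ln_mgf0_ge h N h0 Nh _ mu00.
have H1 := ln_mgf1_ge h n h0 _ mu10 n0.
have H2 := exponent_at_scale tau g0 theta tau_gt0 g0_01 x l s x01 l0 s01.
have sl0 : s * l <= 0 by rewrite mulr_ge0_le0//; case/andP: s01 => /ltW.
have H3 := Hc _ sl0.
have H4 : - ln s <= 2 * U by apply: ln_one_sub_ge; rewrite (ltW U0).
have E : l * (s * excess - excess) = - l * (2 * e + h).
  by rewrite /s /U; field; rewrite gt_eqF.
rewrite E (exponent_at_mass tau g0 theta tau_gt0 g0_01 x l x01 l0) in H2.
have H5 : - ln (1 - expR (- (n%:R * h))) <= 2 * expR (- (n%:R * h)).
  by apply: ln_one_sub_ge; rewrite expR_ge0.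

rewrite -mu0E -mu1E in H2.
have xmu0 : x * mu0 = g0 * l by rewrite mu0E mulrC divfK// gt_eqF.
have ymu1 : (1 - x) * mu1 = g1 * l by rewrite mu1E mulrC divfK// gt_eqF.
have K0' := ler_wpM2l (ltW x0) H0.
have K1' := ler_wpM2l (ltW y0) H1.
have K5 : (1 - x) * - ln (1 - expR (- (n%:R * h))) <= 2 * expR (- (n%:R * h)).
  apply: (@le_trans _ _ ((1 - x) * (2 * expR (- (n%:R * h))))).
    by rewrite ler_wpM2l// ltW.
  by rewrite ler_piMl ?mulr_ge0 ?expR_ge0// gerBl ltW.
move: K0' K1' K5 H2 H3 H4.
set X0 := ln (mgf _ _ mu0); set X1 := ln (mgf _ _ mu1).
set Y0 := ln (expmass _ _ _); set Y1 := ln (mass_above _ _).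
set Z := exponent_at _ _ _ _ _; set Z' := ln s; set V := ln (1 - expR _).
set lx := ln x; set ly := ln (1 - x).
move: X0 X1 Y0 Y1 Z Z' V lx ly => X0 X1 Y0 Y1 Z Z' V lx ly K0' K1' K5 H2 H3 H4.
have -> : - (x * (X0 - mu0 * (t0 - e) - lx) + (1 - x) * (X1 - mu1 * (t1 - e) - ly)) =
   x * lx + (1 - x) * ly - x * X0 - (1 - x) * X1 + (x * mu0 * t0 + (1 - x) * mu1 * t1)
   - (x * mu0 + (1 - x) * mu1) * e by ring.
have F0 : x * (- ((1 - mu0) * h) + Y0) = - (x * h) + (x * mu0) * h + x * Y0 by ring.
have F1 : (1 - x) * (- ((1 - mu1) * h) + Y1 + V) =
   - ((1 - x) * h) + ((1 - x) * mu1) * h + (1 - x) * Y1 - (1 - x) * - V by ring.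
rewrite F0 in K0'; rewrite F1 in K1'; rewrite xmu0 in K0' *; rewrite ymu1 in K1' *.
rewrite mE; have -> : (g0 * l + g1 * l) * e = l * e by ring.
have K01 : - (x * X0 + (1 - x) * X1) <= h - l * h - x * Y0 - (1 - x) * Y1 +
   (1 - x) * - V by lra.
lra.
Qed.

(** The law of [K0] is tilted too, from [p0 tau] to [x]. Summing over a window of [k] keeps at least
    half of the tilted binomial mass, whereas a single [k] would require an estimate of
    ['C(K, k)]. *)
Lemma outage_ge_at_near (x c c0 : R) : 0 < x < 1 -> 0 < excess -> c0 < c ->
  (forall l, l <= 0 -> exponent_at tau g0 theta x l <= c0) ->
  \forall K \near \oo, ((expR (- (c * K%:R)))%:E <= P (outage K))%E.
Proof.
move=> x01 a0 cc Hc0; have /andP[x0 x1] := x01.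
have y0 : 0 < 1 - x by lra.
pose e0 := c - c0; have e0_gt0 : 0 < e0 by rewrite subr_gt0.
have e0E : e0 = c - c0 by [].
pose eps := Num.min (excess / 8) (Num.min (excess * e0 / 64) (e0 / 16)).
have eps0 : 0 < eps by rewrite !lt_min !divr_gt0// mulr_gt0.
have eps1 : eps <= excess / 8 by rewrite ge_min lexx.
have eps2 : eps <= excess * e0 / 64 by rewrite !ge_min lexx orbT.
have eps3 : eps <= e0 / 16 by rewrite !ge_min lexx !orbT.
move: e0 eps eps0 eps1 eps2 eps3 e0_gt0 e0E => e0 eps eps0 eps1 eps2 eps3 e0_gt0 e0E.
have [N N0 HN] := exists_nat_gt (tau / eps).
have NR : 0 < N%:R :> R by rewrite ltr0n.
pose h := tau / N%:R.
have h0 : 0 < h by rewrite divr_gt0.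
have Nh : N%:R * h = tau by rewrite /h mulrC divfK// gt_eqF.
have heps : h <= eps.
  by rewrite /h ler_pdivrMr// mulrC -ler_pdivrMr// ltW.
move: h h0 Nh heps => h h0 Nh heps.
(* With [expR (- D) <= D^-1] for [D = n * h], this makes the truncation error at most both 1/2 and
   [e0 / 16]. *)
have [n n0 Hn] := exists_nat_gt ((2 + 16 / e0) / h).
rewrite ltr_pdivrMr// in Hn.
pose t0 := tilted_mean (mass0 h N) (value0 h N).
pose t1 := tilted_mean (mass1 tau h n) (value1 tau h n).
pose i0 : 'I_N := Ordinal N0.
pose i1 : 'I_n := Ordinal n0.
have q0 j : 0 < mass0 h N j by exact: mass0_gt0.
have q1 j : 0 < mass1 tau h n j by exact: mass1_gt0.
pose m l := g0 * t0 (l * (g0 / x)) + g1 * t1 (l * (g1 / (1 - x))).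
have mc : continuous m.
  move=> l; apply: cvgD.
    exact: (continuous_scaled_tilted_mean (mass0 h N) (value0 h N) i0 g0 (g0 / x) q0 l).
  exact: (continuous_scaled_tilted_mean (mass1 tau h n) (value1 tau h n) i1 g1
    (g1 / (1 - x)) q1 l).
pose Q0 := (\sum_j mass0 h N j) / mass0 h N i0.
pose Q1 := (\sum_j mass1 tau h n j) / mass1 tau h n i1.
have Q0p : 0 < Q0.
  rewrite divr_gt0// (bigD1 i0)//= ltr_pwDl// sumr_ge0// => j _; exact/ltW.
have Q1p : 0 < Q1.
  rewrite divr_gt0// (bigD1 i1)//= ltr_pwDl// sumr_ge0// => j _; exact/ltW.
(* At [- L] the weighted mean exceeds its smallest value, at most [g1 * tau + h], by at most [eps];
   this is below [theta - eps] because [3 * eps <= excess]. *)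
pose L := (Q0 + Q1) / eps.
have Lp : 0 < L by rewrite divr_gt0// addr_gt0.
have QL (q : R) : q <= Q0 + Q1 -> q / L <= eps.
  move=> qQ; rewrite ler_pdivrMr// /L mulrCA divff ?mulr1//.
  by rewrite gt_eqF.
have gx0 : 0 <= g0 / x by rewrite divr_ge0// ltW.
have gy0 : 0 <= g1 / (1 - x) by rewrite divr_ge0// ltW.
have mL : m (- L) <= theta - eps.
  have V0min j : value0 h N i0 <= value0 h N j.
    by rewrite /value0 lerD2l ler_wpM2r ?(ltW h0)// ler_nat.
  have V1min j : value1 tau h n i1 <= value1 tau h n j.
    by rewrite /value1 lerD2l ler_wpM2r ?(ltW h0)// ler_nat.
  have H0 := scaled_tilted_mean_le (mass0 h N) (value0 h N) i0 (g0 / x) L q0 V0min gx0 Lp.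
  have H1 := scaled_tilted_mean_le (mass1 tau h n) (value1 tau h n) i1
    (g1 / (1 - x)) L q1 V1min gy0 Lp.
  have cancel (g u v : R) : 0 < u -> g * v = u * (g / u * v).
    by move=> u0; field; rewrite gt_eqF.
  have E0 := cancel g0 x (t0 (- L * (g0 / x))) x0.
  have E1 := cancel g1 (1 - x) (t1 (- L * (g1 / (1 - x)))) y0.
  rewrite -/t0 -/Q0 in H0; rewrite -/t1 -/Q1 in H1.
  have F0 := ler_wpM2l (ltW x0) H0; have F1 := ler_wpM2l (ltW y0) H1.
  rewrite -E0 in F0; rewrite -E1 in F1.
  rewrite /m; apply: (le_trans (lerD F0 F1)).
  have V0E : value0 h N i0 = h by rewrite /value0 /= add0r mul1r.
  have V1E : value1 tau h n i1 = tau + h by rewrite /value1 /= mul1r.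
  rewrite V0E V1E.
  have -> : x * (g0 / x * h + Q0 / L) + (1 - x) * (g1 / (1 - x) * (tau + h) + Q1 / L) =
    g1 * tau + h + (x * Q0 + (1 - x) * Q1) / L.
    by field; rewrite !gt_eqF.
  have : (x * Q0 + (1 - x) * Q1) / L <= eps.
    apply: QL; apply: lerD; rewrite ler_piMl ?(ltW Q0p) ?(ltW Q1p)//; lra.
  by move: heps eps1 eps0; lra.
have [l [l0 ml lml]] := ivt_or_zero m L (theta - eps) (ltW Lp) mc mL.
pose mu0 := l * (g0 / x); pose mu1 := l * (g1 / (1 - x)).
have mu00 : mu0 <= 0 by rewrite mulr_le0_ge0.
have mu10 : mu1 <= 0 by rewrite mulr_le0_ge0.
pose B0 := mgf (mass0 h N) (value0 h N) mu0 * expR (- (mu0 * (t0 mu0 - eps))).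
pose B1 := mgf (mass1 tau h n) (value1 tau h n) mu1 * expR (- (mu1 * (t1 mu1 - eps))).
have M0 : 0 < mgf (mass0 h N) (value0 h N) mu0 by exact: mgf_gt0.
have M1 : 0 < mgf (mass1 tau h n) (value1 tau h n) mu1 by exact: mgf_gt0.
have B0p : 0 < B0 by rewrite mulr_gt0 ?expR_gt0.
have B1p : 0 < B1 by rewrite mulr_gt0 ?expR_gt0.
(* Dividing by [x] and [1 - x] compensates for pairing ['C(K, k)] with the binomial weights of
   parameter [x]. *)
pose b0 := ln (B0 / x); pose b1 := ln (B1 / (1 - x)).
pose U := (2 * eps + h) / excess.
have U1 : U <= 1 / 2 by rewrite ler_pdivrMr//; lra.
have U2 : U <= 3 * e0 / 64 by rewrite ler_pdivrMr//; lra.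
have D0 : 2 + 16 / e0 < n%:R * h by [].
have e16 : 0 < 16 / e0 by rewrite divr_gt0.
have [HD2 HDe] : expR (- (n%:R * h)) <= 1 / 2 /\ expR (- (n%:R * h)) <= e0 / 16.
  have [D2 De] : 2 <= n%:R * h /\ 16 / e0 <= n%:R * h.
    by split; apply: le_trans (ltW D0); [rewrite lerDl ltW | rewrite lerDr].
  have Dp : 0 < n%:R * h by exact: lt_le_trans D2.
  have HD : expR (- (n%:R * h)) <= (n%:R * h)^-1.
    rewrite -[leRHS]mul1r ler_pdivlMr// mulrC.
    by have := mul_expRN_le 1 (n%:R * h) ltr01; rewrite invr1 mul1r.
  split; apply: (le_trans HD).
    by rewrite div1r lef_pV2 ?posrE.
  by rewrite -[leRHS]invrK invf_div lef_pV2 ?posrE.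
have mE : g0 * l * t0 mu0 + g1 * l * t1 mu1 = l * (theta - eps).
  by rewrite -lml /m -/mu0 -/mu1; ring.
have lnB : - (x * b0 + (1 - x) * b1) <= c0 + e0 / 2.
  have b0E : b0 = ln (mgf (mass0 h N) (value0 h N) mu0) - mu0 * (t0 mu0 - eps) - ln x.
    rewrite /b0 ln_div ?posrE//; congr (_ - _).
    by rewrite /B0 lnM ?posrE ?expR_gt0// expRK.
  have b1E : b1 = ln (mgf (mass1 tau h n) (value1 tau h n) mu1)
     - mu1 * (t1 mu1 - eps) - ln (1 - x).
    rewrite /b1 ln_div ?posrE//; congr (_ - _).
    by rewrite /B1 lnM ?posrE ?expR_gt0// expRK.
  rewrite b0E b1E.
  apply: (le_trans (tilted_exponent_at_le h N n x l eps c0 _ _ h0 Nh n0 x01 a0 l0 eps0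
    U1 HD2 mE Hc0 mu0 mu1 erefl erefl)).
  exact: error_budget U2 (le_trans heps eps3) HDe e0_gt0.
pose delta := Num.min (Num.min (x / 2) ((1 - x) / 2)) (e0 / 8 / (`|b0| + `|b1| + 1)).
have bp : 0 < `|b0| + `|b1| + 1 by rewrite ltr_wpDl// addr_ge0.
have d0 : 0 < delta by rewrite !lt_min !divr_gt0.
have d1 : delta <= x / 2 by rewrite !ge_min lexx.
have d2 : delta <= (1 - x) / 2 by rewrite !ge_min lexx orbT.
have d3 : delta * (`|b0| + `|b1|) <= e0 / 8.
  apply: (@le_trans _ _ (delta * (`|b0| + `|b1| + 1))).
    by rewrite ler_wpM2l ?(ltW d0)// lerDl.
  by rewrite -ler_pdivlMr// ge_min lexx orbT.
move: delta d0 d1 d2 d3 => delta d0 d1 d2 d3.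
near=> K.
have K_gt0 : (0 < K)%N by near: K; exact: nbhs_infty_gt.
have KR : 0 < K%:R :> R by rewrite ltr0n.
have Kd : 2 / delta ^+ 2 <= K%:R by near: K; exact: nbhs_infty_ger.
have KWx : 2 * (tau + n%:R * h) ^+ 2 / eps ^+ 2 / (x / 2) <= K%:R.
  by near: K; exact: nbhs_infty_ger.
have KWy : 2 * (tau + n%:R * h) ^+ 2 / eps ^+ 2 / ((1 - x) / 2) <= K%:R.
  by near: K; exact: nbhs_infty_ger.
(* [5 / 8] is [1 / 2] from [lnB] plus [1 / 8] from the window; 8 is the 4 of [outage_lower] times 2
   for the mass of the window. *)
have gap : expR (- (c * K%:R)) <= expR (- ((c0 + 5 * e0 / 8) * K%:R)) / 8.
  by near: K; apply: expR_gap_near => //; lra.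
have dd : 0 < delta ^+ 2 by exact: exprn_gt0.
have ee : 0 < eps ^+ 2 by exact: exprn_gt0.
rewrite ler_pdivrMr// in Kd.
rewrite ler_pdivrMr ?divr_gt0// ler_pdivrMr// in KWx.
rewrite ler_pdivrMr ?divr_gt0// ler_pdivrMr// in KWy.
pose win (k : 'I_K.+1) := `|k%:R - K%:R * x| <= K%:R * delta.
have Wbound (k : 'I_K.+1) : win k ->
   (('C(K, k)%:R * (x ^+ k * (1 - x) ^+ (K - k)) *
     (expR (- ((c0 + 5 * e0 / 8) * K%:R)) / 4))%:E
    <= P (outage K `&` (K0 K @^-1` [set (k : nat)])))%E.
  rewrite /win => Hk.
  have kK : (k <= K)%N by rewrite -ltnS.
  have [k1 k2] := window_bounds x delta K k kK Hk d1 d2.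
  have k_gt0 : (0 < k)%N.
    by rewrite -(ltr_nat R); apply: lt_le_trans k1; rewrite mulr_gt0// divr_gt0.
  have k_ltK : (k < K)%N.
    rewrite -subn_gt0 -(ltr_nat R); apply: lt_le_trans k2.
    by rewrite mulr_gt0// divr_gt0.
  have W0 : 2 * (tau + n%:R * h) ^+ 2 <= k%:R * eps ^+ 2.
    by apply: (le_trans KWx); rewrite ler_wpM2r// ltW.
  have W1 : 2 * (tau + n%:R * h) ^+ 2 <= (K - k)%:R * eps ^+ 2.
    by apply: (le_trans KWy); rewrite ler_wpM2r// ltW.
  have cond : g0 * (t0 mu0 + eps) + g1 * (t1 mu1 + eps) <= theta.
    have -> : g0 * (t0 mu0 + eps) + g1 * (t1 mu1 + eps) = m l + eps.
      by rewrite /m -/mu0 -/mu1; ring.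
    by rewrite -lerBrDr.
  have := @outage_lower R d T P tau g0 rho theta K0 A0 A1 tau_gt0 g0_01 rho_gt0 feedback
    h N n h0 Nh n0 K k mu0 mu1 eps k_gt0 k_ltK mu00 mu10 eps0 cond W0 W1.
  apply: le_trans; rewrite lee_fin -/t0 -/t1 -/B0 -/B1.
  have E (C u v a b : R) i j : u != 0 -> v != 0 -> C * (a ^+ i * b ^+ j) / 4 =
      C * (u ^+ i * v ^+ j) * ((a / u) ^+ i * (b / v) ^+ j / 4).
    move=> /(expf_neq0 i) u0 /(expf_neq0 j) v0; rewrite !expr_div_n.
    move: (u ^+ i) (v ^+ j) u0 v0 => u' v' u0 v0.
    by field; rewrite ?u0 ?v0.
  rewrite (E _ x (1 - x)) ?gt_eqF//.
  apply: ler_wpM2l.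
    by rewrite !mulr_ge0// exprn_ge0// ltW.
  rewrite ler_pM2r ?invr_gt0//.
  have -> : (B0 / x) ^+ k * (B1 / (1 - x)) ^+ (K - k) = expR (k%:R * b0 + (K - k)%:R * b1).
    rewrite expRD -(exp_ln_pow k _ (divr_gt0 B0p x0)).
    by rewrite -(exp_ln_pow (K - k) _ (divr_gt0 B1p y0)).
  have Hw := window_exponent x delta K k kK Hk b0 b1 _ _ lnB d3.
  rewrite ler_expR; apply: le_trans Hw.
  by rewrite lerN2 ler_wpM2r//; lra.
have sumW : 1 / 2 <= \sum_(k < K.+1 | win k) 'C(K, k)%:R * (x ^+ k * (1 - x) ^+ (K - k)).
  apply: le_trans (binomial_window x delta K _ d0 K_gt0); last by rewrite !ltW.
  rewrite lerBrDl -lerBrDr (_ : 1 - 1 / 2 = 2^-1); last by field.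
  by rewrite lef_pV2 ?posrE// mulr_gt0.
have mOut (k : 'I_K.+1) : measurable (outage K `&` (K0 K @^-1` [set (k : nat)])).
  exact: measurable_outage_at.
apply: (@le_trans _ _ (\sum_(k < K.+1 | win k)
    P (outage K `&` (K0 K @^-1` [set (k : nat)])))%E); last first.
  apply: ge_measure_disjoint; [exact: measurable_outage | exact: mOut | by move=> k _ w [] |].
  by move=> i j w [_ /= wi] [_ /= wj]; apply: val_inj; rewrite /= -wi -wj.
apply: (@le_trans _ _ (\sum_(k < K.+1 | win k) ('C(K, k)%:R * (x ^+ k * (1 - x) ^+ (K - k)) *
     (expR (- ((c0 + 5 * e0 / 8) * K%:R)) / 4))%:E)%E); last by apply: lee_sum.
rewrite sumEFin lee_fin -mulr_suml; apply: (le_trans gap).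
apply: (@le_trans _ _ (1 / 2 * (expR (- ((c0 + 5 * e0 / 8) * K%:R)) / 4))).
  by rewrite le_eqVlt; apply/orP; left; apply/eqP; field.
by rewrite ler_wpM2r// divr_ge0 ?expR_ge0.
Unshelve. all: by end_near.
Qed.
End lower_limit.

(** * The wideband outage exponent *)

Section exponent_limit.
Context {R : realType} {d : measure_display} {T : measurableType d}.
Variables (P : probability T R) (tau g0 rho eta : R).
Variables (K0 : nat -> {RV P >-> nat}) (A0 A1 : nat -> {RV P >-> R}).
Hypotheses (tau_gt0 : 0 < tau) (g0_01 : 0 <= g0 <= 1) (rho_gt0 : 0 < rho).
Hypotheses (eta_gt0 : 0 < eta).
Hypothesis feedback : one_bit_feedback tau K0 A0 A1.

Local Notation theta := (eta^-1).
Local Notation outage := (outage P g0 rho theta K0 A0 A1).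
Local Notation log_outage K := (normalized_log_outage P g0 (fun K => K0 K)
  (fun i => A0 i) (fun j => A1 j) rho eta K).
Local Notation limit := (mine (ereal_inf [set exponent tau g0 eta x | x in `]0, 1[])
             (exponent0 tau g0 eta)).

Let theta_gt0 : 0 < theta. Proof. by rewrite invr_gt0. Qed.

Lemma log_outageE K : log_outage K = (- lne (P (outage K)) * (K%:R^-1)%:E)%E.
Proof. by []. Qed.

Lemma log_outage_ge0 K : (0 <= log_outage K)%E.
Proof.
rewrite log_outageE mule_ge0 ?lee_fin ?invr_ge0// oppe_ge0 lne_le0.
exact: probability_le1 (measurable_outage P g0 rho theta K0 A0 A1 K).
Qed.

Lemma log_outage_ge (c : R) K : (0 < K)%N ->
  (P (outage K) <= (expR (- (c * K%:R)))%:E)%E -> (c%:E <= log_outage K)%E.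
Proof.
move=> K_gt0 HP; have KR : 0 < K%:R :> R by rewrite ltr0n.
have H : (lne (P (outage K)) <= (- (c * K%:R))%:E)%E.
  rewrite -[leRHS]expeRK lee_lne ?in_itv/= ?measure_ge0 ?leey ?lee_fin ?expR_ge0//.
rewrite log_outageE.
have -> : (c%:E = - (- (c * K%:R))%:E * (K%:R^-1)%:E)%E.
  by rewrite -EFinN -EFinM opprK mulfK// gt_eqF.
by apply: lee_wpmul2r; rewrite ?lee_fin ?invr_ge0// leeN2.
Qed.

Lemma log_outage_le (c : R) K : (0 < K)%N ->
  ((expR (- (c * K%:R)))%:E <= P (outage K))%E -> (log_outage K <= c%:E)%E.
Proof.
move=> K_gt0 HP; have KR : 0 < K%:R :> R by rewrite ltr0n.
have H : ((- (c * K%:R))%:E <= lne (P (outage K)))%E.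
  rewrite -[leLHS]expeRK lee_lne ?in_itv/= ?measure_ge0 ?leey ?lee_fin ?expR_ge0//.
rewrite log_outageE.
have -> : (c%:E = - (- (c * K%:R))%:E * (K%:R^-1)%:E)%E.
  by rewrite -EFinN -EFinM opprK mulfK// gt_eqF.
by apply: lee_wpmul2r; rewrite ?lee_fin ?invr_ge0// leeN2.
Qed.

Lemma exponent0E : exponent0 tau g0 eta =
  ereal_sup [set (exponent_all0 tau g0 theta l)%:E | l in [set l : R | l <= 0]].
Proof. by []. Qed.

Lemma exponentE x : 0 < x < 1 -> exponent tau g0 eta x =
  ereal_sup [set (exponent_at tau g0 theta x l)%:E | l in [set l : R | l <= 0]].
Proof.
move=> x01; rewrite /exponent; congr ereal_sup.
by apply/seteqP; split => y [l /= l0 <-]; exists l => //;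
  rewrite (exponent_at_alt tau g0 theta tau_gt0 g0_01).
Qed.

Lemma exponent_pinfty x : theta - (1 - g0) * tau <= 0 -> 0 < x < 1 ->
  exponent tau g0 eta x = +oo%E.
Proof.
move=> a0 x01; rewrite exponentE//; apply/eqyP => c _.
have /andP[x0 x1] := x01; have y0 : 0 < 1 - x by rewrite subr_gt0.
have [l l0 Hl] := exponent_at_unbounded tau g0 theta tau_gt0 g0_01 c (1 - x) theta_gt0 a0 y0.
apply: le_trans (ereal_sup_ubound _); last by exists l.
by rewrite lee_fin ltW//; apply: Hl; rewrite x0 subKr lexx.
Qed.

Lemma lt_limit_near (c c' : R) : c < c' -> (c'%:E < limit)%E ->
  \forall K \near \oo, (c%:E <= log_outage K)%E.
Proof.
move=> cc; rewrite lt_min => /andP[Hinf H0].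
(* [outage_le_near] is stated for [c >= 0]; negative [c] is covered because probabilities are at
   most 1. *)
have [c_lt0|c_ge0] := ltP c 0.
  near=> K; apply: le_trans (log_outage_ge0 K).
  by rewrite lee_fin ltW.
have all0 : exists2 l, l <= 0 & c' < exponent_all0 tau g0 theta l.
  move: H0; rewrite exponent0E => /ereal_sup_gt[_ [l /= l0 <-]].
  by rewrite lte_fin; exists l.
have at_x x : 0 < x < 1 -> exists2 l, l <= 0 & c' < exponent_at tau g0 theta x l.
  move=> x01.
  have : (c'%:E < exponent tau g0 eta x)%E.
    by apply: (lt_le_trans Hinf); apply: ereal_inf_lbound; exists x.
  rewrite exponentE// => /ereal_sup_gt[_ [l /= l0 <-]].
  by rewrite lte_fin; exists l.
near=> K; apply: log_outage_ge; first by near: K; exact: nbhs_infty_gt.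
near: K; exact: (outage_le_near P tau g0 rho theta K0 A0 A1 tau_gt0 g0_01 rho_gt0
  theta_gt0 feedback c c' c_ge0 cc all0 at_x).
Unshelve. all: by end_near.
Qed.

Lemma lt_fin_between (y : \bar R) (c : R) : (y < c%:E)%E ->
  exists2 c0 : R, c0 < c & (y <= c0%:E)%E.
Proof.
case: y => [r||] //; first by rewrite lte_fin; exists r.
by exists (c - 1); rewrite ?leNye// gtrBl.
Qed.

Lemma gt_limit_near (c : R) : (limit < c%:E)%E ->
  \forall K \near \oo, (log_outage K <= c%:E)%E.
Proof.
rewrite gt_min => /orP[|H0].
  move=> /ereal_inf_lt[_ [x x01 <-]]; rewrite /= in_itv/= in x01.
  have [a0|a0] := leP (theta - (1 - g0) * tau) 0; first by rewrite exponent_pinfty.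
  move=> /lt_fin_between[c0 cc]; rewrite exponentE// => Hx.
  have Hc0 l : l <= 0 -> exponent_at tau g0 theta x l <= c0.
    by move=> l0; rewrite -lee_fin; apply: le_trans Hx; apply: ereal_sup_ubound; exists l.
  near=> K; apply: log_outage_le; first by near: K; exact: nbhs_infty_gt.
  near: K; exact: (outage_ge_at_near P tau g0 rho theta K0 A0 A1 tau_gt0 g0_01 rho_gt0
    feedback x c c0 x01 a0 cc Hc0).
move: H0 => /lt_fin_between[c0 cc]; rewrite exponent0E => H0.
have Hc0 l : l <= 0 -> exponent_all0 tau g0 theta l <= c0.
  by move=> l0; rewrite -lee_fin; apply: le_trans H0; apply: ereal_sup_ubound; exists l.
near=> K; apply: log_outage_le; first by near: K; exact: nbhs_infty_gt.
near: K; exact: (outage_ge_all0_near P tau g0 rho theta K0 A0 A1 tau_gt0 g0_01 rho_gt0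
  theta_gt0 feedback c c0 cc Hc0).
Unshelve. all: by end_near.
Qed.

(** [exponent_all0_bounded] excludes [+oo]. If the minimum were [-oo], [gt_limit_near] would push
    [log_outage] to [-1] or below, whereas it is never negative. *)
Lemma limit_fin : limit \is a fin_num.
Proof.
have [c Hc] := exponent_all0_bounded tau g0 theta tau_gt0 g0_01 theta_gt0.
have lt_c : (limit < (c + 1)%:E)%E.
  apply: (@le_lt_trans _ _ (exponent0 tau g0 eta)); first by rewrite ge_min lexx orbT.
  apply: (@le_lt_trans _ _ c%:E); last by rewrite lte_fin ltrDl.
  rewrite exponent0E; apply: ge_ereal_sup => _ [l /= l0 <-].
  by rewrite lee_fin Hc.
rewrite fin_numE; apply/andP; split; apply/eqP => E; last first.
  by move: lt_c; rewrite E.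
have : (limit < (-1)%:E)%E by rewrite E ltNyr.
move=> /gt_limit_near [M _ HM]; have := HM M (leqnn M).
move=> /(le_trans (log_outage_ge0 M)); rewrite lee_fin.
by rewrite ler0N1.
Qed.

Lemma exponent_limit : log_outage K @[K --> \oo] --> limit.
Proof.
rewrite -(fineK limit_fin); set r := fine _.
have rE : limit = r%:E by rewrite fineK// limit_fin.
have bounds (e : R) : 0 < e ->
    \forall K \near \oo, ((r - e)%:E <= log_outage K <= (r + e)%:E)%E.
  move=> e0.
  have lower : \forall K \near \oo, ((r - e)%:E <= log_outage K)%E.
    apply: (@lt_limit_near _ (r - e / 2)); last by rewrite rE lte_fin gtrBl divr_gt0.
    by rewrite ltrD2l ltrN2 gtr_pMr// invf_lt1// ltr1n.
  have upper : \forall K \near \oo, (log_outage K <= (r + e)%:E)%E.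
    by apply: gt_limit_near; rewrite rE lte_fin ltrDl.
  by apply: filterS2 lower upper => K -> ->.
apply/fine_cvgP; split.
  have := bounds 1 ltr01; apply: filterS => K /andP[H1 H2].
  by rewrite fin_numE; apply/andP; split; apply/eqP => E; move: H1 H2; rewrite E.
apply/cvgrPdist_le => e e0; have := bounds e e0; apply: filterS => K /= /andP[].
case: (log_outage K) => [y||]//=; rewrite !lee_fin => H1 H2.
by rewrite ler_norml; apply/andP; split; lra.
Qed.

End exponent_limit.

Theorem proposition5 (R : realType) (d : measure_display)
    (T : measurableType d) (P : probability T R)
    (tau g0 rho eta : R)
    (K0 : nat -> {RV P >-> nat}) (A0 A1 : nat -> {RV P >-> R}) :
  0 < tau -> 0 <= g0 <= 1 -> 0 < rho -> 0 < eta ->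
  one_bit_feedback tau K0 A0 A1 ->
  (eta_bar tau g0 <= eta -> (eta%:E <= eta_max tau g0)%E ->
     is_wideband_outage_exponent P g0 K0 A0 A1 rho eta
       (mine (ereal_inf [set exponent tau g0 eta x | x in `]0, 1[])
             (exponent0 tau g0 eta)))
  /\
  ((eta_max tau g0 < eta%:E)%E ->
     is_wideband_outage_exponent P g0 K0 A0 A1 rho eta (exponent0 tau g0 eta)).
Proof.
move=> tau0 g01 rho0 eta0 fb.
have lim := exponent_limit P tau g0 rho eta K0 A0 A1 tau0 g01 rho0 eta0 fb.
split=> [_ _|]; first exact: lim.
rewrite /eta_max; case: ifPn => [_|g0n1]; first by rewrite ltNge leey.
rewrite lte_fin => Heta.
have g1p : 0 < 1 - g0.
  by rewrite subr_gt0 lt_neqAle g0n1; case/andP: g01.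
have a0 : eta^-1 - (1 - g0) * tau <= 0.
  rewrite subr_le0 -[leRHS]invrK lef_pV2 ?posrE ?invr_gt0 ?mulr_gt0//.
  exact: ltW.
rewrite (_ : exponent0 tau g0 eta =
  mine (ereal_inf [set exponent tau g0 eta x | x in `]0, 1[]) (exponent0 tau g0 eta));
  first exact: lim.
(* Here [eta^-1 - (1 - g0) * tau <= 0], so every exponent in the infimum is infinite and the minimum
   is its second term. *)
rewrite (_ : ereal_inf _ = +oo%E) ?minye//.
apply/eqP; rewrite -leye_eq; apply: le_ereal_inf_tmp => _ [x /= x01 <-].
rewrite in_itv/= in x01.
by rewrite (exponent_pinfty tau g0 eta tau0 g01 eta0 x a0 x01).
Qed.
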